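(* Let $(\alpha_n)$ be a Riemann sequence and let $$\zeta_\alpha(s)=\Xi_\alpha(0)\frac{\pi^{s/2}}{(s-1)\Gamma(1+s/2)}\prod_{n=1}^\infty\Bigl(1+\frac{(s-1/2)^2}{\alpha_n^2}\Bigr),$$ with $\Xi_\alpha(0)$ as defined in the context. Then $$\log\zeta_\alpha(s)\simeq0,\qquad\zeta_\alpha(s)\simeq1.$$
   Context: Asymptotic notation: for a function $f(z)$ defined on a half-plane $\operatorname{Re}z>a$, one writes $f(z)\simeq\sum_{n=0}^\infty\frac{b_n}{z^n}$ if for each natural number $N$ and any $0<\varepsilon<\frac{\pi}{2}$ we have $\lim_{z\to\infty}\bigl(f(z)-\sum_{n=0}^N\frac{b_n}{z^n}\bigr)z^N=0$ for $|\arg z|\le\frac{\pi}{2}-\varepsilon$; and $f\simeq g+\sum_n b_nz^{-n}$ means $f-g\simeq\sum_n b_nz^{-n}$. In particular $f\simeq0$ (resp. $f\simeq1$) means that $f$ (resp. $f-1$) has all coefficients $b_n=0$ in its expansion. Coefficients: $a_{2n+1}=\frac{8-E_{2n}}{2^{2n+2}}$ ($n\ge0$), $a_{2n}=\bigl(1-\frac{1}{2^{2n-1}}\bigr)\frac{B_{2n}}{4n}$ ($n\ge1$), with $\frac{2e^t}{e^{2t}+1}=\sum_{n\ge0} E_n\frac{t^n}{n!}$, $\frac{t}{e^t-1}=\sum_{n\ge0} B_n\frac{t^n}{n!}$. Riemann sequence: a sequence of complex numbers $(\alpha_n)_{n\ge1}$ is a Riemann sequence if: (a) $1<\operatorname{Re}\alpha_1\le\operatorname{Re}\alpha_2\le\cdots$;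 (b) each complex number $\alpha$ has finite multiplicity $\nu(\alpha)=\operatorname{card}\{n:\alpha_n=\alpha\}$, and $\nu(\alpha)=\nu(\overline\alpha)$ if $\alpha$ is not real; (c) there is a constant $C$ with $|\operatorname{Im}\alpha_n|<C$ for all $n$; (d) $|\arg\alpha_n|<\pi/4$, i.e. $|\operatorname{Im}\alpha_n|<\operatorname{Re}\alpha_n$, for all $n$; (e) $\sum_{k=1}^\infty\frac{2z}{z^2+\alpha_k^2}\simeq\frac12\log\frac{z}{2\pi}+\sum_{n=1}^\infty\frac{a_n}{z^n}$. The constant $\Xi_\alpha(0)$: for a Riemann sequence the limit $B=\lim_{x\to+\infty}\bigl\{\sum_{n}\log(1+\frac{x^2}{\alpha_n^2})-\frac x2\log\frac{x}{2\pi}+\frac x2-\frac74\log x\bigr\}$ (principal logarithms) exists and is real, and $\Xi_\alpha(0)$ is the positive real number defined by $B=\frac14\log\frac\pi2-\log\Xi_\alpha(0)$. Branch of the logarithm: $\zeta_\alpha$ has no zeros or poles in the half-plane $\operatorname{Re}s>\frac12+\max(C,\frac12)$ and is positive for real $s$ there; $\log\zeta_\alpha$ is the analytic branch on this half-plane that is real on the real axis. *)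

(* Defs.v *)
From Stdlib Require Import Reals List Arith.
From Coquelicot Require Import Coquelicot.
Open Scope R_scope.

(** Principal determinations; [Carg] takes its values in (-PI, PI] and is
    meaningful only away from [0]. *)
Definition Cexp (z : C) : C :=
  (exp (Re z) * cos (Im z), exp (Re z) * sin (Im z)).

Definition Carg (z : C) : R :=
  if Rle_dec 0 (Im z) then acos (Re z / Cmod z) else - acos (Re z / Cmod z).

Definition Clog (z : C) : C := (ln (Cmod z), Carg z).

(** [x ^ z] for a real base [x > 0]. *)
Definition Rcpower (x : R) (z : C) : C := Cexp (z * RtoC (ln x))%C.

(** Componentwise, as in the library's [C_lim]; this is the limit of [u]
    whenever [u] converges. *)
Definition Clim_seq (u : nat -> C) : C :=
  (real (Lim_seq (fun n => Re (u n))), real (Lim_seq (fun n => Im (u n)))).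

Definition CSeries (u : nat -> C) : C := Clim_seq (sum_n u).

(** Product of [u 0], ..., [u n]. *)
Fixpoint Cprod_n (u : nat -> C) (n : nat) : C :=
  match n with
  | O => u O
  | S m => (Cprod_n u m * u (S m))%C
  end.

Definition CProd (u : nat -> C) : C := Clim_seq (Cprod_n u).

(** Euler's limit: n! n^z / (z (z+1) ... (z+n)) as n goes to infinity, which
    gives Gamma on the whole plane minus its poles. *)
Definition CGamma (z : C) : C :=
  Clim_seq (fun n : nat =>
    (RtoC (INR (fact n)) * Rcpower (INR n) z
       / Cprod_n (fun k => z + RtoC (INR k)) n)%C).

Definition C_infty (P : C -> Prop) : Prop :=
  exists M : R, forall z : C, M < Cmod z -> P z.

Definition sector (eps : R) (z : C) : Prop := Rabs (Carg z) <= PI / 2 - eps.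

(** [f ~ sum_n b_n / z^n].  Only values of [f] at points of large modulus in a
    sector are used, and those points lie in any given half-plane [a < Re z];
    so the values that a total [f] takes outside the half-plane where it is
    meant to be defined do not matter. *)
Definition asymp (f : C -> C) (b : nat -> C) : Prop :=
  forall (N : nat) (eps : R), 0 < eps < PI / 2 ->
  filterlim (fun z : C => ((f z - sum_n (fun n => b n / z ^ n) N) * z ^ N)%C)
    (within (sector eps) C_infty) (locally (RtoC 0)).

(** [f t = sum_n c_n t^n / n!] near [0]; [t = 0] is excluded because [f] may
    have a removable singularity there. *)
Definition is_egf (c : nat -> R) (f : R -> R) : Prop :=
  locally' 0 (fun t => is_pseries (fun n => c n / INR (fact n)) t (f t)).

Definition Euler_numbers (E : nat -> R) : Prop :=
  is_egf E (fun t => 2 * exp t / (exp (2 * t) + 1)).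

Definition Bernoulli_numbers (B : nat -> R) : Prop :=
  is_egf B (fun t => t / (exp t - 1)).

(** The coefficients a_n for n >= 1, and 0 for n = 0. *)
Definition coef_a (E B : nat -> R) (n : nat) : R :=
  let m := Nat.div2 n in
  if Nat.eqb n 0 then 0
  else if Nat.even n then
    (1 - 1 / 2 ^ (2 * m - 1)) * (B (2 * m)%nat / (4 * INR m))
  else (8 - E (2 * m)%nat) / 2 ^ (2 * m + 2).

Definition has_multiplicity (alpha : nat -> C) (a : C) (k : nat) : Prop :=
  exists l : list nat,
    NoDup l /\ (forall n, In n l <-> alpha n = a) /\ length l = k.

Definition zeta_sum_term (alpha : nat -> C) (z : C) (k : nat) : C :=
  (2 * z / (z ^ 2 + alpha k ^ 2))%C.

(** Sequences are indexed from [0]: [alpha n] is the (n+1)-st term. *)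
Record Riemann_sequence (E B : nat -> R) (alpha : nat -> C) : Prop := {
  rs_gt1 : 1 < Re (alpha 0%nat);
  rs_incr : forall n, Re (alpha n) <= Re (alpha (S n));
  rs_mult : forall a : C, exists k : nat,
    has_multiplicity alpha a k /\
    (Im a <> 0 -> has_multiplicity alpha (Cconj a) k);
  rs_strip : exists c : R, forall n, Rabs (Im (alpha n)) < c;
  rs_arg : forall n, Rabs (Carg (alpha n)) < PI / 4;
  (* the sum has to be a function defined on some half-plane *)
  rs_cv : exists a : R, forall z : C, a < Re z ->
    ex_series (K := C_AbsRing) (V := C_NormedModule) (zeta_sum_term alpha z);
  rs_asymp : asymp
    (fun z => (CSeries (zeta_sum_term alpha z)
                 - RtoC (1 / 2) * Clog (z / RtoC (2 * PI)))%C)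
    (fun n => RtoC (coef_a E B n))
}.

(** The limit defining this constant is real, non-real terms occurring in
    conjugate pairs; hence the real part. *)
Definition B_const (alpha : nat -> C) : R :=
  real (Lim (fun x : R =>
    Re (CSeries (fun n => Clog (1 + RtoC (x ^ 2) / alpha n ^ 2)%C))
      - x / 2 * ln (x / (2 * PI)) + x / 2 - 7 / 4 * ln x) p_infty).

(** The positive solution X of B = 1/4 log (PI/2) - log X. *)
Definition Xi0 (alpha : nat -> C) : R :=
  exp (1 / 4 * ln (PI / 2) - B_const alpha).

Definition zeta (alpha : nat -> C) (s : C) : C :=
  (RtoC (Xi0 alpha)
     * (Rcpower PI (s / 2) / ((s - 1) * CGamma (1 + s / 2)))
     * CProd (fun n => 1 + (s - RtoC (1 / 2)) ^ 2 / alpha n ^ 2))%C.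

(** [L] is the analytic branch of [log f] on the half-plane [a < Re s] that is
    real on the real axis. *)
Definition is_log_branch (a : R) (f L : C -> C) : Prop :=
  (forall s : C, a < Re s ->
     ex_derive (K := C_AbsRing) (V := C_NormedModule) L s) /\
  (forall s : C, a < Re s -> Cexp (L s) = f s) /\
  (forall x : R, a < x -> Im (L (RtoC x)) = 0).

(* Main.v *)
(** Write [s = 1/2 + z]. The logarithm of zeta is [P - Q], where [P] is the sum of
    the [log (1 + z^2/alpha_n^2)] and [Q] is elementary apart from
    [log Gamma (5/4 + z/2)]. Both turn out to have the same expansion
    [z/2 log (z/2pi) - z/2 + 7/4 log z + B - sum a_n z^(1-n)/(n-1)].

    For [P] this is integration of hypothesis (e) along the cone: a bound on the
    derivative bounds [f(z+2) - f(z)], and summing over [z, z+2, z+4, ...]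
    bounds [f] minus a constant, which is [B] by definition.

    For [Q] the functional equation of Gamma makes [Q(z+2) - Q(z)] elementary. Let
    [e] be the difference between it and the same difference of the truncated
    expansion. Its second derivative is rational, namely the Laplace transform of
    the exponential polynomial [t (1 - exp(-2t)) (A(t) - A_N(t))], where [A] is the
    exponential generating function of the [a_(n+1)] and [A_N] its truncation; as
    this vanishes to high order at [0], the Laplace transform, hence [e], hence
    [Q] minus its truncated expansion, is small. The constants are matched by
    Euler's limit for Gamma together with Stirling's formula. *)

Require Import Defs.
From Stdlib Require Import Reals Arith List Lra Lia Psatz IndefiniteDescription FinFun.
From Coquelicot Require Import Coquelicot.
Open Scope R_scope.

(** Both logarithms are built factor by factor. The principal logarithm of [1 + z^2/alpha_n^2] need
    not be analytic on a half-plane, since its argument may cross the negative axis when [alpha_n]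
    is not real. The factors [z - i alpha_n] and [z + i alpha_n], however, lie in the right
    half-plane once [Re z] exceeds the width of the strip. Log Gamma is likewise the limit of
    Euler's quotients with one logarithm per factor.

    No complex integral occurs. Integration is the mean value inequality from [z] to [z + 2]
    followed by a telescoping sum, and cones are preserved by such steps. The Laplace transform is a
    rational function attached to a list, and integration by parts is an algebraic identity. This is
    why differences are taken: [A] is not an exponential polynomial, but the factor
    [t (1 - exp(-2t))] clears its denominators.

    Each integration leaves a constant, fixed by a limit along [z + 2n]; there [B] and Stirling's
    formula enter. The step 2 is forced by [Gamma (5/4 + z/2)], which is [Gamma (1 + s/2)] at
    [s = 1/2 + z]. *)

(** * Components and modulus of complex numbers *)

Lemma le_div_r a b c : 0 < c -> a * c <= b -> a <= b / c.
Proof. intros Hc. apply Rle_div_r. auto. Qed.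

Lemma le_div_l a b c : 0 < c -> a <= b * c -> a / c <= b.
Proof. intros Hc. apply Rle_div_l. auto. Qed.

Lemma C_eq (z w : C) : Re z = Re w -> Im z = Im w -> z = w.
Proof. destruct z, w; simpl; intros; subst; auto. Qed.

Lemma Re_plus z w : Re (z + w)%C = Re z + Re w. Proof. reflexivity. Qed.
Lemma Im_plus z w : Im (z + w)%C = Im z + Im w. Proof. reflexivity. Qed.
Lemma Re_minus z w : Re (z - w)%C = Re z - Re w. Proof. reflexivity. Qed.
Lemma Im_minus z w : Im (z - w)%C = Im z - Im w. Proof. reflexivity. Qed.
Lemma Re_opp z : Re (- z)%C = - Re z. Proof. reflexivity. Qed.
Lemma Im_opp z : Im (- z)%C = - Im z. Proof. reflexivity. Qed.
Lemma Re_mult z w : Re (z * w)%C = Re z * Re w - Im z * Im w. Proof. reflexivity. Qed.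
Lemma Im_mult z w : Im (z * w)%C = Re z * Im w + Im z * Re w. Proof. reflexivity. Qed.
Lemma Re_RtoC x : Re (RtoC x) = x. Proof. reflexivity. Qed.
Lemma Im_RtoC x : Im (RtoC x) = 0. Proof. reflexivity. Qed.
Lemma Re_Ci : Re Ci = 0. Proof. reflexivity. Qed.
Lemma Im_Ci : Im Ci = 1. Proof. reflexivity. Qed.

Ltac reim := repeat progress rewrite ?Re_plus, ?Im_plus, ?Re_minus, ?Im_minus,
  ?Re_opp, ?Im_opp, ?Re_mult, ?Im_mult, ?Re_RtoC, ?Im_RtoC, ?Re_Ci, ?Im_Ci.

Lemma Cmod_sqr z : Cmod z * Cmod z = Re z * Re z + Im z * Im z.
Proof. generalize (Cmod2_alt z). simpl. lra. Qed.

Lemma im_le_Cmod z : Rabs (Im z) <= Cmod z.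
Proof.
  generalize (Rmax_Cmod z). unfold Rmax, Im.
  destruct (Rle_dec (Rabs (fst z)) (Rabs (snd z))); lra.
Qed.

Lemma Cmod_le_abs z : Cmod z <= Rabs (Re z) + Rabs (Im z).
Proof.
  apply Rsqr_incr_0_var. 2: { generalize (Rabs_pos (Re z)) (Rabs_pos (Im z)); lra. }
  unfold Rsqr. rewrite Cmod_sqr.
  assert (H1 : Re z * Re z = Rabs (Re z) * Rabs (Re z)).
  { rewrite <- Rabs_mult. symmetry; apply Rabs_pos_eq. nra. }
  assert (H2 : Im z * Im z = Rabs (Im z) * Rabs (Im z)).
  { rewrite <- Rabs_mult. symmetry; apply Rabs_pos_eq. nra. }
  rewrite H1, H2. generalize (Rabs_pos (Re z)) (Rabs_pos (Im z)). nra.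
Qed.

Lemma Cmod_minus_le z w : Cmod (z - w)%C <= Cmod z + Cmod w.
Proof.
  replace (z - w)%C with (z + - w)%C by ring.
  rewrite <- (Cmod_opp w). apply Cmod_triangle.
Qed.

Lemma Cmod_minus_ge z w : Cmod z - Cmod w <= Cmod (z - w)%C.
Proof.
  generalize (Cmod_triangle (z - w)%C w).
  replace (z - w + w)%C with z by ring. lra.
Qed.

Lemma Cmod_plus_ge z w : Cmod z - Cmod w <= Cmod (z + w)%C.
Proof.
  generalize (Cmod_minus_ge z (- w)%C). rewrite Cmod_opp.
  replace (z - - w)%C with (z + w)%C by ring. lra.
Qed.

Lemma Cmod_minus_sym z w : Cmod (z - w)%C = Cmod (w - z)%C.
Proof. rewrite <- Cmod_opp. f_equal. ring. Qed.

Lemma Re_le_Cmod z : Re z <= Cmod z.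
Proof. generalize (re_le_Cmod z) (Rle_abs (Re z)). lra. Qed.

Lemma Cmod_gt_0_re z : 0 < Re z -> 0 < Cmod z.
Proof. generalize (Re_le_Cmod z). lra. Qed.

Lemma Cneq0_re (z : C) : 0 < Re z -> z <> 0%C.
Proof. intros H E. rewrite E in H. simpl in H. lra. Qed.

Lemma Cmod_inv' z : Cmod (/ z)%C = / Cmod z.
Proof.
  destruct (Ceq_dec z (RtoC 0)) as [->|H].
  - rewrite Cmod_0, Rinv_0.
    replace (/ 0)%C with (RtoC 0). apply Cmod_0.
    unfold Cinv. simpl. apply C_eq; simpl; unfold Rdiv; ring.
  - apply Cmod_inv; auto.
Qed.

Lemma Cmod_div' z w : Cmod (z / w)%C = Cmod z / Cmod w.
Proof. unfold Cdiv. rewrite Cmod_mult, Cmod_inv'. reflexivity. Qed.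

Lemma Cmod_R_pos x : 0 <= x -> Cmod (RtoC x) = x.
Proof. intros. rewrite Cmod_R. apply Rabs_pos_eq; auto. Qed.

(** * Complex differentiability and the mean value inequality *)

(** Multiplied out, so that [h = 0] needs no exclusion, and stated with [Cmod] alone. The passage to
    and from [ex_derive] is made only for the branches of the logarithm. *)
Definition Cder (f : C -> C) (z l : C) : Prop :=
  forall eps : R, 0 < eps -> exists d : R, 0 < d /\
    forall h : C, Cmod h < d ->
      Cmod (f (z + h) - f z - l * h)%C <= eps * Cmod h.

(** The real mean value theorem is applied to the inner product of the path with its chord
    [D = p 1 - p 0]. The increment of that product is [Cmod D] squared, and by Cauchy-Schwarz its
    derivative is at most [Cmod D * M]. *)
Lemma path_mvt (p q : R -> C) (M : R) :
  (forall t, 0 <= t <= 1 ->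
     derivable_pt_lim (fun t => Re (p t)) t (Re (q t)) /\
     derivable_pt_lim (fun t => Im (p t)) t (Im (q t))) ->
  (forall t, 0 <= t <= 1 -> Cmod (q t) <= M) ->
  Cmod (p 1 - p 0)%C <= M.
Proof.
  intros Hd Hb.
  set (D := (p 1 - p 0)%C).
  destruct (MVT_cor2 (fun t => Re D * Re (p t) + Im D * Im (p t))
    (fun t => Re D * Re (q t) + Im D * Im (q t)) 0 1) as [c [Hc1 Hc2]].
  - lra.
  - intros t Ht. destruct (Hd t Ht) as [H1 H2].
    apply derivable_pt_lim_plus.
    + apply (derivable_pt_lim_scal (fun t => Re (p t))); auto.
    + apply (derivable_pt_lim_scal (fun t => Im (p t))); auto.
  - assert (HM : Cmod (q c) <= M) by (apply Hb; lra).
    assert (E : Cmod D * Cmod D = Re D * Re (q c) + Im D * Im (q c)).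
    { rewrite Cmod_sqr. transitivity ((Re D * Re (p 1) + Im D * Im (p 1)) - (Re D * Re (p 0) + Im D * Im (p 0))).
      unfold D; reim; ring. rewrite Hc1. ring. }
    assert (Hcs : Re D * Re (q c) + Im D * Im (q c) <= Cmod D * Cmod (q c)).
    { replace (Re D * Re (q c) + Im D * Im (q c)) with (Re (D * Cconj (q c))%C)
        by (reim; rewrite re_conj, im_conj; ring).
      eapply Rle_trans. apply Re_le_Cmod. rewrite Cmod_mult, Cmod_conj. lra. }
    generalize (Cmod_ge_0 D) (Cmod_ge_0 (q c)). intros.
    destruct (Rle_lt_or_eq_dec 0 (Cmod D)); auto; [|lra].
    apply Rle_trans with (Cmod (q c)); auto.
    apply Rmult_le_reg_l with (Cmod D); lra.
Qed.

Lemma Cder_path (f : C -> C) (a b l : C) (t : R) :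
  Cder f (a + RtoC t * b)%C l ->
  derivable_pt_lim (fun t => Re (f (a + RtoC t * b)%C)) t (Re (l * b)%C) /\
  derivable_pt_lim (fun t => Im (f (a + RtoC t * b)%C)) t (Im (l * b)%C).
Proof.
  intros H.
  assert (HH : forall eps, 0 < eps -> exists d : posreal, forall h, h <> 0 -> Rabs h < d ->
    Cmod ((f (a + RtoC (t + h) * b) - f (a + RtoC t * b)) / RtoC h - l * b)%C < eps).
  { intros eps He.
    assert (Hp : 0 < eps / 2 / (Cmod b + 1)).
    { generalize (Cmod_ge_0 b). intros. apply Rdiv_lt_0_compat; lra. }
    destruct (H _ Hp) as [d [Hd Hd']].
    assert (Hq : 0 < d / (Cmod b + 1)).
    { generalize (Cmod_ge_0 b). intros. apply Rdiv_lt_0_compat; lra. }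
    exists (mkposreal _ Hq). intros h Hh0 Hh. simpl in Hh.
    generalize (Cmod_ge_0 b); intros Hb.
    assert (Hhp := Rabs_pos_lt _ Hh0).
    assert (Hm : Cmod (RtoC h * b)%C < d).
    { rewrite Cmod_mult, Cmod_R.
      apply Rle_lt_trans with (Rabs h * (Cmod b + 1)). nra.
      apply Rmult_lt_compat_r with (r := Cmod b + 1) in Hh; [|lra].
      replace (d / (Cmod b + 1) * (Cmod b + 1)) with d in Hh by (field; lra). lra. }
    specialize (Hd' _ Hm).
    replace (a + RtoC t * b + RtoC h * b)%C with (a + RtoC (t + h) * b)%C in Hd'
      by (rewrite RtoC_plus; ring).
    rewrite Cmod_mult, Cmod_R in Hd'.
    assert (Hh0' : RtoC h <> 0%C) by (intro E; apply Hh0; apply RtoC_inj in E; auto).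
    replace ((f (a + RtoC (t + h) * b) - f (a + RtoC t * b)) / RtoC h - l * b)%C
      with ((f (a + RtoC (t + h) * b) - f (a + RtoC t * b) - l * (RtoC h * b)) / RtoC h)%C
      by (field; auto).
    rewrite Cmod_div', Cmod_R.
    apply Rle_lt_trans with (eps / 2 / (Cmod b + 1) * (Rabs h * Cmod b) / Rabs h).
    - apply Rmult_le_compat_r; auto. left. apply Rinv_0_lt_compat; auto.
    - replace (eps / 2 / (Cmod b + 1) * (Rabs h * Cmod b) / Rabs h)
        with (eps / 2 * (Cmod b / (Cmod b + 1))) by (field; lra).
      assert (Cmod b / (Cmod b + 1) <= 1) by (apply Rle_div_l; lra).
      assert (0 <= Cmod b / (Cmod b + 1)) by (apply Rdiv_le_0_compat; lra). nra. }
  assert (Hre : forall h z w, h <> 0 ->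
     (Re z - Re w) / h - Re (l * b)%C = Re ((z - w) / RtoC h - l * b)%C
     /\ (Im z - Im w) / h - Im (l * b)%C = Im ((z - w) / RtoC h - l * b)%C).
  { intros h z w Hh.
    replace ((z - w) / RtoC h)%C with ((z - w) * RtoC (/ h))%C
      by (rewrite RtoC_inv by auto; reflexivity).
    reim. unfold Rdiv. split; ring. }
  split; intros eps He; destruct (HH eps He) as [d Hd]; exists d; intros h H0 Hh;
    specialize (Hd h H0 Hh).
  - rewrite (proj1 (Hre h _ _ H0)). eapply Rle_lt_trans. apply re_le_Cmod. exact Hd.
  - rewrite (proj2 (Hre h _ _ H0)). eapply Rle_lt_trans. apply im_le_Cmod. exact Hd.
Qed.

Lemma Cmvt (f g : C -> C) (a b : C) (M : R) :
  (forall t, 0 <= t <= 1 ->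
     Cder f (a + RtoC t * (b - a))%C (g (a + RtoC t * (b - a))%C)) ->
  (forall t, 0 <= t <= 1 -> Cmod (g (a + RtoC t * (b - a))%C) <= M) ->
  Cmod (f b - f a)%C <= M * Cmod (b - a)%C.
Proof.
  intros Hd Hb.
  generalize (path_mvt (fun t => f (a + RtoC t * (b - a))%C)
     (fun t => g (a + RtoC t * (b - a))%C * (b - a))%C (M * Cmod (b - a)%C)).
  replace (a + RtoC 1 * (b - a))%C with b by ring.
  replace (a + RtoC 0 * (b - a))%C with a by ring.
  intros H; apply H.
  - intros t Ht. apply Cder_path. apply Hd; auto.
  - intros t Ht. rewrite Cmod_mult. apply Rmult_le_compat_r. apply Cmod_ge_0. apply Hb; auto.
Qed.

Lemma Cder_const c z : Cder (fun _ => c) z 0.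
Proof.
  intros e He. exists 1. split. lra. intros h _.
  replace (c - c - 0 * h)%C with (RtoC 0) by ring. rewrite Cmod_0.
  generalize (Cmod_ge_0 h). nra.
Qed.

Lemma Cder_id z : Cder (fun z => z) z 1.
Proof.
  intros e He. exists 1. split. lra. intros h _.
  replace (z + h - z - 1 * h)%C with (RtoC 0) by ring. rewrite Cmod_0.
  generalize (Cmod_ge_0 h). nra.
Qed.

Lemma Cder_plus f g z l m : Cder f z l -> Cder g z m ->
  Cder (fun z => f z + g z)%C z (l + m)%C.
Proof.
  intros Hf Hg e He.
  destruct (Hf (e / 2)) as [d1 [H1 H1']]. lra.
  destruct (Hg (e / 2)) as [d2 [H2 H2']]. lra.
  exists (Rmin d1 d2). split. apply Rmin_pos; auto.
  intros h Hh.
  replace (f (z + h) + g (z + h) - (f z + g z) - (l + m) * h)%C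
    with ((f (z + h) - f z - l * h) + (g (z + h) - g z - m * h))%C by ring.
  eapply Rle_trans. apply Cmod_triangle.
  specialize (H1' h). specialize (H2' h).
  generalize (Rmin_l d1 d2) (Rmin_r d1 d2). intros.
  assert (A := H1' ltac:(lra)). assert (A' := H2' ltac:(lra)). lra.
Qed.

Lemma Cder_mult f g z l m : Cder f z l -> Cder g z m ->
  Cder (fun z => f z * g z)%C z (l * g z + f z * m)%C.
Proof.
  intros Hf Hg e He.
  (* [K] majorises both values and both derivatives, and [e' <= 1] keeps each remainder below
     [Cmod h]. The terms linear in the remainders then cost [e' * K] and the product of increments
     costs [K * K * Cmod h], each at most [e / 4]. *)
  set (K := Cmod (f z) + Cmod (g z) + Cmod l + Cmod m + 2).
  assert (Bf := Cmod_ge_0 (f z)). assert (Bg := Cmod_ge_0 (g z)).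
  assert (Bl := Cmod_ge_0 l). assert (Bm := Cmod_ge_0 m).
  assert (HK : 2 <= K) by (unfold K; lra).
  set (e' := Rmin 1 (e / (4 * K))).
  assert (He' : 0 < e'). { apply Rmin_pos. lra. apply Rdiv_lt_0_compat; lra. }
  assert (He1 : e' <= 1) by apply Rmin_l.
  assert (He2 : e' * K <= e / 4).
  { apply Rle_trans with (e / (4 * K) * K). apply Rmult_le_compat_r. lra. apply Rmin_r.
    right. field. lra. }
  destruct (Hf e' He') as [d1 [H1 H1']].
  destruct (Hg e' He') as [d2 [H2 H2']].
  set (d3 := e / (4 * (K * K))).
  assert (Hd3 : 0 < d3) by (apply Rdiv_lt_0_compat; nra).
  exists (Rmin d3 (Rmin d1 d2)). split. repeat apply Rmin_pos; auto.
  intros h Hh.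
  assert (Hh3 : Cmod h < d3) by (eapply Rlt_le_trans; [exact Hh|apply Rmin_l]).
  assert (Hh1 : Cmod h < d1).
  { eapply Rlt_le_trans; [exact Hh|]. eapply Rle_trans. apply Rmin_r. apply Rmin_l. }
  assert (Hh2 : Cmod h < d2).
  { eapply Rlt_le_trans; [exact Hh|]. eapply Rle_trans. apply Rmin_r. apply Rmin_r. }
  specialize (H1' h Hh1). specialize (H2' h Hh2).
  set (u := (f (z + h) - f z - l * h)%C) in *.
  set (v := (g (z + h) - g z - m * h)%C) in *.
  replace (f (z + h) * g (z + h) - f z * g z - (l * g z + f z * m) * h)%C
    with (u * g z + f z * v + (l * h + u) * (m * h + v))%C by (unfold u, v; ring).
  assert (Bh := Cmod_ge_0 h). assert (Bu := Cmod_ge_0 u). assert (Bv := Cmod_ge_0 v).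
  assert (T1 : Cmod (l * h + u)%C <= K * Cmod h).
  { eapply Rle_trans. apply Cmod_triangle. rewrite Cmod_mult. unfold K. nra. }
  assert (T2 : Cmod (m * h + v)%C <= K * Cmod h).
  { eapply Rle_trans. apply Cmod_triangle. rewrite Cmod_mult. unfold K. nra. }
  eapply Rle_trans. apply Cmod_triangle. rewrite Cmod_mult.
  eapply Rle_trans. apply Rplus_le_compat_r. apply Cmod_triangle. rewrite !Cmod_mult.
  assert (S1 : Cmod u * Cmod (g z) + Cmod (f z) * Cmod v <= (e' * K) * Cmod h).
  { assert (Cmod u * Cmod (g z) <= e' * Cmod h * Cmod (g z)) by (apply Rmult_le_compat_r; auto).
    assert (Cmod (f z) * Cmod v <= Cmod (f z) * (e' * Cmod h)) by (apply Rmult_le_compat_l; auto).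
    assert (0 <= e' * Cmod h) by nra. unfold K. nra. }
  assert (S2 : Cmod (l * h + u)%C * Cmod (m * h + v)%C <= (K * Cmod h) * (K * Cmod h)).
  { apply Rmult_le_compat; auto; apply Cmod_ge_0. }
  assert (S3 : K * K * Cmod h <= e / 4).
  { apply Rle_trans with (K * K * d3). apply Rmult_le_compat_l. nra. lra.
    right. unfold d3. field. lra. }
  nra.
Qed.

Lemma Cder_scal c f z l : Cder f z l -> Cder (fun z => c * f z)%C z (c * l)%C.
Proof.
  intros H. generalize (Cder_mult _ _ z _ _ (Cder_const c z) H).
  replace (0 * f z + c * l)%C with (c * l)%C by ring. auto.
Qed.

Lemma Cder_opp f z l : Cder f z l -> Cder (fun z => - f z)%C z (- l)%C.
Proof.
  intros H e He. destruct (H e He) as [d [Hd Hd']]. exists d. split; auto.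
  intros h Hh. rewrite <- Cmod_opp.
  replace (- (- f (z + h) - - f z - - l * h))%C with (f (z + h) - f z - l * h)%C by ring.
  auto.
Qed.

Lemma Cder_minus f g z l m : Cder f z l -> Cder g z m ->
  Cder (fun z => f z - g z)%C z (l - m)%C.
Proof. intros. apply Cder_plus; auto. apply Cder_opp; auto. Qed.

Lemma Cder_shift f b z l : Cder f (z + b)%C l -> Cder (fun z => f (z + b)%C) z l.
Proof.
  intros H e He. destruct (H e He) as [d [Hd Hd']]. exists d. split; auto.
  intros h Hh. replace (z + h + b)%C with (z + b + h)%C by ring. auto.
Qed.

Lemma Cder_affine f (c : R) b z l : Cder f (RtoC c * z + b)%C l ->
  Cder (fun z => f (RtoC c * z + b)%C) z (RtoC c * l)%C.
Proof.
  intros H e He.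
  assert (Hc := Rabs_pos c).
  destruct (H (e / (Rabs c + 1))) as [d [Hd Hd']]. apply Rdiv_lt_0_compat; lra.
  exists (d / (Rabs c + 1)). split. apply Rdiv_lt_0_compat; lra.
  intros h Hh.
  assert (Bh := Cmod_ge_0 h).
  assert (Hm : Cmod (RtoC c * h)%C < d).
  { rewrite Cmod_mult, Cmod_R. apply Rle_lt_trans with ((Rabs c + 1) * Cmod h). nra.
    apply Rmult_lt_compat_l with (r := Rabs c + 1) in Hh; [|lra].
    replace ((Rabs c + 1) * (d / (Rabs c + 1))) with d in Hh by (field; lra). lra. }
  specialize (Hd' _ Hm).
  replace (RtoC c * (z + h) + b)%C with (RtoC c * z + b + RtoC c * h)%C by ring.
  replace (RtoC c * l * h)%C with (l * (RtoC c * h))%C by ring.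
  eapply Rle_trans. exact Hd'. rewrite Cmod_mult, Cmod_R.
  replace (e / (Rabs c + 1) * (Rabs c * Cmod h)) with (e * Cmod h * (Rabs c / (Rabs c + 1)))
    by (field; lra).
  assert (Rabs c / (Rabs c + 1) <= 1) by (apply Rle_div_l; lra).
  assert (0 <= Rabs c / (Rabs c + 1)) by (apply Rdiv_le_0_compat; lra).
  assert (0 <= e * Cmod h) by nra. nra.
Qed.

Lemma Cder_ext f g z l : (forall w, f w = g w) -> Cder f z l -> Cder g z l.
Proof.
  intros E H e He. destruct (H e He) as [d [Hd Hd']]. exists d. split; auto.
  intros h Hh. rewrite <- !E. auto.
Qed.

Lemma Cder_eq f z l m : l = m -> Cder f z l -> Cder f z m.
Proof. intros ->. auto. Qed.

Lemma Cder_lin a b z : Cder (fun z => a + b * z)%C z b.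
Proof.
  apply Cder_eq with (0 + b * 1)%C. ring.
  apply Cder_plus. apply Cder_const. apply Cder_scal. apply Cder_id.
Qed.

Lemma Cder_inv (z : C) : z <> 0%C -> Cder (fun z => / z)%C z (- / (z * z))%C.
Proof.
  intros Hz e He.
  assert (Hm : 0 < Cmod z) by (apply Cmod_gt_0; auto).
  set (m := Cmod z) in *.
  exists (Rmin (m / 2) (e * (m * m * m) / 2)). split.
  { apply Rmin_pos. lra. assert (0 < m * m * m) by (repeat apply Rmult_lt_0_compat; auto). nra. }
  intros h Hh.
  assert (H1 : Cmod h < m / 2) by (eapply Rlt_le_trans; [exact Hh|apply Rmin_l]).
  assert (H2 : Cmod h < e * (m * m * m) / 2) by (eapply Rlt_le_trans; [exact Hh|apply Rmin_r]).
  assert (H3 : m / 2 <= Cmod (z + h)%C).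
  { generalize (Cmod_plus_ge z h). fold m. lra. }
  assert (H4 : (z + h)%C <> 0%C). { apply Cmod_gt_0. lra. }
  replace (/ (z + h) - / z - - / (z * z) * h)%C with (h * h / (z * z * (z + h)))%C
    by (field; auto).
  rewrite Cmod_div', !Cmod_mult. fold m.
  assert (Bh := Cmod_ge_0 h).
  apply Rle_div_l. apply Rmult_lt_0_compat; nra.
  apply Rle_trans with (e * Cmod h * (m * m * (m / 2))).
  2: { apply Rmult_le_compat_l. nra. apply Rmult_le_compat_l; nra. }
  nra.
Qed.

(** * The logarithm on the right half-plane *)

Lemma ln_sqrt x : 0 < x -> ln (sqrt x) = / 2 * ln x.
Proof.
  intros H. rewrite <- (sqrt_sqrt x) at 2 by lra.
  rewrite ln_mult by (apply sqrt_lt_R0; auto). field.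
Qed.

(** On the right half-plane the [acos] of the definition, with its case distinction on the sign of
    [Im z], becomes a single arctangent that can be differentiated. *)
Lemma Carg_atan z : 0 < Re z -> Carg z = atan (Im z / Re z).
Proof.
  intros H. unfold Carg.
  assert (Hm := Cmod_gt_0_re z H).
  assert (Hq : 0 < Re z / Cmod z) by (apply Rdiv_lt_0_compat; auto).
  rewrite (acos_atan _ Hq).
  assert (E : sqrt (1 - (Re z / Cmod z)²) = Rabs (Im z) / Cmod z).
  { replace (1 - (Re z / Cmod z)²) with ((Im z / Cmod z)²).
    - rewrite sqrt_Rsqr_abs. unfold Rdiv. rewrite Rabs_mult, (Rabs_pos_eq (/ Cmod z)); auto.
      left; apply Rinv_0_lt_compat; auto.
    - generalize (Cmod_sqr z). intros E. unfold Rsqr.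
      replace (Im z / Cmod z * (Im z / Cmod z)) with
        ((Im z * Im z) / (Cmod z * Cmod z)) by (field; lra).
      replace (Im z * Im z) with (Cmod z * Cmod z - Re z * Re z) by lra.
      field. lra. }
  rewrite E.
  replace (Rabs (Im z) / Cmod z / (Re z / Cmod z)) with (Rabs (Im z) / Re z) by (field; lra).
  destruct (Rle_dec 0 (Im z)).
  - rewrite Rabs_pos_eq; auto.
  - rewrite Rabs_left by lra. rewrite <- atan_opp. f_equal. field. lra.
Qed.

Lemma Clog_rhp z : 0 < Re z ->
  Clog z = (/ 2 * ln (Re z * Re z + Im z * Im z), atan (Im z / Re z)).
Proof.
  intros H. unfold Clog. rewrite Carg_atan by auto. f_equal.
  replace (Cmod z) with (sqrt (Re z * Re z + Im z * Im z)).
  - apply ln_sqrt. nra.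
  - rewrite <- Cmod_sqr. apply sqrt_square. apply Cmod_ge_0.
Qed.

Definition Cxy (x y : R) : C := (x, y).

(** The mean value inequality for [Clog] minus the linear function of slope [c], along a segment
    that convexity keeps in the right half-plane. The choice [c = 1/z] gives differentiability,
    [c = 0] a Lipschitz bound, and [c = 1] the second-order bound on [log (1 + u)]. *)
Lemma Clog_diff z w : 0 < Re z -> 0 < Re w ->
  forall (c : C) (K : R),
  (forall t, 0 <= t <= 1 ->
     Cmod ((/ (z + RtoC t * (w - z)) - c) * (w - z))%C <= K) ->
  Cmod (Clog w - Clog z - c * (w - z))%C <= K.
Proof.
  intros Hz Hw c K HK.
  set (x := Re z) in *. set (y := Im z). set (h1 := Re w - x). set (h2 := Im w - y).
  assert (Hx : forall t, 0 <= t <= 1 -> 0 < x + t * h1) by (intros; unfold h1; nra).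
  set (u := fun t => / 2 * ln ((x + t * h1) * (x + t * h1) + (y + t * h2) * (y + t * h2))).
  set (v := fun t => atan ((y + t * h2) / (x + t * h1))).
  set (k := (c * (w - z))%C).
  generalize (path_mvt (fun t => (Cxy (u t) (v t) - RtoC t * k)%C)
    (fun t => (/ (z + RtoC t * (w - z)) - c) * (w - z))%C K).
  intros H.
  replace (Clog w - Clog z - k)%C with
   ((Cxy (u 1) (v 1) - RtoC 1 * k) - (Cxy (u 0) (v 0) - RtoC 0 * k))%C.
  - apply H; auto.
    intros t Ht. specialize (Hx t Ht).
    assert (Hn0 : 0 < (x + t * h1) * (x + t * h1) + (y + t * h2) * (y + t * h2)).
    { apply Rplus_lt_le_0_compat. apply Rmult_lt_0_compat; auto. apply Rle_0_sqr. }
    assert (Hn := Rgt_not_eq _ _ Hn0).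
    assert (E : ((/ (z + RtoC t * (w - z)) - c) * (w - z))%C =
      (((x + t * h1) * h1 + (y + t * h2) * h2) / ((x + t * h1) * (x + t * h1) + (y + t * h2) * (y + t * h2)) - Re k,
      ((x + t * h1) * h2 - (y + t * h2) * h1) / ((x + t * h1) * (x + t * h1) + (y + t * h2) * (y + t * h2)) - Im k)).
    { replace ((/ (z + RtoC t * (w - z)) - c) * (w - z))%C with
       (/ (z + RtoC t * (w - z)) * (w - z) - k)%C by (unfold k; ring).
      assert (E1 : (z + RtoC t * (w - z))%C = (x + t * h1, y + t * h2)).
      { apply C_eq; reim; [change (Re z + (t * (Re w - Re z) - 0 * (Im w - Im z)) = x + t * h1)
          |change (Im z + (t * (Im w - Im z) + 0 * (Re w - Re z)) = y + t * h2)];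
        unfold h1, h2, x, y; ring. }
      assert (E2 : (w - z)%C = (h1, h2)).
      { apply C_eq; reflexivity. }
      rewrite E1, E2. apply C_eq; reim; simpl; field; auto. }
    rewrite E.
    split; apply is_derive_Reals.
    + apply (is_derive_ext (fun t => u t - t * Re k)).
      { intros s. simpl. ring. }
      unfold u. auto_derive. exact Hn0. simpl. field. exact Hn.
    + apply (is_derive_ext (fun t => v t - t * Im k)).
      { intros s. simpl. ring. }
      unfold v. auto_derive. apply Rgt_not_eq; exact Hx. simpl. unfold Rsqr. field. split. exact Hn. apply Rgt_not_eq; exact Hx.
  - rewrite (Clog_rhp w), (Clog_rhp z) by auto. fold x y. unfold u, v, Cxy.
    replace (x + 1 * h1) with (Re w) by (unfold h1; ring).
    replace (y + 1 * h2) with (Im w) by (unfold h2; ring).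
    replace (x + 0 * h1) with x by ring. replace (y + 0 * h2) with y by ring.
    ring.
Qed.

Lemma Cder_Clog z : 0 < Re z -> Cder Clog z (/ z)%C.
Proof.
  intros Hz e He. set (m := Re z) in *.
  exists (Rmin (m / 2) (e * (m * m) / 2)). split.
  { assert (0 < m * m) by nra. apply Rmin_pos; [lra|]. assert (0 < e * (m * m)) by nra. lra. }
  intros h Hh.
  assert (H1 : Cmod h < m / 2) by (eapply Rlt_le_trans; [exact Hh|apply Rmin_l]).
  assert (H2 : Cmod h < e * (m * m) / 2) by (eapply Rlt_le_trans; [exact Hh|apply Rmin_r]).
  assert (Bh := Cmod_ge_0 h).
  assert (Hre : forall t, 0 <= t <= 1 -> m / 2 <= Re (z + RtoC t * h)%C).
  { intros t Ht. reim. fold m. generalize (re_le_Cmod h).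
    unfold Rabs; destruct (Rcase_abs (Re h)); intros; nra. }
  generalize (Clog_diff z (z + h)%C).
  replace (z + h - z)%C with h by ring. intros H. apply H; auto.
  { generalize (Hre 1). rewrite Cmult_1_l. fold m. lra. }
  intros t Ht.
  assert (Hmz : m <= Cmod z) by exact (Re_le_Cmod z).
  assert (Hmt : m / 2 <= Cmod (z + RtoC t * h)%C)
    by (eapply Rle_trans; [apply (Hre t Ht)|apply Re_le_Cmod]).
  assert (z <> 0)%C by (apply Cmod_gt_0; lra).
  assert (z + RtoC t * h <> 0)%C by (apply Cmod_gt_0; lra).
  replace ((/ (z + RtoC t * h) - / z) * h)%C
    with (- (RtoC t * (h * h)) / (z * (z + RtoC t * h)))%C by (field; auto).
  rewrite Cmod_div', Cmod_opp, !Cmod_mult, Cmod_R, (Rabs_pos_eq t) by lra.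
  assert (HP : m * (m / 2) <= Cmod z * Cmod (z + RtoC t * h)%C)
    by (apply Rmult_le_compat; lra).
  assert (HP0 : 0 < m * (m / 2)) by nra.
  apply Rle_div_l. lra.
  apply Rle_trans with (e * Cmod h * (m * (m / 2))).
  2: { apply Rmult_le_compat_l; nra. }
  assert (0 <= Cmod h * Cmod h) by nra.
  assert (t * (Cmod h * Cmod h) <= Cmod h * Cmod h) by nra.
  assert (Cmod h * Cmod h <= Cmod h * (e * (m * m) / 2)) by (apply Rmult_le_compat_l; lra).
  nra.
Qed.

Lemma Clog_conj z : 0 < Re z -> Clog (Cconj z) = Cconj (Clog z).
Proof.
  intros H. rewrite !Clog_rhp by (rewrite ?re_conj; auto).
  rewrite re_conj, im_conj. apply C_eq.
  - rewrite re_conj. change (/ 2 * ln (Re z * Re z + - Im z * - Im z) = / 2 * ln (Re z * Re z + Im z * Im z)).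
    f_equal. f_equal. ring.
  - rewrite im_conj. change (atan (- Im z / Re z) = - atan (Im z / Re z)).
    rewrite <- atan_opp. f_equal. field. lra.
Qed.

Lemma Clog_R x : 0 < x -> Clog (RtoC x) = RtoC (ln x).
Proof.
  intros H. unfold Clog. rewrite Carg_atan by auto. rewrite Cmod_R_pos by lra.
  rewrite Im_RtoC, Re_RtoC. unfold Rdiv. rewrite Rmult_0_l, atan_0. reflexivity.
Qed.

Lemma Clog_scale x z : 0 < x -> 0 < Re z -> Clog (RtoC x * z)%C = (RtoC (ln x) + Clog z)%C.
Proof.
  intros Hx Hz. unfold Clog.
  assert (0 < Re (RtoC x * z)%C) by (reim; nra).
  rewrite !Carg_atan by auto. rewrite Cmod_mult, Cmod_R_pos by lra.
  rewrite ln_mult by (auto; apply Cmod_gt_0_re; auto).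
  apply C_eq; simpl; auto.
  change (snd z) with (Im z). change (fst z) with (Re z). rewrite Rplus_0_l. apply f_equal. field. lra.
Qed.

Lemma Clog_div_R x z : 0 < x -> 0 < Re z -> Clog (z / RtoC x)%C = (Clog z - RtoC (ln x))%C.
Proof.
  intros Hx Hz.
  replace (z / RtoC x)%C with (RtoC (/ x) * z)%C.
  2: { rewrite RtoC_inv by lra. unfold Cdiv. ring. }
  rewrite Clog_scale; auto. rewrite ln_Rinv by auto. rewrite RtoC_opp. ring.
  apply Rinv_0_lt_compat; auto.
Qed.

Lemma Cexp_plus z w : Cexp (z + w)%C = (Cexp z * Cexp w)%C.
Proof.
  unfold Cexp. reim. rewrite exp_plus, cos_plus, sin_plus.
  apply C_eq; simpl; ring.
Qed.

Lemma Cexp_0 : Cexp 0 = 1%C.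
Proof. unfold Cexp. reim. rewrite exp_0, cos_0, sin_0. apply C_eq; simpl; ring. Qed.

Lemma Cmod_Cexp z : Cmod (Cexp z) = exp (Re z).
Proof.
  apply Rsqr_inj. apply Cmod_ge_0. left; apply exp_pos.
  unfold Rsqr. rewrite Cmod_sqr. unfold Cexp. simpl.
  generalize (sin2_cos2 (Im z)). unfold Rsqr. intros E.
  transitivity (exp (Re z) * exp (Re z) * (sin (Im z) * sin (Im z) + cos (Im z) * cos (Im z))).
  ring. rewrite E. ring.
Qed.

Lemma Cexp_neq0 z : Cexp z <> 0%C.
Proof.
  intro E. apply (f_equal Cmod) in E. rewrite Cmod_Cexp, Cmod_0 in E.
  generalize (exp_pos (Re z)). lra.
Qed.

Lemma Cexp_opp z : Cexp (- z)%C = (/ Cexp z)%C.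
Proof.
  assert (H := Cexp_neq0 z).
  replace (Cexp (- z)%C) with (Cexp z * Cexp (- z) / Cexp z)%C by (field; auto).
  rewrite <- Cexp_plus. replace (z + - z)%C with (RtoC 0) by ring.
  rewrite Cexp_0. unfold Cdiv. ring.
Qed.

Lemma Cexp_minus z w : Cexp (z - w)%C = (Cexp z / Cexp w)%C.
Proof. unfold Cminus. rewrite Cexp_plus, Cexp_opp. reflexivity. Qed.

Lemma Cexp_RtoC x : Cexp (RtoC x) = RtoC (exp x).
Proof. unfold Cexp. reim. rewrite cos_0, sin_0. apply C_eq; simpl; ring. Qed.

Lemma Cexp_Clog z : 0 < Re z -> Cexp (Clog z) = z.
Proof.
  intros Hz. assert (Hm := Cmod_gt_0_re z Hz).
  unfold Clog. rewrite Carg_atan by auto. unfold Cexp. simpl.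
  rewrite exp_ln by auto.
  rewrite cos_atan, sin_atan.
  assert (E : sqrt (1 + (Im z / Re z)²) = Cmod z / Re z).
  { replace (1 + (Im z / Re z)²) with ((Cmod z / Re z)²).
    - apply sqrt_Rsqr. left. apply Rdiv_lt_0_compat; auto.
    - unfold Rsqr. replace (Cmod z / Re z * (Cmod z / Re z)) with
        ((Cmod z * Cmod z) / (Re z * Re z)) by (field; lra).
      rewrite Cmod_sqr. field. lra. }
  rewrite E. apply C_eq; simpl; field; lra.
Qed.

Lemma Clog_lip z w m : 0 < Re z -> 0 < Re w -> 0 < m ->
  (forall t, 0 <= t <= 1 -> m <= Cmod (z + RtoC t * (w - z))%C) ->
  Cmod (Clog w - Clog z)%C <= Cmod (w - z)%C / m.
Proof.
  intros Hz Hw Hm H.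
  generalize (Clog_diff z w Hz Hw 0%C (Cmod (w - z)%C / m)).
  replace (Clog w - Clog z - 0 * (w - z))%C with (Clog w - Clog z)%C by ring.
  intros H'; apply H'. intros t Ht.
  rewrite Cmod_mult. replace (/ (z + RtoC t * (w - z)) - 0)%C with (/ (z + RtoC t * (w - z)))%C by ring.
  rewrite Cmod_inv'. rewrite Rmult_comm. unfold Rdiv.
  apply Rmult_le_compat_l. apply Cmod_ge_0. apply Rinv_le_contravar; auto.
Qed.

Lemma Cmod_1_plus_ge u : 0 <= Re u -> 1 <= Cmod (1 + u)%C.
Proof. intros. eapply Rle_trans; [|apply Re_le_Cmod]. reim. lra. Qed.

(** With [0 <= Re u] the segment from [1] to [1 + u] stays outside the open unit disc, so here and
    in the next lemma [u] may be arbitrarily large. *)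
Lemma Clog_1_plus u : 0 <= Re u -> Cmod (Clog (1 + u)) <= Cmod u.
Proof.
  intros H. generalize (Clog_lip 1%C (1 + u)%C 1).
  rewrite Clog_R, ln_1 by lra.
  replace (Clog (1 + u) - 0)%C with (Clog (1 + u)) by ring.
  replace (1 + u - 1)%C with u by ring. unfold Rdiv; rewrite Rinv_1, Rmult_1_r.
  intros H'. apply H'; reim; try lra.
  intros t Ht. apply Cmod_1_plus_ge. reim. nra.
Qed.

Lemma Clog_1_plus2 u : 0 <= Re u -> Cmod (Clog (1 + u) - u)%C <= Cmod u * Cmod u.
Proof.
  intros H. generalize (Clog_diff 1%C (1 + u)%C ltac:(reim; lra) ltac:(reim; lra) 1%C (Cmod u * Cmod u)).
  rewrite Clog_R, ln_1 by lra.
  replace (1 + u - 1)%C with u by ring.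
  replace (Clog (1 + u) - 0 - 1 * u)%C with (Clog (1 + u) - u)%C by ring.
  intros H'; apply H'. intros t Ht.
  assert (H1 : 1 <= Cmod (1 + RtoC t * u)%C) by (apply Cmod_1_plus_ge; reim; nra).
  assert (H2 : (1 + RtoC t * u)%C <> 0%C) by (apply Cmod_gt_0; lra).
  replace ((/ (1 + RtoC t * u) - 1) * u)%C with (- (RtoC t * (u * u)) / (1 + RtoC t * u))%C
    by (field; auto).
  rewrite Cmod_div', Cmod_opp, !Cmod_mult, Cmod_R, (Rabs_pos_eq t) by lra.
  apply Rle_div_l. lra. assert (0 <= Cmod u * Cmod u) by (generalize (Cmod_ge_0 u); nra). nra.
Qed.

(** * Sequences of complex numbers *)

(** [Clim_seq] returns a value even for divergent sequences; a proof of [Clim] is what gives that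
    value its meaning, through [Clim_Clim_seq]. *)
Definition Clim (u : nat -> C) (l : C) : Prop :=
  forall eps : R, 0 < eps -> exists N : nat, forall n, (N <= n)%nat -> Cmod (u n - l)%C < eps.

Lemma Clim_re u l : Clim u l -> is_lim_seq (fun n => Re (u n)) (Re l).
Proof.
  intros H. apply is_lim_seq_spec. intros eps. destruct (H eps (cond_pos eps)) as [N HN].
  exists N. intros n Hn. rewrite <- Re_minus.
  eapply Rle_lt_trans. apply re_le_Cmod. auto.
Qed.

Lemma Clim_im u l : Clim u l -> is_lim_seq (fun n => Im (u n)) (Im l).
Proof.
  intros H. apply is_lim_seq_spec. intros eps. destruct (H eps (cond_pos eps)) as [N HN].
  exists N. intros n Hn. rewrite <- Im_minus.
  eapply Rle_lt_trans. apply im_le_Cmod. auto.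
Qed.

Lemma Clim_reim u (x y : R) : is_lim_seq (fun n => Re (u n)) x -> is_lim_seq (fun n => Im (u n)) y ->
  Clim u (x, y).
Proof.
  intros Hx Hy eps He. apply is_lim_seq_spec in Hx. apply is_lim_seq_spec in Hy.
  assert (He2 : 0 < eps / 2) by lra.
  destruct (Hx (mkposreal _ He2)) as [N1 H1]. destruct (Hy (mkposreal _ He2)) as [N2 H2].
  exists (N1 + N2)%nat. intros n Hn. simpl in *.
  eapply Rle_lt_trans. apply Cmod_le_abs. reim. simpl.
  specialize (H1 n ltac:(lia)). specialize (H2 n ltac:(lia)). lra.
Qed.

Lemma Clim_Clim_seq u l : Clim u l -> Clim_seq u = l.
Proof.
  intros H. unfold Clim_seq.
  rewrite (is_lim_seq_unique _ _ (Clim_re _ _ H)), (is_lim_seq_unique _ _ (Clim_im _ _ H)).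
  apply C_eq; reflexivity.
Qed.

Lemma Clim_unique u l m : Clim u l -> Clim u m -> l = m.
Proof. intros H1 H2. rewrite <- (Clim_Clim_seq _ _ H1). apply Clim_Clim_seq; auto. Qed.

Lemma Clim_ext u v l : (forall n, u n = v n) -> Clim u l -> Clim v l.
Proof. intros E H eps He. destruct (H eps He) as [N HN]. exists N. intros. rewrite <- E; auto. Qed.

Lemma Clim_const c : Clim (fun _ => c) c.
Proof. intros eps He. exists O. intros. replace (c - c)%C with (RtoC 0) by ring. rewrite Cmod_0; auto. Qed.

Lemma Clim_plus u v l m : Clim u l -> Clim v m -> Clim (fun n => u n + v n)%C (l + m)%C.
Proof.
  intros Hu Hv eps He. destruct (Hu (eps / 2)) as [N1 H1]. lra. destruct (Hv (eps / 2)) as [N2 H2]. lra.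
  exists (N1 + N2)%nat. intros n Hn.
  replace (u n + v n - (l + m))%C with ((u n - l) + (v n - m))%C by ring.
  eapply Rle_lt_trans. apply Cmod_triangle.
  specialize (H1 n ltac:(lia)). specialize (H2 n ltac:(lia)). lra.
Qed.

Lemma Clim_scal c u l : Clim u l -> Clim (fun n => c * u n)%C (c * l)%C.
Proof.
  intros Hu eps He. assert (Hc := Cmod_ge_0 c). destruct (Hu (eps / (Cmod c + 1))) as [N H1].
  apply Rdiv_lt_0_compat; lra.
  exists N. intros n Hn. specialize (H1 n Hn).
  replace (c * u n - c * l)%C with (c * (u n - l))%C by ring. rewrite Cmod_mult.
  apply Rmult_lt_compat_l with (r := Cmod c + 1) in H1; [|lra].
  replace ((Cmod c + 1) * (eps / (Cmod c + 1))) with eps in H1 by (field; lra).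
  generalize (Cmod_ge_0 (u n - l)%C). nra.
Qed.

Lemma Clim_opp u l : Clim u l -> Clim (fun n => - u n)%C (- l)%C.
Proof.
  intros H. apply Clim_ext with (fun n => (-(1)) * u n)%C. intros; ring.
  replace (- l)%C with ((-(1)) * l)%C by ring. apply Clim_scal; auto.
Qed.

Lemma Clim_minus u v l m : Clim u l -> Clim v m -> Clim (fun n => u n - v n)%C (l - m)%C.
Proof. intros. apply Clim_plus; auto. apply Clim_opp; auto. Qed.

Lemma Clim_S u l : Clim u l -> Clim (fun n => u (S n)) l.
Proof. intros H eps He. destruct (H eps He) as [N HN]. exists N. intros. apply HN. lia. Qed.

Lemma Clim_S_inv u l : Clim (fun n => u (S n)) l -> Clim u l.
Proof.
  intros H eps He. destruct (H eps He) as [N HN]. exists (S N). intros n Hn.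
  destruct n. lia. apply HN. lia.
Qed.

Lemma Clim_squeeze u l (v : nat -> R) : (forall n, Cmod (u n - l)%C <= v n) ->
  is_lim_seq v 0 -> Clim u l.
Proof.
  intros H Hv eps He. apply is_lim_seq_spec in Hv. destruct (Hv (mkposreal _ He)) as [N HN].
  exists N. intros n Hn. specialize (HN n Hn). simpl in HN.
  rewrite Rminus_0_r in HN. generalize (Rle_abs (v n)) (H n). lra.
Qed.

Lemma Clim_le u l M : Clim u l -> (forall n, Cmod (u n) <= M) -> Cmod l <= M.
Proof.
  intros H Hb. apply le_epsilon. intros e He. destruct (H e He) as [N HN].
  specialize (HN N (le_n _)). rewrite Cmod_minus_sym in HN.
  generalize (Cmod_triangle (l - u N)%C (u N)). replace (l - u N + u N)%C with l by ring.
  specialize (Hb N). lra.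
Qed.

Lemma Clim_RtoC u (l : R) : is_lim_seq u l -> Clim (fun n => RtoC (u n)) (RtoC l).
Proof. intros H. apply Clim_reim; auto. simpl. apply is_lim_seq_const. Qed.

Lemma Clim_Cexp u l : Clim u l -> Clim (fun n => Cexp (u n)) (Cexp l).
Proof.
  intros H. unfold Cexp. generalize (Clim_re _ _ H) (Clim_im _ _ H). intros Hr Hi.
  assert (HE : is_lim_seq (fun n => exp (Re (u n))) (exp (Re l))).
  { apply is_lim_seq_continuous; auto. apply derivable_continuous_pt, derivable_pt_exp. }
  apply Clim_reim; simpl; apply (is_lim_seq_mult' _ _ _ _ HE); apply is_lim_seq_continuous; auto;
    apply derivable_continuous_pt; [apply derivable_pt_cos|apply derivable_pt_sin].
Qed.

Lemma Cseries_cv (u : nat -> C) (m : nat -> R) : ex_series m ->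
  (forall n, Cmod (u (S n) - u n)%C <= m n) -> exists l, Clim u l.
Proof.
  intros Hm H.
  (* [p] is the real or the imaginary part: both respect differences and are bounded by the
     modulus. *)
  assert (HH : forall p : C -> R, (forall z w, p (z - w)%C = p z - p w) -> (forall z, Rabs (p z) <= Cmod z) ->
     exists x : R, is_lim_seq (fun n => p (u n)) x).
  { intros p Hp Hb.
    assert (Hs : ex_series (fun n => p (u (S n)) - p (u n))).
    { apply (ex_series_le (K := R_AbsRing) (V := R_CompleteNormedModule) _ m); auto. intros n. change (Rabs (p (u (S n)) - p (u n)) <= m n).
      rewrite <- Hp. eapply Rle_trans. apply Hb. auto. }
    destruct Hs as [l Hl].
    exists (l + p (u O)).
    apply is_lim_seq_incr_1.
    apply is_lim_seq_ext with (fun n => sum_n (fun n => p (u (S n)) - p (u n)) n + p (u O)).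
    { induction n. rewrite sum_O. ring. rewrite sum_Sn. unfold plus; simpl. lra. }
    apply (is_lim_seq_plus' _ (fun _ => p (u O))). exact Hl. apply is_lim_seq_const. }
  destruct (HH Re) as [x Hx]. intros; reflexivity. apply re_le_Cmod.
  destruct (HH Im) as [y Hy]. intros; reflexivity. apply im_le_Cmod.
  exists (x, y). apply Clim_reim; auto.
Qed.

(** A uniform Lipschitz bound on the derivatives is enough to differentiate
    the limit. *)
Lemma Cder_lim (F g : nat -> C -> C) (f : C -> C) (z0 G : C) (M d : R) :
  0 < d ->
  (forall n z, Cmod (z - z0)%C < d -> Cder (F n) z (g n z)) ->
  (forall n z, Cmod (z - z0)%C < d -> Cmod (g n z - g n z0)%C <= M * Cmod (z - z0)%C) ->
  (forall z, Cmod (z - z0)%C < d -> Clim (fun n => F n z) (f z)) ->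
  Clim (fun n => g n z0) G ->
  Cder f z0 G.
Proof.
  intros Hd HF HM Hf HG e He.
  exists (Rmin d (e / (Rabs M + 1))). generalize (Rabs_pos M). intros HM0. split.
  { apply Rmin_pos; auto. apply Rdiv_lt_0_compat; lra. }
  intros h Hh.
  assert (H1 : Cmod h < d) by (eapply Rlt_le_trans; [exact Hh|apply Rmin_l]).
  assert (H2 : Cmod h < e / (Rabs M + 1)) by (eapply Rlt_le_trans; [exact Hh|apply Rmin_r]).
  assert (Bh := Cmod_ge_0 h).
  apply Rle_trans with (Rabs M * Cmod h * Cmod h).
  2: { apply Rmult_lt_compat_l with (r := Rabs M + 1) in H2; [|lra].
       replace ((Rabs M + 1) * (e / (Rabs M + 1))) with e in H2 by (field; lra). nra. }
  assert (Hz : forall t, 0 <= t <= 1 -> Cmod (z0 + RtoC t * h - z0)%C <= Cmod h).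
  { intros t Ht. replace (z0 + RtoC t * h - z0)%C with (RtoC t * h)%C by ring.
    rewrite Cmod_mult, Cmod_R, Rabs_pos_eq; nra. }
  apply Clim_le with (fun n => F n (z0 + h) - F n z0 - g n z0 * h)%C.
  - apply Clim_minus. apply Clim_minus; apply Hf.
    replace (z0 + h - z0)%C with h by ring; auto.
    replace (z0 - z0)%C with (RtoC 0) by ring. rewrite Cmod_0; auto.
    apply Clim_ext with (fun n => h * g n z0)%C. intros; ring.
    replace (G * h)%C with (h * G)%C by ring. apply Clim_scal; auto.
  - intros n.
    generalize (Cmvt (fun z => F n z - g n z0 * z)%C (fun z => g n z - g n z0)%C z0 (z0 + h)%C (Rabs M * Cmod h)).
    replace (z0 + h - z0)%C with h by ring.
    replace (F n (z0 + h) - g n z0 * (z0 + h) - (F n z0 - g n z0 * z0))%C with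
      (F n (z0 + h) - F n z0 - g n z0 * h)%C by ring.
    intros H. apply H; intros t Ht; specialize (Hz t Ht).
    + apply Cder_minus. apply HF. lra.
      generalize (Cder_scal (g n z0) _ _ _ (Cder_id (z0 + RtoC t * h)%C)). rewrite Cmult_1_r. auto.
    + eapply Rle_trans. apply HM. lra.
      apply Rle_trans with (Rabs M * Cmod (z0 + RtoC t * h - z0)%C).
      apply Rmult_le_compat_r. apply Cmod_ge_0. apply Rle_abs.
      apply Rmult_le_compat_l; auto.
Qed.

(** * Summable majorants, finite complex sums and bounds on the real logarithm *)

(** Without its first term the series is dominated by the telescoping differences of
    [/ INR (S n)]. *)
Lemma ex_series_inv_sqr : ex_series (fun n => / (INR (S n) * INR (S n))).
Proof.
  apply ex_series_incr_1.
  apply (ex_series_le (K := R_AbsRing) (V := R_CompleteNormedModule) _ (fun n => / INR (S n) - / INR (S (S n)))).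
  - intros n. change (Rabs (/ (INR (S (S n)) * INR (S (S n)))) <= / INR (S n) - / INR (S (S n))).
    rewrite !S_INR. generalize (pos_INR n). intros Hn.
    rewrite Rabs_pos_eq by (left; apply Rinv_0_lt_compat; nra).
    replace (/ (INR n + 1) - / (INR n + 1 + 1)) with (/ ((INR n + 1) * (INR n + 1 + 1))) by (field; lra).
    apply Rinv_le_contravar; nra.
  - exists 1. assert (is_lim_seq (fun n => 1 - / INR (S (S n))) 1).
    { replace (Finite 1) with (Finite (1 - 0)) by (f_equal; ring).
      apply is_lim_seq_minus'. apply is_lim_seq_const.
      apply (is_lim_seq_incr_1 (fun n => / INR (S n))).
      apply (is_lim_seq_incr_1 (fun n => / INR n)).
      replace (Finite 0) with (Rbar_inv p_infty) by reflexivity.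
      apply is_lim_seq_inv. apply is_lim_seq_INR. discriminate. }
    change (is_lim_seq (sum_n (fun n => / INR (S n) - / INR (S (S n)))) 1).
    eapply is_lim_seq_ext; [|exact H].
    induction n. rewrite sum_O. simpl. field.
    rewrite sum_Sn. rewrite <- IHn. unfold plus; simpl. ring.
Qed.

(** Exactly [n] terms, so that inductions start from the empty sum; [sum_n u n] has one term more,
    whence the [S n] in [sum_n_Csum]. *)
Fixpoint Csum (u : nat -> C) (n : nat) : C :=
  match n with O => RtoC 0 | S m => (Csum u m + u m)%C end.

Lemma sum_n_Csum u n : sum_n u n = Csum u (S n).
Proof.
  induction n.
  - rewrite sum_O. simpl. rewrite Cplus_0_l. reflexivity.
  - rewrite sum_Sn, IHn. reflexivity.
Qed.

Lemma Csum_ext u v n : (forall k, (k < n)%nat -> u k = v k) -> Csum u n = Csum v n.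
Proof. induction n; intros H; simpl; auto. rewrite IHn, H; auto. Qed.

Lemma Csum_shift u n : Csum (fun k => u (S k)) n = (Csum u (S n) - u O)%C.
Proof. induction n. simpl. ring. simpl. rewrite IHn. simpl. ring. Qed.

Lemma Csum_minus u v n : Csum (fun k => u k - v k)%C n = (Csum u n - Csum v n)%C.
Proof. induction n; simpl; [ring|rewrite IHn; ring]. Qed.

Lemma Csum_scal c u n : Csum (fun k => c * u k)%C n = (c * Csum u n)%C.
Proof. induction n; simpl; [ring|rewrite IHn; ring]. Qed.

Lemma Csum_bound u m n : ex_series m -> (forall k, Cmod (u k) <= m k) -> Cmod (Csum u n) <= Series m.
Proof.
  intros Hm H.
  assert (Hpos : forall k, 0 <= m k) by (intros k; eapply Rle_trans; [apply Cmod_ge_0|apply H]).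
  assert (Hs : forall n, Cmod (Csum u (S n)) <= sum_n m n).
  { intros k; induction k.
    - rewrite sum_O. simpl. rewrite Cplus_0_l. auto.
    - rewrite sum_Sn. change (Csum u (S (S k))) with (Csum u (S k) + u (S k))%C.
      eapply Rle_trans. apply Cmod_triangle. apply Rplus_le_compat; auto. }
  assert (Hlim := Series_correct _ Hm). change (is_lim_seq (sum_n m) (Series m)) in Hlim.
  assert (Hl : forall n, sum_n m n <= Series m).
  { intros k. apply is_lim_seq_incr_compare with (u := sum_n m); auto.
    intros j. rewrite sum_Sn. unfold plus; simpl. generalize (Hpos (S j)). lra. }
  destruct n.
  - simpl. rewrite Cmod_0. eapply Rle_trans. 2: apply (Hl O). rewrite sum_O. auto.
  - eapply Rle_trans. apply Hs. apply Hl.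
Qed.

Lemma Cder_Csum (f g : nat -> C -> C) z n : (forall k, (k < n)%nat -> Cder (f k) z (g k z)) ->
  Cder (fun z => Csum (fun k => f k z) n) z (Csum (fun k => g k z) n).
Proof.
  induction n; intros H; simpl.
  - apply Cder_const.
  - apply Cder_plus; auto.
Qed.

Lemma ln_le_minus_1 x : 0 < x -> ln x <= x - 1.
Proof.
  intros H. generalize (exp_ineq1_le (x - 1)). intros H'.
  rewrite <- (ln_exp (x - 1)). apply ln_le; auto. lra.
Qed.

Lemma ln_S_bounds n : 
  / INR (S (S n)) <= ln (INR (S (S n))) - ln (INR (S n)) <= / INR (S n).
Proof.
  assert (H1 := lt_0_INR (S n) ltac:(lia)). rewrite (S_INR (S n)).
  set (x := INR (S n)) in *.
  split.
  - replace (ln (x + 1) - ln x) with (- ln (x / (x + 1))).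
    + generalize (ln_le_minus_1 (x / (x + 1)) ltac:(apply Rdiv_lt_0_compat; lra)).
      replace (x / (x + 1) - 1) with (- / (x + 1)) by (field; lra). lra.
    + rewrite ln_div by lra. ring.
  - rewrite <- ln_div by lra.
    generalize (ln_le_minus_1 ((x + 1) / x) ltac:(apply Rdiv_lt_0_compat; lra)).
    replace ((x + 1) / x - 1) with (/ x) by (field; lra). lra.
Qed.

Lemma is_lim_seq_inv_S : is_lim_seq (fun n => / INR (S n)) 0.
Proof.
  apply (is_lim_seq_incr_1 (fun n => / INR n)).
  replace (Finite 0) with (Rbar_inv p_infty) by reflexivity.
  apply is_lim_seq_inv. apply is_lim_seq_INR. discriminate.
Qed.

Lemma Clog_plus_R w x : 0 < Re w -> 0 < x ->
  Clog (w + RtoC x)%C = (RtoC (ln x) + Clog (1 + RtoC (/ x) * w))%C.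
Proof.
  intros Hw Hx. rewrite <- Clog_scale; auto.
  - f_equal. rewrite RtoC_inv by lra. field. intro E; apply RtoC_inj in E; lra.
  - assert (0 < / x) by (apply Rinv_0_lt_compat; auto). reim. nra.
Qed.

Lemma Clim_Clog_plus_INR w : 0 < Re w ->
  Clim (fun n => Clog (w + RtoC (INR n)) - RtoC (ln (INR n)))%C 0.
Proof.
  intros Hw. apply Clim_S_inv.
  apply Clim_squeeze with (fun n => Cmod w * / INR (S n)).
  2: { replace (Finite 0) with (Finite (Cmod w * 0)) by (f_equal; ring).
       apply is_lim_seq_mult'. apply is_lim_seq_const. apply is_lim_seq_inv_S. }
  intros n. assert (H1 := lt_0_INR (S n) ltac:(lia)).
  assert (0 < / INR (S n)) by (apply Rinv_0_lt_compat; auto).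
  rewrite Clog_plus_R by auto.
  replace (RtoC (ln (INR (S n))) + Clog (1 + RtoC (/ INR (S n)) * w) - RtoC (ln (INR (S n))) - 0)%C
    with (Clog (1 + RtoC (/ INR (S n)) * w)) by ring.
  eapply Rle_trans. apply Clog_1_plus. reim. nra.
  rewrite Cmod_mult, Cmod_R_pos by lra. lra.
Qed.

(** * Euler's limit for the logarithm of the Gamma function *)

(** The logarithm of the [n]-th quotient in Euler's limit, with one principal logarithm per factor.
    This is analytic on the right half-plane, whereas the principal logarithm of the whole product
    may jump. *)
Definition Gn (n : nat) (w : C) : C :=
  (RtoC (ln (INR (fact n))) + RtoC (ln (INR n)) * w
     - Csum (fun k => Clog (w + RtoC (INR k))) (S n))%C.

Definition LogGamma (w : C) : C := Clim_seq (fun n => Gn n w).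

Lemma Gn_S n w : (Gn (S n) w - Gn n w)%C =
  (RtoC (ln (INR (S n))) + RtoC (ln (INR (S n)) - ln (INR n)) * w - Clog (w + RtoC (INR (S n))))%C.
Proof.
  unfold Gn. change (fact (S n)) with (S n * fact n)%nat. rewrite mult_INR.
  rewrite ln_mult; [|apply lt_0_INR; lia|apply lt_0_INR, lt_O_fact].
  change (Csum (fun k => Clog (w + RtoC (INR k))) (S (S n))) with
   (Csum (fun k => Clog (w + RtoC (INR k))) (S n) + Clog (w + RtoC (INR (S n))))%C.
  rewrite RtoC_plus, RtoC_minus. ring.
Qed.

(** With [m = n + 2], the increment is [(D - 1/m) w - (log (1 + w/m) - w/m)], where
    [D = ln m - ln (m - 1)]. Both parts are of order [n^(-2)], the first by [ln_S_bounds] and the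
    second by [Clog_1_plus2]. The sequence is started at [S n] to stay away from [ln 0]. *)
Lemma LogGamma_lim w : 0 < Re w -> Clim (fun n => Gn n w) (LogGamma w).
Proof.
  intros Hw.
  destruct (Cseries_cv (fun n => Gn (S n) w)
    (fun n => (Cmod w + Cmod w * Cmod w) * / (INR (S n) * INR (S n)))) as [l Hl].
  - apply (ex_series_scal (V := R_NormedModule)). apply ex_series_inv_sqr.
  - intros n. rewrite Gn_S.
    assert (H1 := lt_0_INR (S n) ltac:(lia)). assert (H2 := lt_0_INR (S (S n)) ltac:(lia)).
    assert (Hb := ln_S_bounds n). rewrite (Clog_plus_R w) by auto.
    set (D := ln (INR (S (S n))) - ln (INR (S n))) in *.
    set (m := INR (S (S n))) in *. assert (Em : m = INR (S n) + 1) by apply S_INR.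
    set (p := INR (S n)) in *.
    assert (0 < / m) by (apply Rinv_0_lt_compat; auto).
    replace (RtoC (ln m) + RtoC D * w - (RtoC (ln m) + Clog (1 + RtoC (/ m) * w)))%C with
      (RtoC (D - / m) * w - (Clog (1 + RtoC (/ m) * w) - RtoC (/ m) * w))%C
      by (rewrite RtoC_minus; ring).
    eapply Rle_trans. apply Cmod_minus_le.
    rewrite Rmult_plus_distr_r. apply Rplus_le_compat.
    + rewrite Cmod_mult, Cmod_R_pos by lra. rewrite Rmult_comm.
      apply Rmult_le_compat_l. apply Cmod_ge_0.
      apply Rle_trans with (/ p - / m). lra.
      rewrite Em. replace (/ p - / (p + 1)) with (/ (p * (p + 1))) by (field; lra).
      apply Rinv_le_contravar; nra.
    + eapply Rle_trans. apply Clog_1_plus2. reim. nra.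
      rewrite Cmod_mult, Cmod_R_pos by lra.
      replace (/ m * Cmod w * (/ m * Cmod w)) with (Cmod w * Cmod w * / (m * m)) by (field; lra).
      apply Rmult_le_compat_l. generalize (Cmod_ge_0 w); nra.
      apply Rinv_le_contravar; nra.
  - apply (Clim_S_inv (fun n => Gn n w)) in Hl. unfold LogGamma.
    rewrite (Clim_Clim_seq _ _ Hl). exact Hl.
Qed.

(** Replacing [w] by [w + 1] shifts the factors of Euler's quotient: [w] leaves and [w + 1 + n]
    enters, and [log (w + 1 + n) - ln n] tends to 0. *)
Lemma LogGamma_step w : 0 < Re w -> LogGamma (w + 1)%C = (LogGamma w + Clog w)%C.
Proof.
  intros Hw. assert (Hw1 : 0 < Re (w + 1)%C) by (reim; lra).
  apply Clim_unique with (fun n => Gn n (w + 1)%C). apply LogGamma_lim; auto.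
  apply Clim_ext with (fun n => Gn n w + (Clog w - (Clog (w + 1 + RtoC (INR n)) - RtoC (ln (INR n)))))%C.
  - intros n. unfold Gn.
    rewrite (Csum_ext (fun k => Clog (w + 1 + RtoC (INR k)))
      (fun k => (fun k => Clog (w + RtoC (INR k))) (S k))).
    + rewrite (Csum_shift (fun k => Clog (w + RtoC (INR k)))%C). 
      change (Csum (fun k => Clog (w + RtoC (INR k))) (S (S n))) with
        (Csum (fun k => Clog (w + RtoC (INR k))) (S n) + Clog (w + RtoC (INR (S n))))%C.
      rewrite S_INR, RtoC_plus.
      replace (w + RtoC (INR 0))%C with w by (simpl; ring).
      replace (w + (RtoC (INR n) + RtoC 1))%C with (w + 1 + RtoC (INR n))%C by ring. ring.
    + intros k _. f_equal. rewrite S_INR, RtoC_plus. ring.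
  - apply Clim_plus. apply LogGamma_lim; auto.
    generalize (Clim_minus _ _ _ _ (Clim_const (Clog w)) (Clim_Clog_plus_INR _ Hw1)).
    replace (Clog w - 0)%C with (Clog w) by ring. auto.
Qed.

Lemma Re_plus_INR w n : 0 < Re w -> 0 < Re (w + RtoC (INR n))%C.
Proof. intros. reim. generalize (pos_INR n). lra. Qed.

(** The bridge to Stirling's formula: it expresses [LogGamma] far to the right by factorials.
    Iterating the functional equation turns the difference into [LogGamma w - Gn k w] minus
    [log (w + k) - ln k], both of which tend to 0. *)
Lemma LogGamma_shift w : 0 < Re w ->
  Clim (fun k => LogGamma (w + RtoC (INR k)) -
     (RtoC (ln (INR (fact k))) + RtoC (ln (INR k)) * (w - 1)))%C 0.
Proof.
  intros Hw.
  assert (E : forall k, LogGamma (w + RtoC (INR k))%C =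
     (LogGamma w + Csum (fun j => Clog (w + RtoC (INR j))) k)%C).
  { induction k.
    - simpl. rewrite Cplus_0_r, Cplus_0_r. auto.
    - rewrite S_INR, RtoC_plus, Cplus_assoc, LogGamma_step by (apply Re_plus_INR; auto).
      rewrite IHk. simpl. ring. }
  apply Clim_ext with (fun k => (LogGamma w - Gn k w) - (Clog (w + RtoC (INR k)) - RtoC (ln (INR k))))%C.
  - intros k. rewrite E. unfold Gn. simpl. ring.
  - replace (RtoC 0) with ((LogGamma w - LogGamma w) - 0)%C by ring.
    apply Clim_minus. apply Clim_minus. apply Clim_const. apply LogGamma_lim; auto.
    apply Clim_Clog_plus_INR; auto.
Qed.

Lemma CGamma_LogGamma w : 0 < Re w -> CGamma w = Cexp (LogGamma w).
Proof.
  intros Hw. unfold CGamma. apply Clim_Clim_seq.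
  apply Clim_ext with (fun n => Cexp (Gn n w)).
  2: { apply Clim_Cexp. apply LogGamma_lim; auto. }
  intros n. unfold Gn, Rcpower. rewrite Cexp_minus, Cexp_plus, Cexp_RtoC.
  rewrite exp_ln by apply INR_fact_lt_0. f_equal.
  - f_equal. f_equal. ring.
  - f_equal. induction n.
    + cbn [Csum]. rewrite Cplus_0_l, Cexp_Clog by (apply Re_plus_INR; auto). reflexivity.
    + change (Csum (fun k => Clog (w + RtoC (INR k))) (S (S n))) with
        (Csum (fun k => Clog (w + RtoC (INR k))) (S n) + Clog (w + RtoC (INR (S n))))%C.
      rewrite Cexp_plus, IHn, Cexp_Clog by (apply Re_plus_INR; auto). reflexivity.
Qed.

Lemma LogGamma_real x : 0 < x -> Im (LogGamma (RtoC x)) = 0.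
Proof.
  intros Hx. assert (H := Clim_im _ _ (LogGamma_lim (RtoC x) Hx)).
  assert (E : forall n, Im (Csum (fun k => Clog (RtoC x + RtoC (INR k))) n) = 0).
  { induction n. auto. cbn [Csum]. rewrite Im_plus, IHn, <- RtoC_plus, Clog_R.
    rewrite Im_RtoC. ring. generalize (pos_INR n); lra. }
  assert (H' : is_lim_seq (fun n => Im (Gn n (RtoC x))) 0).
  { apply is_lim_seq_ext with (fun _ => 0). 2: apply is_lim_seq_const.
    intros n. unfold Gn. reim. rewrite E. ring. }
  generalize (is_lim_seq_unique _ _ H) (is_lim_seq_unique _ _ H'). intros E1 E2.
  rewrite E1 in E2. injection E2. auto.
Qed.

(** Serves the analyticity of the branch of [log zeta], which asks only that a derivative exists. It
    is obtained by differentiating Euler's limit through [Cder_lim]. *)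
Lemma LogGamma_der w : 0 < Re w -> exists l, Cder LogGamma w l.
Proof.
  intros Hw.
  set (g := fun n z => (RtoC (ln (INR n)) - Csum (fun k => / (z + RtoC (INR k))) (S n))%C).
  assert (Hg : exists G, Clim (fun n => g (S n) w) G).
  { apply Cseries_cv with (fun n => (1 + Cmod w) * / (INR (S n) * INR (S n))).
    - apply (ex_series_scal (V := R_NormedModule)). apply ex_series_inv_sqr.
    - intros n. unfold g.
      change (Csum (fun k => / (w + RtoC (INR k)))%C (S (S (S n)))) with
        (Csum (fun k => / (w + RtoC (INR k)))%C (S (S n)) + / (w + RtoC (INR (S (S n)))))%C.
      assert (H1 := lt_0_INR (S n) ltac:(lia)).
      assert (Hb := ln_S_bounds n).
      set (m := INR (S (S n))) in *. assert (Em : m = INR (S n) + 1) by apply S_INR.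
      set (p := INR (S n)) in *.
      assert (Hwm : m <= Cmod (w + RtoC m)%C).
      { eapply Rle_trans; [|apply Re_le_Cmod]. reim. lra. }
      assert (HC : (w + RtoC m)%C <> 0%C) by (apply Cmod_gt_0; lra).
      assert (HC' : RtoC m <> 0%C) by (intro E; apply RtoC_inj in E; lra).
      match goal with |- Cmod ?e <= _ =>
        replace e with (RtoC (ln m - ln p - / m) + w / (RtoC m * (w + RtoC m)))%C end.
      2: { rewrite !RtoC_minus, RtoC_inv by lra. field. auto. }
      eapply Rle_trans. apply Cmod_triangle.
      rewrite Rmult_plus_distr_r. apply Rplus_le_compat.
      + rewrite Cmod_R_pos by lra. apply Rle_trans with (/ p - / m). lra.
        rewrite Em. replace (/ p - / (p + 1)) with (/ (p * (p + 1))) by (field; lra).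
        rewrite Rmult_1_l. apply Rinv_le_contravar; nra.
      + rewrite Cmod_div', Cmod_mult, Cmod_R_pos by lra. unfold Rdiv.
        apply Rmult_le_compat_l. apply Cmod_ge_0. apply Rinv_le_contravar; nra. }
  destruct Hg as [G HG].
  exists G.
  (* Chosen so that [q * (k + 1) <= Re (z + k)] for every [k], uniformly for [z] in the disc of
     radius [Re w / 2] around [w]. The derivatives of all [Gn] then share the Lipschitz constant
     [q^(-2)] times the sum of the [(k + 1)^(-2)]. *)
  set (q := Rmin 1 (Re w / 2)).
  assert (Hq : 0 < q) by (apply Rmin_pos; lra).
  assert (Hq1 : q <= 1) by apply Rmin_l. assert (Hq2 : q <= Re w / 2) by apply Rmin_r.
  set (S0 := Series (fun n => / (INR (S n) * INR (S n)))).
  assert (Hz : forall z, Cmod (z - w)%C < Re w / 2 -> forall k, q * INR (S k) <= Re (z + RtoC (INR k))%C).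
  { intros z Hz k. generalize (re_le_Cmod (z - w)%C). reim. rewrite S_INR.
    generalize (pos_INR k). unfold Rabs. destruct (Rcase_abs (Re z - Re w)); intros; nra. }
  apply Cder_lim with (F := fun n => Gn (S n)) (g := fun n => g (S n)) (M := / (q * q) * S0) (d := Re w / 2); auto.
  - lra.
  - intros n z Hzw. unfold Gn, g.
    apply Cder_minus.
    + apply Cder_lin.
    + apply (Cder_Csum (fun k z => Clog (z + RtoC (INR k))) (fun k z => / (z + RtoC (INR k)))%C).
      intros k _. apply (Cder_shift Clog). apply Cder_Clog.
      specialize (Hz z Hzw k). assert (0 < INR (S k)) by (apply lt_0_INR; lia). nra.
  - intros n z Hzw. unfold g.
    match goal with |- Cmod ?e <= _ => replace e with
      ((z - w) * Csum (fun k => / ((z + RtoC (INR k)) * (w + RtoC (INR k)))) (S (S n)))%C end.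
    + rewrite Cmod_mult, Rmult_comm. apply Rmult_le_compat_r. apply Cmod_ge_0.
      unfold S0. rewrite <- Series_scal_l. apply Csum_bound.
      { apply (ex_series_scal (V := R_NormedModule)). apply ex_series_inv_sqr. }
      intros k. rewrite Cmod_inv', Cmod_mult.
      assert (0 < INR (S k)) by (apply lt_0_INR; lia).
      assert (A1 := Hz z Hzw k).
      assert (A2 := Hz w ltac:(replace (w - w)%C with (RtoC 0) by ring; rewrite Cmod_0; lra) k).
      assert (A3 := Re_le_Cmod (z + RtoC (INR k))%C). assert (A4 := Re_le_Cmod (w + RtoC (INR k))%C).
      rewrite <- Rinv_mult. apply Rinv_le_contravar.
      apply Rmult_lt_0_compat; nra.
      replace (q * q * (INR (S k) * INR (S k))) with ((q * INR (S k)) * (q * INR (S k))) by ring.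
      apply Rmult_le_compat; nra.
    + rewrite <- Csum_scal.
      rewrite (Csum_ext _ (fun k => / (w + RtoC (INR k)) - / (z + RtoC (INR k)))%C).
      rewrite Csum_minus. ring.
      intros k _. 
      assert (0 < INR (S k)) by (apply lt_0_INR; lia).
      assert (A1 := Hz z Hzw k).
      assert (A2 := Hz w ltac:(replace (w - w)%C with (RtoC 0) by ring; rewrite Cmod_0; lra) k).
      assert (0 < q * INR (S k)) by nra.
      field. split; apply Cneq0_re; lra.
  - intros z Hzw. apply (Clim_S (fun n => Gn n z)). apply LogGamma_lim.
    specialize (Hz z Hzw O). rewrite Re_plus, Re_RtoC in Hz. simpl INR in Hz. lra.
Qed.

(** * Stirling's formula *)

Definition wallis (n : nat) : R := RInt (fun x => sin x ^ n) 0 (PI / 2).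

Lemma ex_RInt_sin_pow n : ex_RInt (fun x => sin x ^ n) 0 (PI / 2).
Proof.
  apply (ex_RInt_continuous (V := R_CompleteNormedModule)). intros x _.
  apply (ex_derive_continuous (fun x => sin x ^ n)). auto_derive. auto.
Qed.

Lemma wallis_0 : wallis 0 = PI / 2.
Proof. unfold wallis. simpl. rewrite RInt_const. unfold scal; simpl. unfold mult; simpl. ring. Qed.

Lemma wallis_1 : wallis 1 = 1.
Proof.
  unfold wallis.
  rewrite (is_RInt_unique _ _ _ (minus (- cos (PI / 2)) (- cos 0))).
  rewrite cos_0, cos_PI2. unfold minus, plus, opp; simpl. ring.
  apply (is_RInt_derive (fun x => - cos x)).
  - intros x _. auto_derive; auto. ring.
  - intros x _. apply (ex_derive_continuous (fun x => sin x ^ 1)). auto_derive. auto.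
Qed.

(** Integration by parts in the form of an exact antiderivative, [- cos x * sin x ^ (n + 1)], which
    vanishes at both ends of the interval. *)
Lemma wallis_rec n : INR (n + 2) * wallis (n + 2) = INR (n + 1) * wallis n.
Proof.
  assert (H : is_RInt (fun x => INR (n + 2) * sin x ^ (n + 2) - INR (n + 1) * sin x ^ n) 0 (PI / 2)
    (minus (- cos (PI / 2) * sin (PI / 2) ^ (n + 1)) (- cos 0 * sin 0 ^ (n + 1)))).
  { apply (is_RInt_derive (fun x => - cos x * sin x ^ (n + 1))).
    - intros x _. auto_derive; auto.
      replace (Init.Nat.pred (n + 1)) with n by lia.
      rewrite !plus_INR, !pow_add. simpl.
      assert (E : cos x * cos x = 1 - sin x * sin x).
      { generalize (sin2_cos2 x). unfold Rsqr. lra. }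
      transitivity (sin x * sin x * sin x ^ n - (cos x * cos x) * (INR n + 1) * sin x ^ n). ring.
      rewrite E. ring.
    - intros x _. apply (ex_derive_continuous (fun x => INR (n + 2) * sin x ^ (n + 2) - INR (n + 1) * sin x ^ n)).
      auto_derive. auto. }
  rewrite cos_PI2, sin_0, pow_i in H by lia.
  apply (is_RInt_unique (V := R_CompleteNormedModule)) in H.
  assert (H2 : RInt (fun x => INR (n + 2) * sin x ^ (n + 2) - INR (n + 1) * sin x ^ n) 0 (PI / 2) =
     INR (n + 2) * wallis (n + 2) - INR (n + 1) * wallis n).
  { apply (is_RInt_unique (V := R_CompleteNormedModule)).
    apply (is_RInt_minus (V := R_NormedModule)); apply (is_RInt_scal (V := R_NormedModule));
      apply (RInt_correct (V := R_CompleteNormedModule)); apply ex_RInt_sin_pow. }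
  rewrite H2 in H. unfold minus, plus, opp in H; simpl in H. lra.
Qed.

Lemma wallis_decr n : wallis (S n) <= wallis n.
Proof.
  unfold wallis. apply RInt_le. generalize PI_RGT_0; lra.
  apply ex_RInt_sin_pow. apply ex_RInt_sin_pow.
  intros x Hx. simpl. generalize (SIN_bound x) (sin_gt_0 x). intros H1 H2.
  assert (0 < sin x) by (apply H2; generalize PI_RGT_0; lra).
  assert (0 <= sin x ^ n) by (apply pow_le; lra). nra.
Qed.

Lemma wallis_prod n : INR (S n) * wallis n * wallis (S n) = PI / 2.
Proof.
  induction n. simpl. rewrite wallis_0, wallis_1. ring.
  generalize (wallis_rec n). replace (n + 2)%nat with (S (S n)) by lia.
  replace (n + 1)%nat with (S n) by lia. intros H. rewrite <- IHn.
  replace (INR (S (S n)) * wallis (S n) * wallis (S (S n))) with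
    (INR (S (S n)) * wallis (S (S n)) * wallis (S n)) by ring.
  rewrite H. ring.
Qed.

Lemma wallis_pos n : 0 < wallis n.
Proof.
  assert (H : forall m, 0 <= wallis m).
  { intros m. unfold wallis. apply RInt_ge_0. generalize PI_RGT_0; lra. apply ex_RInt_sin_pow.
    intros x Hx. apply pow_le. left. apply sin_gt_0; lra. }
  destruct (H n); auto. exfalso.
  generalize (wallis_prod n) PI_RGT_0. rewrite <- H0. lra.
Qed.

Lemma wallis_even m : wallis (2 * m) = PI / 2 * (INR (fact (2 * m)) / (4 ^ m * (INR (fact m) * INR (fact m)))).
Proof.
  induction m.
  - simpl. rewrite wallis_0. field.
  - replace (2 * S m)%nat with (2 * m + 2)%nat by lia.
    assert (H := wallis_rec (2 * m)).
    assert (Hp := lt_0_INR (2 * m + 2) ltac:(lia)).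
    apply Rmult_eq_reg_l with (INR (2 * m + 2)); [|lra]. rewrite H, IHm.
    replace (2 * m + 2)%nat with (S (S (2 * m))) by lia.
    replace (2 * m + 1)%nat with (S (2 * m)) by lia.
    change (fact (S (S (2 * m)))) with (S (S (2 * m)) * (S (2 * m) * fact (2 * m)))%nat.
    change (fact (S m)) with (S m * fact m)%nat.
    rewrite !mult_INR. rewrite !S_INR. rewrite mult_INR.
    assert (F1 := INR_fact_lt_0 m). assert (F2 := pos_INR m). simpl pow.
    assert (0 < 4 ^ m) by (apply pow_lt; lra). simpl (INR 2).
    field. repeat split; lra.
Qed.

(** The difference has derivative [x^2 / ((1 + x) (2 + x)^2)], which lies between 0 and [x^2 / 4].
    At [x = 1/p] the rational function is [1 / (p + 1/2)], exactly the term that occurs in the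
    increments of [dfact]. *)
Lemma ln_1_plus_bounds x : 0 < x -> 0 <= ln (1 + x) - 2 * x / (2 + x) <= x * x * x / 4.
Proof.
  intros Hx.
  destruct (MVT_cor2 (fun x => ln (1 + x) - 2 * x / (2 + x))
     (fun x => x * x / ((1 + x) * ((2 + x) * (2 + x)))) 0 x Hx) as [c [H1 H2]].
  - intros c Hc. apply is_derive_Reals. auto_derive. split; [lra|split; [lra|auto]]. field. lra.
  - rewrite Rplus_0_r, ln_1 in H1.
    replace (ln (1 + x) - 2 * x / (2 + x)) with (c * c / ((1 + c) * ((2 + c) * (2 + c))) * (x - 0)) by lra.
    assert (Hd : 4 <= (1 + c) * ((2 + c) * (2 + c))) by nra.
    assert (Hq : 0 <= c * c / ((1 + c) * ((2 + c) * (2 + c))) <= x * x / 4).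
    { split. apply Rdiv_le_0_compat; nra. apply Rmult_le_compat; try nra.
      left. apply Rinv_0_lt_compat. lra. apply Rinv_le_contravar; lra. }
    split; nra.
Qed.

Definition dfact (n : nat) : R := ln (INR (fact n)) - (INR n + / 2) * ln (INR n) + INR n.

(** With [p = n + 1], the decrement is [(p + 1/2) (ln (1 + 1/p) - 1/(p + 1/2))], of order [p^(-2)]
    by the previous lemma. *)
Lemma dfact_cv : exists k : R, is_lim_seq dfact k.
Proof.
  assert (Hs : ex_series (fun n => dfact (S n) - dfact (S (S n)))).
  { apply (ex_series_le (K := R_AbsRing) (V := R_CompleteNormedModule) _
      (fun n => 1 * / (INR (S n) * INR (S n)))).
    2: { apply (ex_series_scal (V := R_NormedModule)). apply ex_series_inv_sqr. }
    intros n. change (Rabs (dfact (S n) - dfact (S (S n))) <= 1 * / (INR (S n) * INR (S n))).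
    unfold dfact. change (fact (S (S n))) with (S (S n) * fact (S n))%nat.
    rewrite mult_INR, ln_mult; [|apply lt_0_INR; lia|apply lt_0_INR, lt_O_fact].
    assert (H1 := lt_0_INR (S n) ltac:(lia)).
    rewrite (S_INR (S n)). 
    assert (Hp : 1 <= INR (S n)) by (rewrite S_INR; generalize (pos_INR n); lra).
    set (p := INR (S n)) in *.
    assert (Hx : 0 < / p) by (apply Rinv_0_lt_compat; auto).
    generalize (ln_1_plus_bounds (/ p) Hx).
    replace (1 + / p) with ((p + 1) / p) by (field; lra). rewrite ln_div by lra.
    replace (2 * / p / (2 + / p)) with (1 / (p + / 2)) by (field; lra).
    set (D := ln (p + 1) - ln p). intros [B1 B2].
    match goal with |- Rabs ?e <= _ => replace e with ((p + / 2) * (D - 1 / (p + / 2))) end.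
    2: { unfold D. field. lra. }
    rewrite Rabs_pos_eq by (apply Rmult_le_pos; lra).
    apply Rle_trans with ((p + / 2) * (/ p * / p * / p / 4)). apply Rmult_le_compat_l; lra.
    replace ((p + / 2) * (/ p * / p * / p / 4)) with ((/ 4 + / 8 * / p) * / (p * p)) by (field; lra).
    apply Rmult_le_compat_r. left; apply Rinv_0_lt_compat; nra.
    assert (/ p <= 1) by (rewrite <- Rinv_1; apply Rinv_le_contravar; lra). lra. }
  destruct Hs as [l Hl]. exists (dfact 1 - l).
  apply is_lim_seq_incr_1. apply is_lim_seq_incr_1.
  apply is_lim_seq_ext with (fun n => dfact 1 - sum_n (fun n => dfact (S n) - dfact (S (S n))) n).
  - induction n. rewrite sum_O. ring. rewrite sum_Sn. unfold plus; simpl. simpl in IHn. lra.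
  - apply (is_lim_seq_minus' (fun _ => dfact 1)). apply is_lim_seq_const. exact Hl.
Qed.

(** The limit [k] of [dfact] is determined by computing the limit of [u] twice. Monotonicity and the
    product formula of the Wallis integrals squeeze it to [ln 1 = 0]. The closed form of
    [wallis (2 * m)] makes it [ln PI + ln 2 + 2 k - 4 k], because the terms in [m ln m] and [m]
    cancel between [2 * dfact (2 * m)] and [4 * dfact m]. *)
Lemma stirling : is_lim_seq dfact (/ 2 * ln (2 * PI)).
Proof.
  destruct dfact_cv as [k Hk].
  assert (HPI := PI_RGT_0).
  assert (E : k = / 2 * ln (2 * PI)); [|rewrite <- E; auto].
  set (u := fun m : nat => ln (4 * INR (S m) / PI * (wallis (2 * S m) * wallis (2 * S m)))).
  assert (L1 : is_lim_seq u 0).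
  { rewrite <- ln_1. 
    apply (is_lim_seq_continuous ln). apply derivable_continuous_pt.
    exists (/ 1). apply derivable_pt_lim_ln. lra.
    apply is_lim_seq_le_le with (u := fun m => 1 - / INR (S m)) (w := fun _ => 1).
    - intros m. assert (Hm := lt_0_INR (S m) ltac:(lia)).
      assert (A := wallis_prod (2 * S m)). 
      assert (A' := wallis_prod (2 * S m - 1)). replace (S (2 * S m - 1)) with (2 * S m)%nat in A' by lia.
      assert (B := wallis_decr (2 * S m)).
      assert (B' := wallis_decr (2 * S m - 1)). replace (S (2 * S m - 1)) with (2 * S m)%nat in B' by lia.
      assert (P := wallis_pos (2 * S m)).
      rewrite (S_INR (2 * S m)), mult_INR in A. rewrite mult_INR in A'. simpl (INR 2) in A, A'.
      set (w := wallis (2 * S m)) in *. set (p := INR (S m)) in *.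
      assert (C1 : PI / 2 <= (2 * p + 1) * (w * w)).
      { rewrite <- A. rewrite Rmult_assoc. apply Rmult_le_compat; try lra.
        assert (0 < wallis (S (2 * S m))) by apply wallis_pos. nra.
        apply Rmult_le_compat_l; lra. }
      assert (C2 : 2 * p * (w * w) <= PI / 2).
      { rewrite <- A'. rewrite Rmult_assoc. rewrite (Rmult_assoc _ (wallis _)).
        replace (1 + 1) with 2 by ring. rewrite !Rmult_assoc.
        apply Rmult_le_compat_l. lra. apply Rmult_le_compat_l. lra.
        apply Rmult_le_compat_r; lra. }
      replace (4 * p / PI * (w * w)) with ((2 * p * (w * w)) / (PI / 2)) by (field; lra).
      split.
      + apply le_div_r. lra.
        assert (w * w <= PI / 2 / (2 * p)) by (apply le_div_r; lra).
        assert (PI / 2 / (2 * p) = PI / 2 * / p / 2) by (field; lra).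
        assert (0 < PI / 2 * / p) by (apply Rmult_lt_0_compat; [lra|apply Rinv_0_lt_compat; lra]).
        lra.
      + apply le_div_l; lra.
    - replace (Finite 1) with (Finite (1 - 0)) by (f_equal; ring).
      apply is_lim_seq_minus'. apply is_lim_seq_const. apply is_lim_seq_inv_S.
    - apply is_lim_seq_const. }
  assert (L2 : is_lim_seq u (ln PI + ln 2 + 2 * k - 4 * k)).
  { apply is_lim_seq_ext with (fun m => ln PI + ln 2 + 2 * dfact (2 * S m) - 4 * dfact (S m)).
    - intros m. unfold u. assert (Hm := lt_0_INR (S m) ltac:(lia)).
      rewrite wallis_even. unfold dfact. rewrite mult_INR. simpl (INR 2).
      assert (F1 := INR_fact_lt_0 (S m)). assert (F2 := INR_fact_lt_0 (2 * S m)).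
      set (a := INR (fact (S m))) in *. set (b := INR (fact (2 * S m))) in *.
      assert (F4 : 0 < 4 ^ S m) by (apply pow_lt; lra).
      assert (E4 : ln (4 ^ S m) = 2 * INR (S m) * ln 2).
      { rewrite ln_pow by lra. replace 4 with (2 * 2) by ring. rewrite ln_mult by lra. ring. }
      assert (E5 : ln 4 = 2 * ln 2) by (replace 4 with (2 * 2) by ring; rewrite ln_mult by lra; ring).
      set (p := INR (S m)) in *. set (f := 4 ^ S m) in *.
      assert (0 < a * a) by nra. assert (0 < f * (a * a)) by nra.
      assert (G : 0 < PI / 2 * (b / (f * (a * a)))).
      { apply Rmult_lt_0_compat. lra. apply Rdiv_lt_0_compat; auto. }
      assert (EW : ln (PI / 2 * (b / (f * (a * a)))) = ln PI - ln 2 + ln b - ln f - 2 * ln a).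
      { rewrite ln_mult by (try lra; apply Rdiv_lt_0_compat; auto).
        rewrite !ln_div by lra. rewrite !ln_mult by lra. ring. }
      rewrite (ln_mult (1 + 1) p) by lra.
      rewrite ln_mult; [|apply Rdiv_lt_0_compat; lra|apply Rmult_lt_0_compat; exact G].
      rewrite (ln_mult _ _ G G). rewrite EW.
      rewrite ln_div by lra. rewrite !ln_mult by lra.
      rewrite E4, E5. replace (1 + 1) with 2 by ring. field.
    - apply is_lim_seq_minus'; [apply is_lim_seq_plus'; [apply is_lim_seq_const|]|];
        apply (is_lim_seq_mult' (fun _ => _)); try apply is_lim_seq_const.
      + apply (is_lim_seq_subseq dfact k (fun m => 2 * S m)%nat). 2: exact Hk.
        apply eventually_subseq. intros n; lia.
      + apply is_lim_seq_incr_1 in Hk. exact Hk. }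
  apply is_lim_seq_unique in L1. apply is_lim_seq_unique in L2. rewrite L1 in L2. injection L2.
  intros. rewrite ln_mult by lra. lra.
Qed.

(** * Exponential polynomials and their Laplace transforms *)

(** The list of triples [(p, n, b)] stands for the sum of the [p t^n exp(b t)];
    [lap] is its Laplace transform, read off algebraically. *)
Definition epoly := list (R * nat * R).

Fixpoint ev (l : epoly) (t : R) : R :=
  match l with
  | nil => 0
  | (p, n, b) :: l' => p * t ^ n * exp (b * t) + ev l' t
  end.

Fixpoint lap (l : epoly) (z : C) : C :=
  match l with
  | nil => RtoC 0
  | (p, n, b) :: l' => (RtoC (p * INR (fact n)) / (z - RtoC b) ^ S n + lap l' z)%C
  end.

Fixpoint dep (l : epoly) : epoly :=
  match l with
  | nil => nil
  | (p, n, b) :: l' => (p * INR n, pred n, b) :: (p * b, n, b) :: dep l'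
  end.

Lemma is_derive_ev l t : is_derive (ev l) t (ev (dep l) t).
Proof.
  induction l as [|[[p n] b] l IH].
  - apply (is_derive_const 0).
  - cbn [ev dep].
    apply (is_derive_ext (fun t => p * t ^ n * exp (b * t) + ev l t)). auto.
    replace (p * INR n * t ^ pred n * exp (b * t) + (p * b * t ^ n * exp (b * t) + ev (dep l) t))
      with (plus (p * INR n * t ^ pred n * exp (b * t) + p * b * t ^ n * exp (b * t)) (ev (dep l) t))
      by (unfold plus; simpl; ring).
    apply (is_derive_plus (fun t => p * t ^ n * exp (b * t)) (ev l)); auto.
    auto_derive; auto. ring.
Qed.

Lemma Derive_n_ev l k t : Derive_n (ev l) k t = ev (Nat.iter k dep l) t.
Proof.
  revert t. induction k; intros t; auto.
  simpl. rewrite (Derive_ext _ (ev (Nat.iter k dep l))) by auto.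
  apply is_derive_unique. apply is_derive_ev.
Qed.

Lemma ex_derive_n_ev l k t : ex_derive_n (ev l) k t.
Proof.
  destruct k; simpl; auto.
  apply (ex_derive_ext (ev (Nat.iter k dep l))).
  - intros s. rewrite Derive_n_ev; auto.
  - eexists. apply is_derive_ev.
Qed.

(** Suppose that the derivatives of order below [j] vanish at 0 and the [j]-th is [v <> 0].
    Taylor-Lagrange gives [ev l t = t^j / j!] times the [j]-th derivative at a point near 0, so
    [Rabs (ev l t)] is at least [Rabs v * t^j / (2 j!)]. For small [t] this contradicts a bound of
    order [t^m] with [m > j]. *)
Lemma ev_vanish l m : (exists K d, 0 < d /\ forall t, 0 < t < d -> Rabs (ev l t) <= K * t ^ m) ->
  forall j, (j < m)%nat -> ev (Nat.iter j dep l) 0 = 0.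
Proof.
  intros [K [d [Hd HK]]] j. induction j as [j IH] using lt_wf_ind. intros Hj.
  set (v := ev (Nat.iter j dep l) 0).
  destruct (Req_dec v 0) as [|Hv]; auto. exfalso.
  assert (Hcont : continuous (ev (Nat.iter j dep l)) 0)
    by (apply (ex_derive_continuous (ev (Nat.iter j dep l))); eexists; apply is_derive_ev).
  assert (Hav := Rabs_pos_lt _ Hv).
  apply continuity_pt_filterlim in Hcont.
  destruct (Hcont (Rabs v / 2)) as [d2 [Hd2 Hd2']]. lra.
  assert (HF := INR_fact_lt_0 j).
  set (C0 := Rabs K * INR (fact j) + 1).
  assert (HC0 : 0 < C0) by (unfold C0; generalize (Rabs_pos K); nra).
  (* The four bounds serve, in order: [t^m <= t^(j+1)], the hypothesis on [ev l], continuity of the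
     [j]-th derivative at 0, and the final contradiction, which is strict thanks to the [+ 1] in
     [C0]. *)
  set (t := Rmin (Rmin 1 (d / 2)) (Rmin (d2 / 2) (Rabs v / (2 * C0)))).
  assert (Ht : 0 < t). { repeat apply Rmin_pos; try lra. apply Rdiv_lt_0_compat; lra. }
  assert (Ht1 : t <= 1) by (eapply Rle_trans; [apply Rmin_l|apply Rmin_l]).
  assert (Ht2 : t <= d / 2) by (eapply Rle_trans; [apply Rmin_l|apply Rmin_r]).
  assert (Ht3 : t <= d2 / 2) by (eapply Rle_trans; [apply Rmin_r|apply Rmin_l]).
  assert (Ht4 : t <= Rabs v / (2 * C0)) by (eapply Rle_trans; [apply Rmin_r|apply Rmin_r]).
  assert (Hex : exists s, 0 <= s <= t /\ ev l t = t ^ j / INR (fact j) * ev (Nat.iter j dep l) s).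
  { destruct j as [|j].
    - exists t. split. lra. simpl. field.
    - destruct (Taylor_Lagrange (ev l) j 0 t Ht) as [s [Hs1 Hs2]].
      intros; apply ex_derive_n_ev.
      exists s. split. lra.
      rewrite Hs2, Derive_n_ev, Rminus_0_r.
      rewrite (sum_eq _ (fun _ => 0)).
      2: { intros i Hi. rewrite Derive_n_ev, (IH i) by lia. ring. }
      rewrite sum_cte. ring. }
  destruct Hex as [s [Hs1 Hs2]].
  assert (Hvs : Rabs v / 2 <= Rabs (ev (Nat.iter j dep l) s)).
  { destruct (Req_dec s 0) as [->|Hs0]. fold v. lra.
    assert (A : Rabs (ev (Nat.iter j dep l) s - v) < Rabs v / 2).
    { apply Hd2'. split. split. exact I. auto. simpl. unfold R_dist. rewrite Rminus_0_r, Rabs_pos_eq; lra. }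
    generalize (Rabs_triang_inv v (v - ev (Nat.iter j dep l) s)).
    rewrite (Rabs_minus_sym v). replace (v - (v - ev (Nat.iter j dep l) s)) with (ev (Nat.iter j dep l) s) by ring.
    lra. }
  assert (HKt := HK t ltac:(lra)).
  assert (Htj : 0 < t ^ j) by (apply pow_lt; auto).
  rewrite Hs2 in HKt. rewrite Rabs_mult in HKt.
  rewrite (Rabs_pos_eq (t ^ j / INR (fact j))) in HKt by (apply Rdiv_le_0_compat; lra).
  assert (B : K * t ^ m <= Rabs K * (t * t ^ j)).
  { apply Rle_trans with (Rabs K * t ^ m). apply Rmult_le_compat_r. apply pow_le; lra. apply Rle_abs.
    apply Rmult_le_compat_l. apply Rabs_pos.
    replace m with (S j + (m - S j))%nat by lia. rewrite pow_add. simpl.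
    rewrite <- (Rmult_1_r (t * t ^ j)) at 2. apply Rmult_le_compat_l. nra.
    replace 1 with (1 ^ (m - S j)) by apply pow1. apply pow_incr. lra. }
  assert (D1 : t ^ j / INR (fact j) * (Rabs v / 2) <= Rabs K * (t * t ^ j)).
  { eapply Rle_trans; [|exact B]. eapply Rle_trans; [|exact HKt].
    apply Rmult_le_compat_l; auto. apply Rdiv_le_0_compat; lra. }
  assert (D2 : Rabs v / 2 <= Rabs K * INR (fact j) * t).
  { apply Rmult_le_reg_l with (t ^ j / INR (fact j)). apply Rdiv_lt_0_compat; auto.
    eapply Rle_trans. exact D1. right. field. lra. }
  assert (D3 : C0 * t <= Rabs v / 2).
  { apply Rle_trans with (C0 * (Rabs v / (2 * C0))). apply Rmult_le_compat_l; lra. right; field; lra. }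
  unfold C0 in D3. nra.
Qed.

(** [z] is none of the exponents, so that the divisions in [lap] are genuine. *)
Definition lap_regular (l : epoly) (z : C) : Prop := List.Forall (fun e : R * nat * R => (z - RtoC (snd e))%C <> RtoC 0) l.

Lemma lap_regular_dep l z : lap_regular l z -> lap_regular (dep l) z.
Proof.
  induction l as [|[[p n] b] l IH]; intros H; inversion H; subst.
  - constructor.
  - repeat constructor; auto. apply IH; auto.
Qed.

Lemma lap_regular_iter l z m : lap_regular l z -> lap_regular (Nat.iter m dep l) z.
Proof. intros H; induction m; simpl; auto. apply lap_regular_dep; auto. Qed.

(** The rule for the Laplace transform of a derivative. It is checked triple by triple as an
    identity of rational functions; [n = 0] is separate because only then does the triple contribute
    to the value at 0. *)
Lemma lap_dep l z : lap_regular l z -> lap (dep l) z = (z * lap l z - RtoC (ev l 0))%C.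
Proof.
  induction l as [|[[p n] b] l IH]; intros H; inversion H; subst.
  - simpl. ring.
  - cbn [dep lap ev]. rewrite IH by auto. simpl in H2.
    rewrite Rmult_0_r, exp_0, RtoC_plus.
    destruct n.
    + simpl. rewrite Rmult_0_r, !Rmult_1_r, RtoC_mult. field. auto.
    + rewrite Rmult_1_r. rewrite pow_i by lia. rewrite Rmult_0_r.
      change (fact (S n)) with (S n * fact n)%nat. rewrite mult_INR.
      simpl pred. rewrite !RtoC_mult.
      assert (Hp : ((z - RtoC b) ^ S n)%C <> 0%C) by (apply Cpow_nz; auto).
      rewrite (Cpow_S (z - RtoC b) (S n)). field. auto.
Qed.

Lemma lap_bound l : exists K r, 1 <= r /\ 0 <= K /\ forall z, r <= Cmod z -> 
  lap_regular l z /\ Cmod (lap l z) <= K / Cmod z.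
Proof.
  induction l as [|[[p n] b] l IH].
  - exists 0, 1. split; [lra|split;[lra|]]. intros z Hz. split. constructor. simpl. rewrite Cmod_0. lra.
  - destruct IH as [K [r [Hr [HK H]]]].
    exists (Rabs (p * INR (fact n)) * 2 ^ S n + K), (Rmax r (2 * Rabs b + 2)).
    assert (Hb := Rabs_pos b).
    assert (H0 : 0 <= Rabs (p * INR (fact n)) * 2 ^ S n) by (apply Rmult_le_pos; [apply Rabs_pos|apply pow_le; lra]).
    split. eapply Rle_trans. exact Hr. apply Rmax_l.
    split. lra.
    intros z Hz. assert (Hz1 := Rle_trans _ _ _ (Rmax_l _ _) Hz). assert (Hz2 := Rle_trans _ _ _ (Rmax_r _ _) Hz).
    destruct (H z Hz1) as [H1 H2].
    assert (H3 : Cmod z / 2 <= Cmod (z - RtoC b)%C).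
    { generalize (Cmod_minus_ge z (RtoC b)). rewrite Cmod_R. lra. }
    split. constructor; auto. simpl. apply Cmod_gt_0. lra.
    cbn [lap]. eapply Rle_trans. apply Cmod_triangle. unfold Rdiv. rewrite Rmult_plus_distr_r.
    apply Rplus_le_compat; auto.
    rewrite Cmod_div', Cmod_R, Cmod_pow. unfold Rdiv. rewrite Rmult_assoc.
    apply Rmult_le_compat_l. apply Rabs_pos.
    apply Rle_trans with (/ ((Cmod z / 2) ^ S n)).
    { apply Rinv_le_contravar. apply pow_lt; lra. apply pow_incr; lra. }
    unfold Rdiv. rewrite Rpow_mult_distr, pow_inv, Rinv_mult, Rinv_inv, Rmult_comm.
    apply Rmult_le_compat_l. apply pow_le; lra.
    apply Rinv_le_contravar. lra. 
    rewrite <- (pow_1 (Cmod z)) at 1. apply Rle_pow. lra. lia.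
Qed.

(** Integration by parts: an exponential polynomial that vanishes to order [m]
    at [0] has a Laplace transform of order [z^(-m-1)]. *)
Lemma lap_order l m : (exists K d, 0 < d /\ forall t, 0 < t < d -> Rabs (ev l t) <= K * t ^ m) ->
  exists K r, 1 <= r /\ 0 <= K /\ forall z, r <= Cmod z -> 
  lap_regular l z /\ Cmod (lap l z) <= K / Cmod z ^ S m.
Proof.
  intros H. assert (Hv := ev_vanish l m H).
  destruct (lap_bound l) as [K1 [r1 [Hr1 [HK1 H1]]]].
  destruct (lap_bound (Nat.iter m dep l)) as [K2 [r2 [Hr2 [HK2 H2]]]].
  exists K2, (Rmax r1 r2). split. eapply Rle_trans. exact Hr1. apply Rmax_l. split; auto.
  intros z Hz. assert (Hz1 := Rle_trans _ _ _ (Rmax_l _ _) Hz). assert (Hz2 := Rle_trans _ _ _ (Rmax_r _ _) Hz).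
  destruct (H1 z Hz1) as [A1 _]. destruct (H2 z Hz2) as [_ A2]. split; auto.
  assert (E : forall j, (j <= m)%nat -> lap (Nat.iter j dep l) z = (z ^ j * lap l z)%C).
  { induction j; intros Hj. simpl. ring.
    simpl Nat.iter. rewrite lap_dep by (apply lap_regular_iter; auto).
    rewrite IHj, Hv by lia. rewrite Cpow_S. ring. }
  rewrite E in A2 by lia. rewrite Cmod_mult, Cmod_pow in A2.
  assert (0 < Cmod z ^ m) by (apply pow_lt; lra).
  apply Rmult_le_reg_l with (Cmod z ^ m); auto.
  eapply Rle_trans. exact A2. right. simpl. field. split; lra.
Qed.

(** * The generating function of the coefficients *)

Lemma locally'_0 (P : R -> Prop) : locally' 0 P ->
  exists d, 0 < d /\ forall t, t <> 0 -> Rabs t < d -> P t.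
Proof.
  intros [d Hd]. exists d. split. apply cond_pos.
  intros t H0 Ht. apply Hd; auto. change (Rabs (t - 0) < d). rewrite Rminus_0_r. auto.
Qed.

Lemma CV_radius_pos (a : nat -> R) t : t <> 0 -> ex_pseries a t -> Rbar_lt 0 (CV_radius a).
Proof.
  intros H0 H. apply Rbar_lt_le_trans with (Rabs t). simpl. apply Rabs_pos_lt; auto.
  apply Rbar_not_lt_le. intros Hlt.
  apply (CV_disk_outside a t Hlt).
  destruct H as [l H]. apply is_pseries_R in H.
  apply (ex_series_lim_0 (fun n => a n * t ^ n)). exists l. exact H.
Qed.

(** [is_egf] says nothing at [t = 0], so the constant coefficient is recovered from the limit of [f]
    by continuity of the power series. *)
Lemma PSeries_at_0 (a : nat -> R) (f : R -> R) (d : R) : 0 < d ->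
  (forall t, t <> 0 -> Rabs t < d -> is_pseries a t (f t)) ->
  forall l, (forall eps, 0 < eps -> exists e, 0 < e /\ forall t, 0 < t < e -> Rabs (f t - l) < eps) -> a O = l.
Proof.
  intros Hd H l Hl.
  assert (HCV : Rbar_lt (Rabs 0) (CV_radius a)).
  { rewrite Rabs_R0. apply CV_radius_pos with (d / 2). lra. eexists. apply H. lra. rewrite Rabs_pos_eq; lra. }
  assert (Hc := PSeries_continuity a 0 HCV).
  rewrite <- PSeries_0. apply Rminus_diag_uniq. apply Rabs_eq_0. apply Rle_antisym; [|apply Rabs_pos].
  apply le_epsilon. intros eps He.
  destruct (Hc (eps / 2)) as [d1 [Hd1 H1]]. lra.
  destruct (Hl (eps / 2)) as [d2 [Hd2 H2]]. lra.
  set (t := Rmin (d / 2) (Rmin (d1 / 2) (d2 / 2))).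
  assert (Ht : 0 < t) by (repeat apply Rmin_pos; lra).
  assert (Ht1 : t <= d / 2) by apply Rmin_l.
  assert (Ht2 : t <= d1 / 2) by (eapply Rle_trans; [apply Rmin_r|apply Rmin_l]).
  assert (Ht3 : t <= d2 / 2) by (eapply Rle_trans; [apply Rmin_r|apply Rmin_r]).
  assert (E : PSeries a t = f t) by (apply is_pseries_unique, H; [lra|rewrite Rabs_pos_eq; lra]).
  assert (A1 : Rabs (PSeries a t - PSeries a 0) < eps / 2).
  { apply H1. split. split. exact I. lra. simpl. unfold R_dist. rewrite Rminus_0_r, Rabs_pos_eq; lra. }
  assert (A2 := H2 t ltac:(lra)). rewrite E in A1.
  replace (PSeries a 0 - l) with (- (f t - PSeries a 0) + (f t - l)) by ring.
  eapply Rle_trans. apply Rabs_triang. rewrite Rabs_Ropp. lra.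
Qed.

Lemma Bernoulli_0 B : Bernoulli_numbers B -> B O = 1.
Proof.
  intros H. apply locally'_0 in H. destruct H as [d [Hd H]].
  assert (E := PSeries_at_0 _ _ d Hd H 1). simpl in E.
  rewrite <- E. field.
  intros eps He. exists eps. split; auto. intros t Ht.
  assert (A1 := exp_ineq1_le t). assert (A2 := exp_ineq1_le (- t)). rewrite exp_Ropp in A2.
  assert (P := exp_pos t). 
  assert (A3 : (1 - t) * exp t <= 1).
  { apply Rmult_le_compat_r with (r := exp t) in A2; [|lra]. rewrite Rinv_l in A2; lra. }
  assert (A4 : 0 < exp t - 1) by lra.
  replace (t / (exp t - 1) - 1) with (- ((exp t - 1 - t) / (exp t - 1))) by (field; lra).
  rewrite Rabs_Ropp, Rabs_pos_eq by (apply Rdiv_le_0_compat; lra).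
  apply Rle_lt_trans with t; [|lra]. apply le_div_l. auto. nra.
Qed.

(** With [q = exp (t/2)] this is [2 cosh (t/2) - sech (t/2) / 4 - csch (t/2) / 4 + 1 / (2t)]. The
    first two terms generate the [a_(2m+1)]. The other two generate the [a_(2m)], by
    [coth x - coth (x/2) = - csch x]. *)
Definition genA (t : R) : R :=
  let q := exp (t / 2) in
  q + / q - q / (2 * (q * q + 1)) - q / (2 * (q * q - 1)) + 1 / (2 * t).

Definition coef_c (E B : nat -> R) (k : nat) : R := coef_a E B (S k) / INR (fact k).

Lemma coef_a_odd E B m : coef_a E B (S (2 * m)) = (8 - E (2 * m)%nat) / 2 ^ (2 * m + 2).
Proof.
  unfold coef_a.
  replace (Nat.div2 (S (2 * m))) with m by (symmetry; apply Nat.div2_succ_double).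
  replace (Nat.even (S (2 * m))) with false. reflexivity.
  symmetry. rewrite Nat.even_succ, Nat.odd_mul. reflexivity.
Qed.

Lemma coef_a_even E B m : (1 <= m)%nat ->
  coef_a E B (2 * m) = (1 - 1 / 2 ^ (2 * m - 1)) * (B (2 * m)%nat / (4 * INR m)).
Proof.
  intros H. unfold coef_a.
  replace (Nat.div2 (2 * m)) with m by (symmetry; apply Nat.div2_double).
  replace (Nat.even (2 * m)) with true by (symmetry; rewrite Nat.even_mul; reflexivity).
  replace (Nat.eqb (2 * m) 0) with false by (symmetry; apply Nat.eqb_neq; lia). reflexivity.
Qed.

Lemma is_series_plus_R (a b : nat -> R) (l m : R) : is_series a l -> is_series b m ->
  is_series (fun n => a n + b n) (l + m).
Proof. apply (is_series_plus (V := R_NormedModule)). Qed.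

Lemma is_series_scal_R (c : R) (a : nat -> R) (l : R) : is_series a l ->
  is_series (fun n => c * a n) (c * l).
Proof. apply (is_series_scal (V := R_NormedModule)). Qed.

Lemma is_series_ext_R (a b : nat -> R) (l m : R) : (forall n, a n = b n) -> l = m -> is_series a l -> is_series b m.
Proof. intros H -> Ha. apply (is_series_ext a); auto. Qed.

Lemma pow_opp_even t m : (- t) ^ (2 * m) = t ^ (2 * m).
Proof. rewrite !pow_mult. f_equal. ring. Qed.

Lemma pow_opp_odd t m : (- t) ^ S (2 * m) = - t ^ S (2 * m).
Proof. rewrite <- !tech_pow_Rmult, pow_opp_even. ring. Qed.

Lemma coef_c_series E B : Euler_numbers E -> Bernoulli_numbers B ->
  exists d, 0 < d /\ forall t, 0 < t < d -> is_pseries (coef_c E B) t (genA t).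
Proof.
  intros HE HB. assert (HB0 := Bernoulli_0 B HB).
  apply locally'_0 in HE. destruct HE as [d1 [Hd1 HE]].
  apply locally'_0 in HB. destruct HB as [d2 [Hd2 HB]].
  exists (Rmin d1 d2). split. apply Rmin_pos; auto.
  intros t [Ht0 Ht].
  assert (Ht1 : t < d1) by (eapply Rlt_le_trans; [exact Ht|apply Rmin_l]).
  assert (Ht2 : t < d2) by (eapply Rlt_le_trans; [exact Ht|apply Rmin_r]).
  assert (E1 := HE (t / 2) ltac:(lra) ltac:(rewrite Rabs_pos_eq; lra)).
  assert (E2 := HE (- (t / 2)) ltac:(lra) ltac:(rewrite Rabs_Ropp, Rabs_pos_eq; lra)).
  assert (B1 := HB t ltac:(lra) ltac:(rewrite Rabs_pos_eq; lra)).
  assert (B2 := HB (- t) ltac:(lra) ltac:(rewrite Rabs_Ropp, Rabs_pos_eq; lra)).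
  assert (B3 := HB (t / 2) ltac:(lra) ltac:(rewrite Rabs_pos_eq; lra)).
  assert (B4 := HB (- (t / 2)) ltac:(lra) ltac:(rewrite Rabs_Ropp, Rabs_pos_eq; lra)).
  assert (X1 := is_exp_Reals (t / 2)). assert (X2 := is_exp_Reals (- (t / 2))).
  cbv beta in *.
  apply is_pseries_R in E1, E2, B1, B2, B3, B4, X1, X2. apply is_pseries_R.
  (* Removing the constant term [B 0 = 1] from the Bernoulli series leaves only powers [x^(k+1)],
     which can be divided by [t]; this is the shift from [a_(k+1)] to the coefficient of [t^k]. *)
  assert (DB : forall x l : R, is_series (fun n => B n / INR (fact n) * x ^ n) l ->
     is_series (fun n => B (S n) / INR (fact (S n)) * x ^ S n) (l - 1)%R).
  { intros x l H.
    apply (is_series_incr_1 (V := R_NormedModule) (fun n => B n / INR (fact n) * x ^ n)).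
    assert (E0 : l = (l - 1) + B O / INR (fact O) * x ^ O) by (rewrite HB0; simpl; field).
    rewrite E0 in H. exact H. }
  apply DB in B1, B2, B3, B4.
  set (q := exp (t / 2)) in *.
  assert (Hq : 1 < q). { unfold q. rewrite <- exp_0. apply exp_increasing. lra. }
  assert (Eq2 : exp t = q * q). { unfold q. rewrite <- exp_plus. f_equal. field. }
  assert (Eqm : exp (- (t / 2)) = / q) by (unfold q; apply exp_Ropp).
  assert (Eqm2 : exp (- t) = / (q * q)) by (rewrite exp_Ropp, Eq2; auto).
  replace (2 * (t / 2)) with t in E1 by field.
  replace (2 * - (t / 2)) with (- t) in E2 by field.
  rewrite Eq2 in E1, B1. rewrite Eqm, Eqm2 in E2. rewrite Eqm2 in B2. fold q in B3. rewrite Eqm in B4, X2.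
  (* Adding the values at opposite points isolates the even powers. The weights are those of
     [(8 - E_(2m)) / 4] at [t/2], and of the two terms of [1 - 2^(1-2m)], which come from the
     Bernoulli series at [t] and at [t/2]. *)
  assert (HH := is_series_plus_R _ _ _ _ 
    (is_series_plus_R _ _ _ _ (is_series_scal_R 1 _ _ (is_series_plus_R _ _ _ _ X1 X2))
      (is_series_scal_R (- / 8) _ _ (is_series_plus_R _ _ _ _ E1 E2)))
    (is_series_plus_R _ _ _ _ (is_series_scal_R (/ (4 * t)) _ _ (is_series_plus_R _ _ _ _ B1 B2))
      (is_series_scal_R (- / (2 * t)) _ _ (is_series_plus_R _ _ _ _ B3 B4)))).
  eapply is_series_ext_R; [| |exact HH]; cbv beta.
  - intros k. unfold coef_c.
    assert (Fk := INR_fact_neq_0 k).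
    change (fact (S k)) with (S k * fact k)%nat. rewrite mult_INR.
    assert (FS := not_0_INR (S k) ltac:(lia)).
    assert (P2 : forall j, 2 ^ j <> 0) by (intros; apply pow_nonzero; lra).
    destruct (Nat.Even_or_Odd k) as [[m Hm]|[m Hm]].
    + subst k. rewrite coef_a_odd, !pow_opp_even, !pow_opp_odd.
      replace (2 * m + 2)%nat with (S (S (2 * m))) by lia.
      unfold Rdiv. rewrite !Rpow_mult_distr, !pow_inv. rewrite <- !tech_pow_Rmult.
      field. repeat split; auto; lra.
    + replace (2 * m + 1)%nat with (S (2 * m)) in Hm by lia. subst k.
      replace (S (S (2 * m))) with (2 * S m)%nat by lia.
      rewrite coef_a_even, !pow_opp_even, !pow_opp_odd by lia.
      replace (2 * S m - 1)%nat with (S (2 * m)) by lia.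
      rewrite (mult_INR 2 (S m)). simpl (INR 2).
      assert (FSm := not_0_INR (S m) ltac:(lia)).
      replace (2 * S m)%nat with (S (S (2 * m))) by lia.
      unfold Rdiv. rewrite !Rpow_mult_distr, !pow_inv.
      rewrite <- !tech_pow_Rmult.
      field. repeat split; auto; lra.
  - unfold genA. fold q.
    assert (q * q - 1 <> 0) by nra. assert (q * q + 1 <> 0) by nra.
    assert (q * q * (q * q) - 1 <> 0) by nra.
    assert (q * q * (q * q) + 1 <> 0) by nra.
    field. repeat split; try nra; auto.
Qed.

Fixpoint Rsum (u : nat -> R) (n : nat) : R :=
  match n with O => 0 | S m => Rsum u m + u m end.

Lemma sum_f_R0_Rsum u n : sum_f_R0 u n = Rsum u (S n).
Proof. induction n. simpl. ring. rewrite tech5, IHn. reflexivity. Qed.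

Lemma CV_radius_decr_n (a : nat -> R) n : CV_radius (PS_decr_n a n) = CV_radius a.
Proof.
  induction n.
  - apply CV_radius_ext. reflexivity.
  - rewrite <- IHn, <- (CV_radius_decr_1 (PS_decr_n a n)).
    apply CV_radius_ext. intros k. unfold PS_decr_n, PS_decr_1. f_equal. lia.
Qed.

(** The tail is [t^(n+1)] times a power series with the same radius of convergence, hence bounded
    near 0. *)
Lemma coef_c_tail E B n : Euler_numbers E -> Bernoulli_numbers B ->
  exists K d, 0 < d /\ forall t, 0 < t < d ->
    Rabs (genA t - Rsum (fun k => coef_c E B k * t ^ k) (S n)) <= K * t ^ S n.
Proof.
  intros HE HB. destruct (coef_c_series E B HE HB) as [d [Hd H]].
  set (c := coef_c E B) in *.
  assert (HCV : Rbar_lt 0 (CV_radius c)).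
  { apply CV_radius_pos with (d / 2). lra. eexists; apply H; lra. }
  assert (HCV' : Rbar_lt (Rabs 0) (CV_radius (PS_decr_n c (S n)))).
  { rewrite Rabs_R0. rewrite CV_radius_decr_n. auto. }
  destruct (PSeries_continuity _ _ HCV' 1 ltac:(lra)) as [d1 [Hd1 H1]].
  exists (Rabs (PSeries (PS_decr_n c (S n)) 0) + 1), (Rmin d d1). split. apply Rmin_pos; auto.
  intros t [Ht0 Ht].
  assert (Htd : t < d) by (eapply Rlt_le_trans; [exact Ht|apply Rmin_l]).
  assert (Htd1 : t < d1) by (eapply Rlt_le_trans; [exact Ht|apply Rmin_r]).
  assert (E1 : PSeries c t = genA t) by (apply is_pseries_unique, H; lra).
  rewrite <- E1, (PSeries_decr_n c n t) by (eexists; apply H; lra).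
  rewrite sum_f_R0_Rsum.
  match goal with |- Rabs ?e <= _ => replace e with (t ^ S n * PSeries (PS_decr_n c (S n)) t) by ring end.
  rewrite Rabs_mult, Rmult_comm, (Rabs_pos_eq (t ^ S n)) by (apply pow_le; lra).
  apply Rmult_le_compat_r. apply pow_le; lra.
  assert (A : Rabs (PSeries (PS_decr_n c (S n)) t - PSeries (PS_decr_n c (S n)) 0) < 1).
  { apply H1. split. split. exact I. lra. simpl. unfold R_dist. rewrite Rminus_0_r, Rabs_pos_eq; lra. }
  generalize (Rabs_triang_inv (PSeries (PS_decr_n c (S n)) t) (PSeries (PS_decr_n c (S n)) 0)). lra.
Qed.

(** Laplace original of the second derivative of the difference [z -> z + 2] of
    the truncated expansion; it equals
    [t (1 - exp(-2t)) (genA t - truncation of genA)]. *)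
Fixpoint Wsum (c : nat -> R) (n : nat) : epoly :=
  match n with
  | O => nil
  | S m => (c m, S m, -2) :: (- c m, S m, 0) :: Wsum c m
  end.

Definition Wpoly (c : nat -> R) (n : nat) : epoly :=
  (-1, 1%nat, - (5 / 2)) :: (-1, 1%nat, - (3 / 2)) :: (1, 1%nat, 1 / 2)
  :: (1 / 2, 0%nat, 0) :: (- (1 / 2), 0%nat, -2) :: Wsum c n.

Lemma ev_Wsum c n t : ev (Wsum c n) t = t * (exp (-2 * t) - 1) * Rsum (fun k => c k * t ^ k) n.
Proof.
  induction n. simpl. ring.
  cbn [Wsum ev Rsum]. rewrite IHn, Rmult_0_l, exp_0. simpl. ring.
Qed.

(** This is where the factor [t (1 - exp(-2t))] earns its place: with [q = exp (t/2)] one has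
    [1 - exp(-2t) = (q^2 + 1) (q^2 - 1) / q^4], which clears both denominators of [genA], while [t]
    clears [1 / (2t)]. *)
Lemma ev_Wpoly c n t : 0 < t ->
  ev (Wpoly c n) t = t * (1 - exp (-2 * t)) * (genA t - Rsum (fun k => c k * t ^ k) n).
Proof.
  intros Ht. unfold Wpoly. cbn [ev]. rewrite ev_Wsum. unfold genA.
  set (q := exp (t / 2)).
  assert (Hq : 1 < q). { unfold q. rewrite <- exp_0. apply exp_increasing. lra. }
  assert (E1 : exp (1 / 2 * t) = q) by (unfold q; f_equal; field).
  assert (E4 : exp (-2 * t) = / (q * q * q * q)).
  { unfold q. rewrite <- !exp_plus, <- exp_Ropp. f_equal. field. }
  assert (E3 : exp (- (3 / 2) * t) = / (q * q * q)).
  { unfold q. rewrite <- !exp_plus, <- exp_Ropp. f_equal. field. }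
  assert (E5 : exp (- (5 / 2) * t) = / (q * q * q * q * q)).
  { unfold q. rewrite <- !exp_plus, <- exp_Ropp. f_equal. field. }
  rewrite E1, E3, E4, E5, Rmult_0_l, exp_0. simpl.
  assert (q * q - 1 <> 0) by nra. assert (q * q + 1 <> 0) by nra.
  field. repeat split; auto; lra.
Qed.

(** Two of the orders come from [t (1 - exp(-2t))], the other [n + 1] from the truncation. *)
Lemma Wpoly_order E B n : Euler_numbers E -> Bernoulli_numbers B ->
  exists K d, 0 < d /\ forall t, 0 < t < d -> 
    Rabs (ev (Wpoly (coef_c E B) (S n)) t) <= K * t ^ (n + 3).
Proof.
  intros HE HB. destruct (coef_c_tail E B n HE HB) as [K [d [Hd H]]].
  exists (2 * K), d. split; auto. intros t Ht. specialize (H t Ht).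
  rewrite ev_Wpoly by lra. rewrite !Rabs_mult, (Rabs_pos_eq t) by lra.
  assert (A : Rabs (1 - exp (-2 * t)) <= 2 * t).
  { generalize (exp_ineq1_le (-2 * t)). intros. rewrite Rabs_pos_eq. lra.
    assert (exp (-2 * t) <= exp 0) by (left; apply exp_increasing; lra). rewrite exp_0 in *. lra. }
  replace (2 * K * t ^ (n + 3)) with ((t * (2 * t)) * (K * t ^ S n)).
  2: { rewrite pow_add. simpl. ring. }
  apply Rmult_le_compat; auto. apply Rmult_le_pos. lra. apply Rabs_pos. apply Rabs_pos.
  apply Rmult_le_compat_l; lra.
Qed.

(** * Summation and integration of asymptotic bounds in truncated cones *)

(** The sector of [asymp] with [k = sin eps], cut off at radius [r]. Written without angles, it is
    visibly preserved by translations to the right. *)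
Definition Dom (k r : R) (z : C) : Prop := k * Cmod z <= Re z /\ r <= Cmod z.

Lemma Cmod_plus_pos z t : 0 <= Re z -> 0 <= t -> Cmod z <= Cmod (z + RtoC t)%C /\ t <= Cmod (z + RtoC t)%C.
Proof.
  intros Hz Ht. split.
  - apply Rsqr_incr_0_var; [|apply Cmod_ge_0]. unfold Rsqr. rewrite !Cmod_sqr. reim. nra.
  - eapply Rle_trans; [|apply Re_le_Cmod]. reim. lra.
Qed.

Lemma Dom_re k r z : 0 < k -> 1 <= r -> Dom k r z -> 0 < Re z.
Proof. intros Hk Hr [H1 H2]. nra. Qed.

Lemma Dom_shift k r z t : 0 < k <= 1 -> 1 <= r -> 0 <= t -> Dom k r z -> Dom k r (z + RtoC t)%C.
Proof.
  intros Hk Hr Ht HD. assert (Hz := Dom_re k r z (proj1 Hk) Hr HD). destruct HD as [H1 H2].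
  destruct (Cmod_plus_pos z t) as [A1 A2]; try lra.
  split; [|lra]. reim.
  apply Rle_trans with (k * (Cmod z + t)).
  - apply Rmult_le_compat_l. lra. eapply Rle_trans. apply Cmod_triangle. rewrite Cmod_R_pos; lra.
  - nra.
Qed.

Lemma Clim_telescope (u : nat -> C) (b : nat -> R) : is_lim_seq b 0 ->
  (forall n, Cmod (u (S n) - u n)%C <= b n - b (S n)) ->
  exists l, Clim u l /\ Cmod (u O - l)%C <= b O.
Proof.
  intros Hb H.
  destruct (Cseries_cv u (fun n => b n - b (S n))) as [l Hl]; auto.
  - exists (b O - 0).
    change (is_lim_seq (sum_n (fun n => b n - b (S n))) (b O - 0)).
    apply is_lim_seq_ext with (fun n => b O - b (S n)).
    + induction n. rewrite sum_O. auto. rewrite sum_Sn, <- IHn. unfold plus; simpl. ring.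
    + apply is_lim_seq_minus'. apply is_lim_seq_const. apply is_lim_seq_incr_1 in Hb. exact Hb.
  - exists l. split; auto.
    assert (Hd : forall n, 0 <= b n).
    { intros n. apply (is_lim_seq_decr_compare b 0); auto.
      intros m. generalize (H m) (Cmod_ge_0 (u (S m) - u m)%C). lra. }
    apply (Clim_le (fun n => u O - u n)%C). apply Clim_minus; auto. apply Clim_const.
    assert (Hn : forall n, Cmod (u O - u n)%C <= b O - b n).
    { induction n. replace (u O - u O)%C with (RtoC 0) by ring. rewrite Cmod_0. lra.
      replace (u O - u (S n))%C with ((u O - u n) - (u (S n) - u n))%C by ring.
      eapply Rle_trans. apply Cmod_minus_le. generalize (H n). lra. }
    intros n. generalize (Hn n) (Hd n). lra.
Qed.

(** Stands in for comparing a sum with an integral. Bounding [(x + 2)^m] below by [x^m] reduces the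
    claim to [1/x <= 3/(x + 2)], which is [1 <= x]; hence the factor [3/2]. *)
Lemma inv_pow_telescope x m : 1 <= x -> / x ^ S (S m) <= 3 / 2 * (/ x ^ S m - / (x + 2) ^ S m).
Proof.
  intros Hx. assert (Hp : 0 < x ^ m) by (apply pow_lt; lra).
  assert (Hp2 : x ^ m <= (x + 2) ^ m) by (apply pow_incr; lra).
  assert (A : / (x + 2) ^ S m <= / ((x + 2) * x ^ m)).
  { simpl. apply Rinv_le_contravar. nra. apply Rmult_le_compat_l; lra. }
  apply Rle_trans with (3 / 2 * (/ x ^ S m - / ((x + 2) * x ^ m))); [|lra].
  replace (3 / 2 * (/ x ^ S m - / ((x + 2) * x ^ m))) with (3 / (x + 2) * / x ^ S m)
    by (simpl; field; repeat split; nra).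
  replace (/ x ^ S (S m)) with (/ x * / x ^ S m) by (simpl; field; repeat split; nra).
  apply Rmult_le_compat_r. left; apply Rinv_0_lt_compat, pow_lt; lra.
  apply le_div_r. lra. replace (/ x * (x + 2)) with (1 + 2 * / x) by (field; lra).
  assert (/ x <= / 1) by (apply Rinv_le_contravar; lra). lra.
Qed.

Lemma is_lim_seq_inv_lin x m : 1 <= x -> is_lim_seq (fun n => / (x + 2 * INR n) ^ S m) 0.
Proof.
  intros Hx. apply is_lim_seq_le_le_loc with (u := fun _ => 0) (w := fun n => / INR n).
  - exists 1%nat. intros n Hn.
    assert (H1 : 1 <= INR n) by (apply (le_INR 1); auto).
    split. left; apply Rinv_0_lt_compat, pow_lt; lra.
    apply Rinv_le_contravar. lra.
    apply Rle_trans with ((x + 2 * INR n) ^ 1). simpl. lra. apply Rle_pow. lra. lia.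
  - apply is_lim_seq_const.
  - apply is_lim_seq_incr_1. apply is_lim_seq_inv_S.
Qed.

Definition shift2 (z : C) (n : nat) : C := (z + RtoC (2 * INR n))%C.

Lemma Dom_shift2 k r z n : 0 < k <= 1 -> 1 <= r -> Dom k r z -> Dom k r (shift2 z n).
Proof. intros. apply Dom_shift; auto. generalize (pos_INR n); lra. Qed.

Lemma shift2_S z n : shift2 z (S n) = (shift2 z n + 2)%C.
Proof. unfold shift2. rewrite S_INR. replace (2 * (INR n + 1)) with (2 * INR n + 2) by ring. rewrite RtoC_plus. ring. Qed.

Lemma shift2_O z : shift2 z O = z.
Proof. unfold shift2. simpl. rewrite Rmult_0_r. ring. Qed.

(** In the right half-plane both [Cmod z] and [2 n] are at most [Cmod (z + 2 n)], so their mean is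
    too. This costs the factor [2^(m+2)] and makes the step bounds telescope, with the loss of one
    power. *)
Lemma tele k r K m f : 0 < k <= 1 -> 1 <= r -> 0 <= K ->
  (forall z, Dom k r z -> Cmod (f (z + 2)%C - f z)%C <= K / Cmod z ^ S (S m)) ->
  forall z, Dom k r z -> exists l, Clim (fun n => f (shift2 z n)) l /\
    Cmod (f z - l)%C <= 2 ^ S (S m) * K * (3 / 2) / Cmod z ^ S m.
Proof.
  intros Hk Hr HK H z HD.
  assert (HDn := fun n => Dom_shift2 k r z n Hk Hr HD).
  assert (Hre := Dom_re k r z (proj1 Hk) Hr HD).
  assert (Hz : 1 <= Cmod z) by (destruct HD; lra).
  destruct (Clim_telescope (fun n => f (shift2 z n))
    (fun n => 2 ^ S (S m) * K * (3 / 2) * / (Cmod z + 2 * INR n) ^ S m)) as [l [Hl1 Hl2]].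
  - replace (Finite 0) with (Finite (2 ^ S (S m) * K * (3 / 2) * 0)) by (f_equal; ring).
    apply is_lim_seq_mult'. apply is_lim_seq_const. apply is_lim_seq_inv_lin; auto.
  - intros n. rewrite shift2_S. eapply Rle_trans. apply H. auto.
    assert (Hn := pos_INR n).
    destruct (Cmod_plus_pos z (2 * INR n)) as [A1 A2]; try lra. fold (shift2 z n) in A1, A2.
    rewrite <- Rmult_minus_distr_l.
    apply Rle_trans with (2 ^ S (S m) * K * / (Cmod z + 2 * INR n) ^ S (S m)).
    + replace (2 ^ S (S m) * K * / (Cmod z + 2 * INR n) ^ S (S m)) with
        (K * / ((Cmod z + 2 * INR n) / 2) ^ S (S m)).
      2: { unfold Rdiv. rewrite Rpow_mult_distr, pow_inv. field.
           split; apply pow_nonzero; lra. }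
      apply Rmult_le_compat_l. lra. apply Rinv_le_contravar.
      apply pow_lt; lra. apply pow_incr; lra.
    + rewrite !Rmult_assoc. apply Rmult_le_compat_l. apply pow_le; lra.
      apply Rmult_le_compat_l. auto. 
      eapply Rle_trans. apply inv_pow_telescope. lra.
      rewrite S_INR. replace (Cmod z + 2 * INR n + 2) with (Cmod z + 2 * (INR n + 1)) by ring. lra.
  - exists l. split; auto. rewrite shift2_O in Hl2. simpl INR in Hl2.
    rewrite Rmult_0_r, Rplus_0_r in Hl2. exact Hl2.
Qed.

Lemma tele0 k r K m f : 0 < k <= 1 -> 1 <= r -> 0 <= K ->
  (forall z, Dom k r z -> Cmod (f (z + 2)%C - f z)%C <= K / Cmod z ^ S (S m)) ->
  (forall z, Dom k r z -> Clim (fun n => f (shift2 z n)) 0%C) ->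
  forall z, Dom k r z -> Cmod (f z) <= 2 ^ S (S m) * K * (3 / 2) / Cmod z ^ S m.
Proof.
  intros Hk Hr HK H H0 z HD.
  destruct (tele k r K m f Hk Hr HK H z HD) as [l [Hl1 Hl2]].
  assert (l = 0%C) by (eapply Clim_unique; [exact Hl1|apply H0; auto]). subst l.
  replace (f z - 0)%C with (f z) in Hl2 by ring. auto.
Qed.

Lemma Dom_step k r K m f g : 0 < k <= 1 -> 1 <= r -> 0 <= K ->
  (forall z, Dom k r z -> Cder f z (g z)) ->
  (forall z, Dom k r z -> Cmod (g z) <= K / Cmod z ^ m) ->
  forall z, Dom k r z -> Cmod (f (z + 2)%C - f z)%C <= (2 * K) / Cmod z ^ m.
Proof.
  intros Hk Hr HK Hd Hg z HD.
  assert (Hre := Dom_re k r z (proj1 Hk) Hr HD).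
  generalize (Cmvt f g z (z + 2)%C (K / Cmod z ^ m)).
  replace (z + 2 - z)%C with (RtoC 2) by ring. rewrite Cmod_R_pos by lra.
  intros H. replace (2 * K / Cmod z ^ m) with (K / Cmod z ^ m * 2) by (unfold Rdiv; ring).
  assert (HDt : forall t, 0 <= t <= 1 -> Dom k r (z + RtoC t * 2)%C).
  { intros t Ht. rewrite <- RtoC_mult. apply Dom_shift; auto. lra. }
  apply H; intros t Ht; specialize (HDt t Ht). apply Hd; auto.
  eapply Rle_trans. apply Hg; auto. apply Rmult_le_compat_l. auto.
  assert (1 <= Cmod z) by (destruct HD; lra).
  apply Rinv_le_contravar. apply pow_lt; lra. apply pow_incr. split. lra.
  rewrite <- RtoC_mult. apply Cmod_plus_pos; lra.
Qed.

Lemma Dom_int0 k r K m f g : 0 < k <= 1 -> 1 <= r -> 0 <= K ->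
  (forall z, Dom k r z -> Cder f z (g z)) ->
  (forall z, Dom k r z -> Cmod (g z) <= K / Cmod z ^ S (S m)) ->
  (forall z, Dom k r z -> Clim (fun n => f (shift2 z n)) 0%C) ->
  exists K', 0 <= K' /\ forall z, Dom k r z -> Cmod (f z) <= K' / Cmod z ^ S m.
Proof.
  intros Hk Hr HK Hd Hg H0. exists (2 ^ S (S m) * (2 * K) * (3 / 2)).
  split. { assert (0 < 2 ^ S (S m)) by (apply pow_lt; lra). nra. }
  apply tele0 with (r := r) (k := k); auto. lra.
  apply Dom_step with (g := g); auto.
Qed.

Lemma Dom_convex k r z w t : 0 < k <= 1 -> Dom k r z -> Dom k r w -> 0 <= t <= 1 ->
  k * Cmod (z + RtoC t * (w - z))%C <= Re (z + RtoC t * (w - z))%C.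
Proof.
  intros Hk [H1 _] [H2 _] Ht.
  replace (z + RtoC t * (w - z))%C with (RtoC (1 - t) * z + RtoC t * w)%C by (rewrite RtoC_minus; ring).
  apply Rle_trans with (k * ((1 - t) * Cmod z + t * Cmod w)).
  - apply Rmult_le_compat_l. lra. eapply Rle_trans. apply Cmod_triangle.
    rewrite !Cmod_mult, !Cmod_R_pos; lra.
  - reim. nra.
Qed.

(** The limits of [f] along [z + 2n] do not depend on [z]. The translates of [z] and of the base
    point [r] keep a fixed distance, while the derivative on the segment joining them is at most
    [K / n]. *)
Lemma Dom_int k r K m f g : 0 < k <= 1 -> 1 <= r -> 0 <= K ->
  (forall z, Dom k r z -> Cder f z (g z)) ->
  (forall z, Dom k r z -> Cmod (g z) <= K / Cmod z ^ S (S m)) ->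
  exists l K', 0 <= K' /\ forall z, Dom k r z -> Cmod (f z - l)%C <= K' / Cmod z ^ S m.
Proof.
  intros Hk Hr HK Hd Hg.
  assert (HT := tele k r (2 * K) m f Hk Hr ltac:(lra) (Dom_step k r K _ f g Hk Hr HK Hd Hg)).
  assert (Hb : Dom k r (RtoC r)).
  { split; rewrite Cmod_R_pos by lra; [reim; nra|lra]. }
  destruct (HT _ Hb) as [l [Hl _]].
  exists l, (2 ^ S (S m) * (2 * K) * (3 / 2)).
  split. { assert (0 < 2 ^ S (S m)) by (apply pow_lt; lra). nra. }
  intros z HD. destruct (HT z HD) as [l' [Hl1 Hl2]].
  replace l with l'; auto.
  apply Clim_unique with (fun n => f (shift2 z n)); auto.
  apply Clim_ext with (fun n => f (shift2 (RtoC r) n) + (f (shift2 z n) - f (shift2 (RtoC r) n)))%C.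
  intros; ring.
  replace l with (l + 0)%C by ring. apply Clim_plus; auto.
  intros eps He.
  set (X := Cmod (z - RtoC r)%C). assert (HX : 0 <= X) by apply Cmod_ge_0.
  destruct (INR_unbounded (r + K * X / eps + 1)) as [N HN].
  exists N. intros n Hn. apply le_INR in Hn.
  assert (HKX : 0 <= K * X / eps) by (apply Rdiv_le_0_compat; nra).
  (* The cone is convex but its truncation is not; the radius condition holds because the real parts
     on the segment exceed [n], and [n > r]. *)
  assert (Hw : forall t, 0 <= t <= 1 -> Dom k r (shift2 (RtoC r) n + RtoC t * (shift2 z n - shift2 (RtoC r) n))%C
     /\ INR n <= Cmod (shift2 (RtoC r) n + RtoC t * (shift2 z n - shift2 (RtoC r) n))%C).
  { intros t Ht.
    assert (D1 := Dom_shift2 k r _ n Hk Hr Hb). assert (D2 := Dom_shift2 k r _ n Hk Hr HD).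
    assert (A := Dom_convex k r _ _ t Hk D1 D2 Ht).
    assert (B : INR n <= Cmod (shift2 (RtoC r) n + RtoC t * (shift2 z n - shift2 (RtoC r) n))%C).
    { eapply Rle_trans; [|apply Re_le_Cmod]. unfold shift2. reim.
      assert (Hre := Dom_re k r z (proj1 Hk) Hr HD). assert (P := pos_INR n).
      assert (0 <= t * Re z) by (apply Rmult_le_pos; lra). assert (0 <= (1 - t) * r) by (apply Rmult_le_pos; lra). lra. }
    split; auto. split; auto. lra. }
  replace (f (shift2 z n) - f (shift2 (RtoC r) n) - 0)%C with (f (shift2 z n) - f (shift2 (RtoC r) n))%C by ring.
  eapply Rle_lt_trans. apply (Cmvt f g _ _ (K / INR n)).
  - intros t Ht. apply Hd. apply Hw; auto.
  - intros t Ht. destruct (Hw t Ht) as [D1 D2]. eapply Rle_trans. apply Hg; auto.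
    apply Rmult_le_compat_l; auto. apply Rinv_le_contravar. lra.
    eapply Rle_trans. exact D2. 
    rewrite <- (pow_1 (Cmod _)) at 1. apply Rle_pow. lra. lia.
  - replace (shift2 z n - shift2 (RtoC r) n)%C with (z - RtoC r)%C by (unfold shift2; ring). fold X.
    replace (K / INR n * X) with (K * X / INR n) by (unfold Rdiv; ring).
    apply Rmult_lt_reg_r with (INR n). lra. 
    replace (K * X / INR n * INR n) with (K * X) by (field; lra).
    apply Rlt_le_trans with (eps * (K * X / eps + 1)).
    replace (eps * (K * X / eps + 1)) with (K * X + eps) by (field; lra). lra.
    apply Rmult_le_compat_l; lra.
Qed.

(** * The elementary factors of the zeta function *)

Lemma Euler_0 E : Euler_numbers E -> E O = 1.
Proof.
  intros H. apply locally'_0 in H. destruct H as [d [Hd H]].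
  assert (E0 := PSeries_at_0 _ _ d Hd H 1). simpl in E0.
  rewrite <- E0. field.
  intros eps He. exists (Rmin 1 (eps / 8)). split. apply Rmin_pos; lra. intros t [Ht0 Ht].
  assert (Ht1 : t < 1) by (eapply Rlt_le_trans; [exact Ht|apply Rmin_l]).
  assert (Ht2 : t < eps / 8) by (eapply Rlt_le_trans; [exact Ht|apply Rmin_r]).
  assert (A1 := exp_ineq1_le t). assert (A2 := exp_ineq1_le (- t)). rewrite exp_Ropp in A2.
  assert (P := exp_pos t). 
  assert (A3 : (1 - t) * exp t <= 1).
  { apply Rmult_le_compat_r with (r := exp t) in A2; [|lra]. rewrite Rinv_l in A2; lra. }
  replace (exp (2 * t)) with (exp t * exp t) by (rewrite <- exp_plus; f_equal; ring).
  set (x := exp t) in *.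
  replace (2 * x / (x * x + 1) - 1) with (- ((x - 1) * (x - 1) / (x * x + 1))) by (field; nra).
  rewrite Rabs_Ropp, Rabs_pos_eq by (apply Rdiv_le_0_compat; nra).
  apply Rle_lt_trans with (t * t); [|nra].
  apply le_div_l. nra.
  assert (x - 1 <= t * x) by lra. assert (0 <= x - 1) by lra.
  assert ((x - 1) * (x - 1) <= (t * x) * (t * x)) by (apply Rmult_le_compat; lra). nra.
Qed.

(** The origin of the [7/4 log x] in [B_const]: integrating [a_1 / z] must reproduce that term. *)
Lemma coef_a_1 E B : Euler_numbers E -> coef_a E B 1 = 7 / 4.
Proof.
  intros H. change (coef_a E B 1) with (coef_a E B (S (2 * 0))). rewrite coef_a_odd. simpl. rewrite (Euler_0 E H). field.
Qed.

Lemma Cder_inv_pow z n : z <> RtoC 0 -> 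
  Cder (fun z => (/ z) ^ n)%C z (- (RtoC (INR n) * (/ z) ^ S n))%C.
Proof.
  intros Hz. induction n.
  - simpl. apply Cder_eq with (RtoC 0). ring. apply Cder_const.
  - apply (Cder_ext (fun z => / z * (/ z) ^ n)%C). reflexivity.
    eapply Cder_eq; [|apply Cder_mult; [apply Cder_inv; auto|exact IHn]].
    rewrite S_INR, RtoC_plus. cbn [Cpow]. field. auto.
Qed.

(** [EN], [EN1], [EN2]: the truncated expansion of the sum of logarithms
    with constant term [Bc], and its first two derivatives. *)
Definition EN (a : nat -> R) (Bc : R) (n : nat) (z : C) : C :=
  (RtoC (1 / 2) * (z * (Clog z - RtoC (ln (2 * PI)))) - RtoC (1 / 2) * z + RtoC (a 1%nat) * Clog z + RtoC Bc
   - Csum (fun k => RtoC (a (S (S k)) / INR (S k)) * (/ z) ^ S k) n)%C.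

Definition EN1 (a : nat -> R) (n : nat) (z : C) : C :=
  (RtoC (1 / 2) * (Clog z - RtoC (ln (2 * PI)))
   + Csum (fun k => RtoC (a (S k)) * (/ z) ^ S k) (S n))%C.

Definition EN2 (a : nat -> R) (n : nat) (z : C) : C :=
  (RtoC (1 / 2) * / z
   - Csum (fun k => RtoC (INR (S k) * a (S k)) * (/ z) ^ S (S k)) (S n))%C.

Lemma Cder_EN a Bc n z : 0 < Re z -> Cder (EN a Bc n) z (EN1 a n z).
Proof.
  intros Hz. assert (Hz0 := Cneq0_re z Hz). unfold EN, EN1.
  apply Cder_eq with (RtoC (1 / 2) * (1 * (Clog z - RtoC (ln (2 * PI))) + z * (/ z - 0)) - RtoC (1 / 2) * 1
     + RtoC (a 1%nat) * / z + 0
     - Csum (fun k => RtoC (a (S (S k)) / INR (S k)) * - (RtoC (INR (S k)) * (/ z) ^ S (S k))) n)%C.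
  - replace (Csum (fun k => RtoC (a (S (S k)) / INR (S k)) * - (RtoC (INR (S k)) * (/ z) ^ S (S k))) n)%C
      with (- Csum (fun k => RtoC (a (S (S k))) * (/ z) ^ S (S k)) n)%C.
    + rewrite (Csum_shift (fun k => RtoC (a (S k)) * (/ z) ^ S k) n)%C.
      cbn [Csum Cpow]. field. auto.
    + induction n. simpl. ring. cbn [Csum]. rewrite <- IHn.
      assert (HS : INR (S n) <> 0) by (apply not_0_INR; lia).
      rewrite RtoC_div by auto. field. intro E0. apply RtoC_inj in E0. auto.
  - apply Cder_minus.
    + apply Cder_plus; [|apply Cder_const]. apply Cder_plus.
      * apply Cder_minus.
        -- apply Cder_scal. apply (Cder_mult (fun z => z) (fun z => Clog z - RtoC (ln (2 * PI)))%C). apply Cder_id. apply Cder_minus. apply Cder_Clog; auto. apply Cder_const.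
        -- apply Cder_scal. apply Cder_id.
      * apply Cder_scal. apply Cder_Clog; auto.
    + apply (Cder_Csum (fun k z => RtoC (a (S (S k)) / INR (S k)) * (/ z) ^ S k)%C
         (fun k z => RtoC (a (S (S k)) / INR (S k)) * - (RtoC (INR (S k)) * (/ z) ^ S (S k)))%C).
      intros k _. apply Cder_scal. apply Cder_inv_pow; auto.
Qed.

Lemma Cder_EN1 a n z : 0 < Re z -> Cder (EN1 a n) z (EN2 a n z).
Proof.
  intros Hz. assert (Hz0 := Cneq0_re z Hz). unfold EN1, EN2.
  apply Cder_eq with (RtoC (1 / 2) * (/ z - 0)
     + Csum (fun k => RtoC (a (S k)) * - (RtoC (INR (S k)) * (/ z) ^ S (S k))) (S n))%C.
  - replace (Csum (fun k => RtoC (a (S k)) * - (RtoC (INR (S k)) * (/ z) ^ S (S k))) (S n))%C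
      with (- Csum (fun k => RtoC (INR (S k) * a (S k)) * (/ z) ^ S (S k)) (S n))%C. ring.
    generalize (S n). intros m. induction m. simpl. ring.
    cbn [Csum]. rewrite <- IHm. rewrite RtoC_mult. ring.
  - apply Cder_plus.
    + apply Cder_scal. apply Cder_minus. apply Cder_Clog; auto. apply Cder_const.
    + apply (Cder_Csum (fun k z => RtoC (a (S k)) * (/ z) ^ S k)%C
         (fun k z => RtoC (a (S k)) * - (RtoC (INR (S k)) * (/ z) ^ S (S k)))%C).
      intros k _. apply Cder_scal. apply Cder_inv_pow; auto.
Qed.

(** The [e] of the overview. The functional equation contributes [log ((z + 5/2) / 2)], the factor
    [s - 1 = z - 1/2] contributes the logarithms at [z + 3/2] and [z - 1/2], and the power of pi
    contributes [ln PI]. *)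
Definition en (a : nat -> R) (Bc : R) (n : nat) (z : C) : C :=
  (Clog (z + RtoC (5 / 2)) + Clog (z + RtoC (3 / 2)) - Clog (z + RtoC (- (1 / 2)))
   - RtoC (ln 2 + ln PI) - (EN a Bc n (z + 2) - EN a Bc n z))%C.

Definition en1 (a : nat -> R) (n : nat) (z : C) : C :=
  (/ (z + RtoC (5 / 2)) + / (z + RtoC (3 / 2)) - / (z + RtoC (- (1 / 2)))
   - (EN1 a n (z + 2) - EN1 a n z))%C.

Definition en2 (a : nat -> R) (n : nat) (z : C) : C :=
  (- (/ (z + RtoC (5 / 2))) ^ 2 - (/ (z + RtoC (3 / 2))) ^ 2 + (/ (z + RtoC (- (1 / 2)))) ^ 2
   - (EN2 a n (z + 2) - EN2 a n z))%C.

Lemma Cder_en a Bc n z : 1 / 2 < Re z -> Cder (en a Bc n) z (en1 a n z).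
Proof.
  intros Hz. unfold en, en1. apply Cder_minus.
  - apply Cder_eq with (/ (z + RtoC (5 / 2)) + / (z + RtoC (3 / 2)) - / (z + RtoC (- (1 / 2))) - 0)%C. ring.
    apply Cder_minus; [|apply Cder_const]. apply Cder_minus; [apply Cder_plus|];
      apply (Cder_shift Clog); apply Cder_Clog; reim; lra.
  - apply Cder_minus. apply (Cder_shift (EN a Bc n)). apply Cder_EN. reim; lra. apply Cder_EN. lra.
Qed.

Lemma Cder_shift_inv b z : 0 < Re (z + b)%C -> Cder (fun z => / (z + b))%C z (- (/ (z + b)) ^ 2)%C.
Proof.
  intros H. apply Cneq0_re in H. apply (Cder_shift Cinv b z).
  apply Cder_eq with (- / ((z + b) * (z + b)))%C. field. auto. apply Cder_inv; auto.
Qed.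

Lemma Cder_en1 a n z : 1 / 2 < Re z -> Cder (en1 a n) z (en2 a n z).
Proof.
  intros Hz. unfold en1, en2. apply Cder_minus.
  - apply Cder_eq with (- (/ (z + RtoC (5 / 2))) ^ 2 + - (/ (z + RtoC (3 / 2))) ^ 2 - - (/ (z + RtoC (- (1 / 2)))) ^ 2)%C.
    ring.
    apply Cder_minus; [apply Cder_plus|]; apply Cder_shift_inv; reim; lra.
  - apply Cder_minus. apply (Cder_shift (EN1 a n)). apply Cder_EN1. reim; lra. apply Cder_EN1. lra.
Qed.

(** Term by term: [1/(z + b)^2] is the transform of [t exp(-bt)], and replacing [z] by [z + 2]
    multiplies the original by [exp(-2t)]. The constant [1/2] in [Wpoly] comes from the [1/(2z)] in
    [EN2]. *)
Lemma en2_lap a n z : lap_regular (Wpoly (fun k => a (S k) / INR (fact k)) (S n)) z ->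
  en2 a n z = lap (Wpoly (fun k => a (S k) / INR (fact k)) (S n)) z.
Proof.
  intros H. unfold Wpoly in H. inversion H as [|? ? R1 H1]; subst.
  inversion H1 as [|? ? R2 H2]; subst. inversion H2 as [|? ? R3 H3]; subst.
  inversion H3 as [|? ? R4 H4]; subst. inversion H4 as [|? ? R5 H5]; subst. clear H H1 H2 H3 H4.
  simpl in R1, R2, R3, R4, R5.
  unfold en2, EN2, Wpoly. cbn [lap].
  assert (E2 : (z - RtoC (-2))%C = (z + 2)%C) by (apply C_eq; reim; ring).
  assert (E0 : (z - RtoC 0)%C = z) by ring.
  assert (EW : lap (Wsum (fun k => a (S k) / INR (fact k)) (S n)) z =
    (Csum (fun k => RtoC (INR (S k) * a (S k)) * (/ (z + 2)) ^ S (S k)) (S n)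
     - Csum (fun k => RtoC (INR (S k) * a (S k)) * (/ z) ^ S (S k)) (S n))%C).
  { clear H5. generalize (S n). intros m. rewrite E2 in R5. rewrite E0 in R4.
    induction m. simpl. ring.
    cbn [Wsum lap Csum]. rewrite IHm, E2, E0.
    rewrite !Cpow_inv by auto.
    assert (P1 := Cpow_nz _ (S (S m)) R4). assert (P2 := Cpow_nz _ (S (S m)) R5).
    replace (a (S m) / INR (fact m) * INR (fact (S m))) with (INR (S m) * a (S m)).
    2: { change (fact (S m)) with (S m * fact m)%nat. rewrite mult_INR. field. apply INR_fact_neq_0. }
    replace (- (a (S m) / INR (fact m)) * INR (fact (S m))) with (- (INR (S m) * a (S m))).
    2: { change (fact (S m)) with (S m * fact m)%nat. rewrite mult_INR. field. apply INR_fact_neq_0. }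
    rewrite RtoC_opp. field. auto. }
  rewrite EW. rewrite E2 in *. rewrite E0 in *.
  simpl fact. simpl INR.
  assert (F1 : (z - RtoC (- (5 / 2)))%C = (z + RtoC (5 / 2))%C) by (rewrite RtoC_opp; ring).
  assert (F2 : (z - RtoC (- (3 / 2)))%C = (z + RtoC (3 / 2))%C) by (rewrite RtoC_opp; ring).
  assert (F3 : (z - RtoC (1 / 2))%C = (z + RtoC (- (1 / 2)))%C) by (rewrite RtoC_opp; ring).
  rewrite F1 in *. rewrite F2 in *. rewrite F3 in *. rewrite !Rmult_1_r, RtoC_opp. cbn [Cpow].
  rewrite RtoC_opp in R3. replace (RtoC (-1)) with (- (1))%C by (apply C_eq; reim; ring). field. repeat split; auto.
Qed.

(** * Functions of order 1/z on a truncated cone *)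

(** A class closed under linear combinations whose members tend to 0 along [shift2], which is the
    condition under which [Dom_int0] has no constant of integration. *)
Definition Small (k r : R) (f : C -> C) : Prop :=
  exists K, 0 <= K /\ forall z, Dom k r z -> Cmod (f z) <= K / Cmod z.

Lemma Small_plus k r f g : Small k r f -> Small k r g -> Small k r (fun z => f z + g z)%C.
Proof.
  intros [K [HK H]] [L [HL G]]. exists (K + L). split. lra. intros z Hz.
  eapply Rle_trans. apply Cmod_triangle. unfold Rdiv. rewrite Rmult_plus_distr_r.
  apply Rplus_le_compat; auto.
Qed.

Lemma Small_scal k r c f : Small k r f -> Small k r (fun z => c * f z)%C.
Proof.
  intros [K [HK H]]. assert (Hc := Cmod_ge_0 c). exists (Cmod c * K). split. nra. intros z Hz.
  rewrite Cmod_mult. unfold Rdiv. rewrite Rmult_assoc. apply Rmult_le_compat_l; auto.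
Qed.

Lemma Small_ext k r f g : (forall z, f z = g z) -> Small k r f -> Small k r g.
Proof. intros E [K [HK H]]. exists K. split; auto. intros z Hz. rewrite <- E; auto. Qed.

Lemma Small_minus k r f g : Small k r f -> Small k r g -> Small k r (fun z => f z - g z)%C.
Proof.
  intros H G. apply Small_ext with (fun z => f z + (- (1)) * g z)%C.
  intros; ring. apply Small_plus; auto. apply Small_scal; auto.
Qed.

Lemma Small_Csum k r (f : nat -> C -> C) n : (forall j, Small k r (f j)) ->
  Small k r (fun z => Csum (fun j => f j z) n).
Proof.
  intros H. induction n; simpl.
  - exists 0. split. lra. intros. rewrite Cmod_0. lra.
  - apply Small_plus; auto.
Qed.

Lemma Small_inv_pow k r b n : 1 <= r -> Rabs b <= r / 2 -> Small k r (fun z => (/ (z + RtoC b)) ^ S n)%C.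
Proof.
  intros Hr Hb. exists (2 ^ S n). split. apply pow_le; lra. intros z [_ Hz].
  assert (H : Cmod z / 2 <= Cmod (z + RtoC b)%C).
  { generalize (Cmod_plus_ge z (RtoC b)). rewrite Cmod_R. lra. }
  rewrite Cmod_pow, Cmod_inv'.
  apply Rle_trans with ((/ (Cmod z / 2)) ^ S n).
  - apply pow_incr. split. left; apply Rinv_0_lt_compat; lra. apply Rinv_le_contravar; lra.
  - replace (/ (Cmod z / 2)) with (2 * / Cmod z) by (field; lra). rewrite Rpow_mult_distr.
    apply Rmult_le_compat_l. apply pow_le; lra.
    rewrite pow_inv. apply Rinv_le_contravar. lra.
    rewrite <- (pow_1 (Cmod z)) at 1. apply Rle_pow. lra. lia.
Qed.

Lemma Small_Clog2 k r : 0 < k <= 1 -> 1 <= r -> Small k r (fun z => Clog (z + 2) - Clog z)%C.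
Proof.
  intros Hk Hr. exists 2. split. lra. intros z HD.
  assert (Hre := Dom_re k r z (proj1 Hk) Hr HD).
  generalize (Clog_lip z (z + 2)%C (Cmod z)).
  replace (z + 2 - z)%C with (RtoC 2) by ring. rewrite Cmod_R_pos by lra. intros H. apply H; auto.
  reim; lra. destruct HD; lra.
  intros t Ht. rewrite <- RtoC_mult. apply Cmod_plus_pos; lra.
Qed.

Lemma Small_lim k r f z : 0 < k <= 1 -> 1 <= r -> Small k r f -> Dom k r z ->
  Clim (fun n => f (shift2 z n)) 0%C.
Proof.
  intros Hk Hr [K [HK H]] HD.
  assert (Hre := Dom_re k r z (proj1 Hk) Hr HD).
  apply Clim_S_inv.
  apply Clim_squeeze with (fun n => K * / INR (S n)).
  - intros n. replace (f (shift2 z (S n)) - 0)%C with (f (shift2 z (S n))) by ring.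
    eapply Rle_trans. apply H. apply Dom_shift2; auto.
    assert (Hn := lt_0_INR (S n) ltac:(lia)).
    apply Rmult_le_compat_l; auto. apply Rinv_le_contravar; auto.
    apply Rle_trans with (2 * INR (S n)). lra.
    apply Cmod_plus_pos; lra.
  - replace (Finite 0) with (Finite (K * 0)) by (f_equal; ring).
    apply is_lim_seq_mult'. apply is_lim_seq_const. apply is_lim_seq_inv_S.
Qed.

(** The logarithms enter only through [Clog (z + 2) - Clog z]. The radius 5 is twice the largest
    shift [5/2], so that [Cmod (z + b) >= Cmod z / 2] for all the shifts. *)
Lemma Small_en1 a k r n : 0 < k <= 1 -> 5 <= r -> Small k r (en1 a n).
Proof.
  intros Hk Hr. unfold en1.
  assert (HI : forall b, Rabs b <= 5 / 2 -> forall j, Small k r (fun z => (/ (z + RtoC b)) ^ S j)%C).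
  { intros b Hb j. apply Small_inv_pow; lra. }
  assert (HI1 : forall b, Rabs b <= 5 / 2 -> Small k r (fun z => / (z + RtoC b))%C).
  { intros b Hb. apply Small_ext with (fun z => (/ (z + RtoC b)) ^ 1)%C. intros; simpl; ring. apply HI; auto. }
  assert (HI0 : forall j, Small k r (fun z => (/ z) ^ S j)%C).
  { intros j. apply Small_ext with (fun z => (/ (z + RtoC 0)) ^ S j)%C.
    intros z. replace (z + 0)%C with z by ring. auto. apply HI. rewrite Rabs_R0. lra. }
  apply Small_minus.
  - apply Small_minus; [apply Small_plus|]; apply HI1; unfold Rabs; destruct Rcase_abs; lra.
  - unfold EN1.
    apply Small_ext with (fun z => RtoC (1 / 2) * (Clog (z + 2) - Clog z) +
       (Csum (fun k0 => RtoC (a (S k0)) * (/ (z + RtoC 2)) ^ S k0) (S n) - Csum (fun k0 => RtoC (a (S k0)) * (/ z) ^ S k0) (S n)))%C.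
    { intros z. ring. }
    apply Small_plus. apply Small_scal. apply Small_Clog2; lra.
    apply Small_minus; apply (Small_Csum _ _ (fun j z => _ * (_) ^ S j)%C); intros j; apply Small_scal; auto.
    apply HI. rewrite Rabs_pos_eq; lra.
Qed.

(** Minus the logarithm, at [s = 1/2 + z], of the factors of the zeta function
    other than the product. *)
Definition Qf (Bc : R) (z : C) : C :=
  (LogGamma (RtoC (1 / 2) * z + RtoC (5 / 4)) + Clog (z + RtoC (- (1 / 2)))
   - (RtoC (1 / 4) + RtoC (1 / 2) * z) * RtoC (ln PI)
   - RtoC (1 / 4 * ln (PI / 2) - Bc))%C.

Lemma Qf_step a Bc n z : 1 / 2 < Re z -> 
  (Qf Bc (z + 2) - EN a Bc n (z + 2) - (Qf Bc z - EN a Bc n z))%C = en a Bc n z.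
Proof.
  intros Hz. unfold Qf, en.
  replace (RtoC (1 / 2) * (z + 2) + RtoC (5 / 4))%C with (RtoC (1 / 2) * z + RtoC (5 / 4) + 1)%C
    by (apply C_eq; reim; field).
  rewrite LogGamma_step by (reim; lra).
  replace (RtoC (1 / 2) * z + RtoC (5 / 4))%C with ((z + RtoC (5 / 2)) / RtoC 2)%C
    by (rewrite !RtoC_div by lra; field; repeat split; intro X; apply RtoC_inj in X; lra).
  rewrite (Clog_div_R 2 (z + RtoC (5 / 2))%C) by (reim; lra).
  replace (z + 2 + RtoC (- (1 / 2)))%C with (z + RtoC (3 / 2))%C by (apply C_eq; reim; lra).
  rewrite RtoC_plus.
  replace (RtoC (1 / 2) * (z + 2))%C with (RtoC (1 / 2) * z + 1)%C by (apply C_eq; reim; field).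
  ring.
Qed.

Lemma Clim_eq u l m : l = m -> Clim u l -> Clim u m.
Proof. intros ->; auto. Qed.

Lemma shift2_Clog z n : 0 < Re z ->
  Clog (shift2 z (S n)) = (RtoC (ln (2 * INR (S n))) + Clog (1 + RtoC (/ (2 * INR (S n))) * z))%C.
Proof.
  intros Hz. assert (Hn := lt_0_INR (S n) ltac:(lia)). unfold shift2. apply Clog_plus_R; auto. lra.
Qed.

(** Writing [log (z + 2N) = ln (2N) + eta_N], these are the limits of [eta_N] and of [N eta_N]. The
    second is needed because [EN] contains [z log z]. *)
Lemma shift2_eta z : 0 < Re z ->
  Clim (fun n => Clog (1 + RtoC (/ (2 * INR (S n))) * z)) 0%C /\
  Clim (fun n => RtoC (INR (S n)) * Clog (1 + RtoC (/ (2 * INR (S n))) * z))%C (RtoC (1 / 2) * z)%C.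
Proof.
  intros Hz. assert (HC := Cmod_ge_0 z).
  assert (Hn : forall n, 0 < INR (S n)) by (intros; apply lt_0_INR; lia).
  assert (Hi : forall n, 0 < / (2 * INR (S n))) by (intros n; apply Rinv_0_lt_compat; specialize (Hn n); lra).
  split.
  - apply Clim_squeeze with (fun n => Cmod z * / INR (S n)).
    + intros n. specialize (Hn n). specialize (Hi n).
      replace (Clog (1 + RtoC (/ (2 * INR (S n))) * z) - 0)%C with (Clog (1 + RtoC (/ (2 * INR (S n))) * z)) by ring.
      eapply Rle_trans. apply Clog_1_plus. reim. nra.
      rewrite Cmod_mult, Cmod_R_pos by lra. rewrite Rmult_comm. apply Rmult_le_compat_l; auto.
      apply Rinv_le_contravar; lra.
    + replace (Finite 0) with (Finite (Cmod z * 0)) by (f_equal; ring).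
      apply is_lim_seq_mult'. apply is_lim_seq_const. apply is_lim_seq_inv_S.
  - apply Clim_squeeze with (fun n => (Cmod z * Cmod z) * / INR (S n)).
    + intros n. specialize (Hn n). specialize (Hi n).
      assert (E : (RtoC (1 / 2) * z)%C = (RtoC (INR (S n)) * (RtoC (/ (2 * INR (S n))) * z))%C).
      { rewrite Cmult_assoc, <- RtoC_mult. f_equal. f_equal. field. lra. }
      rewrite E.
      replace (RtoC (INR (S n)) * Clog (1 + RtoC (/ (2 * INR (S n))) * z) - RtoC (INR (S n)) * (RtoC (/ (2 * INR (S n))) * z))%C
        with (RtoC (INR (S n)) * (Clog (1 + RtoC (/ (2 * INR (S n))) * z) - RtoC (/ (2 * INR (S n))) * z))%C by ring.
      rewrite Cmod_mult, Cmod_R_pos by lra.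
      eapply Rle_trans. apply Rmult_le_compat_l. lra. apply Clog_1_plus2. reim. nra.
      rewrite Cmod_mult, Cmod_R_pos by lra.
      replace (INR (S n) * (/ (2 * INR (S n)) * Cmod z * (/ (2 * INR (S n)) * Cmod z)))
        with (/ 4 * (Cmod z * Cmod z * / INR (S n))) by (field; lra).
      assert (0 <= Cmod z * Cmod z * / INR (S n)).
      { apply Rmult_le_pos. nra. left; apply Rinv_0_lt_compat; auto. } lra.
    + replace (Finite 0) with (Finite (Cmod z * Cmod z * 0)) by (f_equal; ring).
      apply is_lim_seq_mult'. apply is_lim_seq_const. apply is_lim_seq_inv_S.
Qed.

(** At [z + 2N] log Gamma is replaced by factorials ([LogGamma_shift]) and these by Stirling's
    formula; the logarithms are expanded as in [shift2_eta]. All terms that grow with [N] cancel,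
    and so does [Bc], which both functions contain. *)
Lemma Qf_lim E B Bc n k r z : Euler_numbers E -> 0 < k <= 1 -> 5 <= r -> Dom k r z -> 1 / 2 < Re z ->
  Clim (fun j => Qf Bc (shift2 z j) - EN (coef_a E B) Bc n (shift2 z j))%C 0%C.
Proof.
  intros HE Hk Hr HD Hz.
  set (a := coef_a E B).
  assert (Ha1 : a 1%nat = 7 / 4) by (apply coef_a_1; auto).
  set (w := (RtoC (1 / 2) * z + RtoC (5 / 4))%C).
  assert (Hw : 0 < Re w) by (unfold w; reim; lra).
  set (z' := (z + RtoC (- (1 / 2)))%C).
  assert (Hz' : 0 < Re z') by (unfold z'; reim; lra).
  assert (HPI := PI_RGT_0).
  set (eta := fun j => Clog (1 + RtoC (/ (2 * INR (S j))) * z)).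
  set (eta' := fun j => Clog (1 + RtoC (/ (2 * INR (S j))) * z')).
  destruct (shift2_eta z) as [L1 L2]. lra. destruct (shift2_eta z' Hz') as [L3 _].
  fold eta in L1, L2. fold eta' in L3.
  assert (L4 := Clim_S _ _ (LogGamma_shift w Hw)). cbv beta in L4.
  assert (L5 := Clim_RtoC _ _ (proj1 (is_lim_seq_incr_1 _ _) stirling)).
  assert (SS : Small k r (fun z => Csum (fun k => RtoC (a (S (S k)) / INR (S k)) * (/ z) ^ S k) n)%C).
  { apply (Small_Csum _ _ (fun j z => RtoC (a (S (S j)) / INR (S j)) * (/ z) ^ S j)%C). intros j. apply Small_scal.
    apply Small_ext with (fun z => (/ (z + RtoC 0)) ^ S j)%C.
    intros x. replace (x + 0)%C with x by ring. auto. apply Small_inv_pow. lra. rewrite Rabs_R0. lra. }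
  assert (L6 := Clim_S _ _ (Small_lim k r _ z Hk ltac:(lra) SS HD)). cbv beta in L6.
  apply Clim_S_inv.
  (* The part independent of [N]; it cancels the limits of the Stirling term [L5] and of [N eta_N]
     ([L2]), the only non-zero limits in the combination below. *)
  set (k0 := (RtoC (/ 2 * ln (2 * PI)) - RtoC (1 / 2) * z)%C).
  apply Clim_eq with (0 + RtoC (/ 2 * ln (2 * PI)) + 0 - RtoC (1 / 2) * z * 0 - RtoC (1 / 2) * z - RtoC (7 / 4) * 0 + 0 - k0)%C.
  { unfold k0. ring. }
  eapply Clim_ext; [|
    exact (Clim_minus _ _ _ _ (Clim_plus _ _ _ _ (Clim_minus _ _ _ _ (Clim_minus _ _ _ _ 
      (Clim_minus _ _ _ _ (Clim_plus _ _ _ _ (Clim_plus _ _ _ _ L4 L5) L3)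
       (Clim_scal (RtoC (1 / 2) * z)%C _ _ L1)) L2) (Clim_scal (RtoC (7 / 4)) _ _ L1)) L6) (Clim_const k0))].
  intros j. cbv beta.
  unfold Qf, EN. fold a. rewrite Ha1.
  assert (Hj := lt_0_INR (S j) ltac:(lia)).
  replace (RtoC (1 / 2) * shift2 z (S j) + RtoC (5 / 4))%C with (w + RtoC (INR (S j)))%C.
  2: { unfold w, shift2. apply C_eq; reim; field. }
  replace (shift2 z (S j) + RtoC (- (1 / 2)))%C with (shift2 z' (S j)) by (unfold shift2, z'; ring).
  rewrite (shift2_Clog z') by auto. rewrite (shift2_Clog z) by lra. fold (eta j). fold (eta' j).
  set (S0 := Csum _ n).
  assert (ED : RtoC (dfact (S j)) = (RtoC (ln (INR (fact (S j)))) - (RtoC (INR (S j)) + RtoC (/ 2)) * RtoC (ln (INR (S j))) + RtoC (INR (S j)))%C).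
  { unfold dfact. rewrite RtoC_plus, RtoC_minus, RtoC_mult, RtoC_plus. reflexivity. }
  rewrite ED.
  replace (shift2 z (S j)) with (z + 2 * RtoC (INR (S j)))%C by (unfold shift2; rewrite RtoC_mult; ring).
  rewrite !ln_mult by lra. rewrite ln_div by lra.
  unfold k0, w. rewrite !ln_mult by lra.
  set (X1 := LogGamma _). clearbody X1.
  set (lf := ln (INR (fact (S j)))). set (lj := ln (INR (S j))). set (p := INR (S j)) in *.
  set (l2 := ln 2). set (lp := ln PI). 
  set (e1 := eta j). set (e2 := eta' j).
  clearbody e1 e2 lf lj l2 lp S0 p.
  rewrite !RtoC_minus, !RtoC_mult, !RtoC_plus, !RtoC_minus, !RtoC_div by lra.
  rewrite RtoC_inv by lra.
  field.
Qed.

(** One power is lost at each stage: [en2] has order [z^(-n-4)], [en1] has [z^(-n-3)], [en] has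
    [z^(-n-2)], and the sum over the steps of length 2 leaves [z^(-n-1)]. *)
Lemma Qf_bound E B Bc n k : Euler_numbers E -> Bernoulli_numbers B -> 0 < k <= 1 ->
  exists r K, 5 <= r /\ 0 <= K /\ forall z, Dom k r z ->
    Cmod (Qf Bc z - EN (coef_a E B) Bc n z)%C <= K / Cmod z ^ S n.
Proof.
  intros HE HB Hk.
  destruct (lap_order _ _ (Wpoly_order E B n HE HB)) as [K1 [r1 [Hr1 [HK1 H1]]]].
  (* The bound [1/k] forces [Re z >= 1] on the cone, to the right of the singularity at [z = 1/2];
     the 5 is for [Small_en1]. *)
  set (r := Rmax r1 (Rmax 5 (1 / k))).
  assert (Hra : r1 <= r) by apply Rmax_l.
  assert (Hrb : 5 <= r) by (eapply Rle_trans; [apply Rmax_l|apply Rmax_r]).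
  assert (Hrc : 1 / k <= r) by (eapply Rle_trans; [apply Rmax_r|apply Rmax_r]).
  assert (Hrk : 1 <= k * r).
  { apply Rmult_le_compat_l with (r := k) in Hrc; [|lra]. replace (k * (1 / k)) with 1 in Hrc by (field; lra). auto. }
  assert (Hre : forall z, Dom k r z -> 1 / 2 < Re z).
  { intros z [A1 A2]. assert (k * r <= k * Cmod z) by (apply Rmult_le_compat_l; lra). lra. }
  set (a := coef_a E B).
  assert (H2 : forall z, Dom k r z -> Cmod (en2 a n z) <= K1 / Cmod z ^ S (S (n + 2))).
  { intros z Hz. destruct (H1 z) as [A1 A2]. destruct Hz; lra.
    rewrite en2_lap by exact A1. replace (S (S (n + 2))) with (S (n + 3)) by lia. exact A2. }
  destruct (Dom_int0 k r K1 (n + 2) (en1 a n) (en2 a n)) as [K2 [HK2 H3]]; auto.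
  { lra. } { intros z Hz. apply Cder_en1. auto. }
  { intros z Hz. apply (Small_lim k r); auto. lra. apply Small_en1; auto. }
  assert (HL := fun z Hz => Qf_lim E B Bc n k r z HE Hk Hrb Hz (Hre z Hz)). fold a in HL.
  destruct (Dom_int0 k r K2 (n + 1) (en a Bc n) (en1 a n)) as [K3 [HK3 H4]]; auto.
  { lra. } { intros z Hz. apply Cder_en. auto. }
  { replace (S (S (n + 1))) with (S (n + 2)) by lia. auto. }
  { intros z Hz. apply Clim_eq with (0 - 0)%C. ring.
    eapply Clim_ext; [|exact (Clim_minus _ _ _ _ (Clim_S _ _ (HL z Hz)) (HL z Hz))].
    intros j. cbv beta. rewrite shift2_S. apply Qf_step. apply Hre. apply Dom_shift2; auto. lra. }
  exists r, (2 ^ S (S n) * K3 * (3 / 2)). split; auto. split.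
  { assert (0 < 2 ^ S (S n)) by (apply pow_lt; lra). assert (0 <= 2 ^ S (S n) * K3) by nra. lra. }
  apply (tele0 k r K3 n (fun z => Qf Bc z - EN a Bc n z)%C); auto. lra.
  intros z Hz. cbv beta. rewrite Qf_step by auto.
  replace (S (S n)) with (S (n + 1)) by lia. auto.
Qed.

Lemma Qf_der Bc z : 1 / 2 < Re z -> exists l, Cder (Qf Bc) z l.
Proof.
  intros Hz.
  destruct (LogGamma_der (RtoC (1 / 2) * z + RtoC (5 / 4))%C) as [l Hl]. reim; lra.
  eexists. unfold Qf. apply Cder_minus; [|apply Cder_const].
  apply Cder_minus. apply Cder_plus.
  - apply (Cder_affine LogGamma (1 / 2) (RtoC (5 / 4))). exact Hl.
  - apply (Cder_shift Clog). apply Cder_Clog. reim; lra.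
  - apply (Cder_mult (fun z => RtoC (1 / 4) + RtoC (1 / 2) * z)%C (fun _ => RtoC (ln PI))).
    apply Cder_lin. apply Cder_const.
Qed.

Lemma Qf_real Bc x : 1 / 2 < x -> Im (Qf Bc (RtoC x)) = 0.
Proof.
  intros Hx. unfold Qf. reim.
  replace (RtoC (1 / 2) * RtoC x + RtoC (5 / 4))%C with (RtoC (1 / 2 * x + 5 / 4)) by (rewrite RtoC_plus, RtoC_mult; auto).
  rewrite LogGamma_real by lra. rewrite <- RtoC_plus, Clog_R by lra. reim. ring.
Qed.

Lemma Cexp_Qf Bc z : 1 / 2 < Re z ->
  Cexp (- Qf Bc z)%C = (RtoC (exp (1 / 4 * ln (PI / 2) - Bc))
    * (Rcpower PI ((z + RtoC (1 / 2)) / 2) / ((z + RtoC (1 / 2) - 1) * CGamma (1 + (z + RtoC (1 / 2)) / 2))))%C.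
Proof.
  intros Hz.
  replace (1 + (z + RtoC (1 / 2)) / 2)%C with (RtoC (1 / 2) * z + RtoC (5 / 4))%C.
  2: { rewrite !RtoC_div by lra. field. }
  rewrite CGamma_LogGamma by (reim; lra).
  replace (z + RtoC (1 / 2) - 1)%C with (Cexp (Clog (z + RtoC (- (1 / 2)))%C)).
  2: { rewrite Cexp_Clog by (reim; lra). apply C_eq; reim; lra. }
  unfold Rcpower. rewrite <- Cexp_RtoC, <- Cexp_plus, <- Cexp_minus, <- Cexp_plus. f_equal.
  unfold Qf. replace ((z + RtoC (1 / 2)) / 2)%C with (RtoC (1 / 4) + RtoC (1 / 2) * z)%C.
  2: { rewrite !RtoC_div by lra. field. }
  ring.
Qed.

(** * The logarithm of the product over the zeros *)

(** [0 < Re (a * a)] is the algebraic form of [Rabs (Carg a) < PI / 4]. *)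
Definition good (c : R) (a : C) : Prop := Rabs (Im a) < c /\ 1 < Re a /\ 0 < Re (a * a)%C.

Lemma good_mod c a : good c a -> 1 < Cmod a.
Proof. intros [_ [H _]]. eapply Rlt_le_trans. exact H. apply Re_le_Cmod. Qed.

Lemma good_neq0 c a : good c a -> a <> RtoC 0.
Proof. intros [_ [H _]]. apply Cneq0_re. lra. Qed.

Lemma good_pos c a : good c a -> 0 < c.
Proof. intros [H _]. generalize (Rabs_pos (Im a)). lra. Qed.

Lemma good_re1 c a z : good c a -> c < Re z -> Re z - c <= Re (z - Ci * a)%C.
Proof. intros [H _] Hz. reim. revert H. unfold Rabs. destruct (Rcase_abs (Im a)); lra. Qed.

Lemma good_re2 c a z : good c a -> c < Re z -> Re z - c <= Re (z + Ci * a)%C.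
Proof. intros [H _] Hz. reim. revert H. unfold Rabs. destruct (Rcase_abs (Im a)); lra. Qed.

(** [z -/+ i a] lie in the right half-plane, so this is an analytic branch of
    [log (1 + z^2/a^2)]; it is the principal one at [z = c + 1]. *)
Definition Tf (c : R) (a z : C) : C :=
  (Clog (1 + RtoC (c + 1) * RtoC (c + 1) / (a * a)) +
   (Clog (z - Ci * a) - Clog (RtoC (c + 1) - Ci * a)) +
   (Clog (z + Ci * a) - Clog (RtoC (c + 1) + Ci * a)))%C.

Definition Tf1 (a z : C) : C := (/ (z - Ci * a) + / (z + Ci * a))%C.

Lemma Ci2 : (Ci * Ci)%C = (- (1))%C.
Proof. apply C_eq; reim; ring. Qed.

Lemma Re_inv_pos z : 0 < Re z -> 0 < Re (/ z)%C.
Proof.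
  intros H. unfold Cinv, Re. simpl. change (fst z) with (Re z). apply Rdiv_lt_0_compat; auto.
  simpl. change (snd z) with (Im z). nra.
Qed.

Lemma good_re_quot c a x : good c a -> 0 <= Re (RtoC x * RtoC x / (a * a))%C.
Proof.
  intros [_ [_ H]]. apply Re_inv_pos in H. unfold Cdiv. rewrite <- RtoC_mult. reim.
  assert (0 <= x * x) by nra. nra.
Qed.

Lemma factor_za a z : (z * z + a * a = (z - Ci * a) * (z + Ci * a))%C.
Proof.
  replace ((z - Ci * a) * (z + Ci * a))%C with (z * z - Ci * Ci * (a * a))%C by ring.
  rewrite Ci2. ring.
Qed.

(** Both [z^2 + a^2] and [(c + 1)^2 + a^2] factor into the arguments of the four logarithms, and the
    normalisation at [c + 1] cancels. *)
Lemma Cexp_Tf c a z : good c a -> c < Re z -> Cexp (Tf c a z) = (1 + z * z / (a * a))%C.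
Proof.
  intros Ha Hz. assert (Hc := good_pos c a Ha). assert (Ha0 := good_neq0 c a Ha).
  assert (A1 := good_re1 c a z Ha Hz). assert (A2 := good_re2 c a z Ha Hz).
  assert (A3 := good_re1 c a (RtoC (c + 1)) Ha ltac:(reim; lra)).
  assert (A4 := good_re2 c a (RtoC (c + 1)) Ha ltac:(reim; lra)).
  rewrite Re_RtoC in A3, A4.
  assert (A5 := good_re_quot c a (c + 1) Ha).
  unfold Tf. rewrite !Cexp_plus, !Cexp_minus, !Cexp_Clog; try lra.
  2: { reim. revert A5. reim. lra. }
  assert (N1 : (z - Ci * a)%C <> RtoC 0) by (apply Cneq0_re; lra).
  assert (N2 : (z + Ci * a)%C <> RtoC 0) by (apply Cneq0_re; lra).
  assert (N3 : (RtoC (c + 1) - Ci * a)%C <> RtoC 0) by (apply Cneq0_re; lra).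
  assert (N4 : (RtoC (c + 1) + Ci * a)%C <> RtoC 0) by (apply Cneq0_re; lra).
  replace (1 + RtoC (c + 1) * RtoC (c + 1) / (a * a))%C with
    ((RtoC (c + 1) * RtoC (c + 1) + a * a) / (a * a))%C by (field; auto).
  replace (1 + z * z / (a * a))%C with ((z * z + a * a) / (a * a))%C by (field; auto).
  rewrite !factor_za. field. auto.
Qed.

Lemma Cder_Tf c a z : good c a -> c < Re z -> Cder (Tf c a) z (Tf1 a z).
Proof.
  intros Ha Hz.
  assert (A1 := good_re1 c a z Ha Hz). assert (A2 := good_re2 c a z Ha Hz).
  unfold Tf, Tf1.
  apply Cder_eq with (0 + (/ (z - Ci * a) - 0) + (/ (z + Ci * a) - 0))%C. ring.
  apply Cder_plus; [apply Cder_plus; [apply Cder_const|]|]; apply Cder_minus; try apply Cder_const;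
    apply (Cder_shift Clog); apply Cder_Clog; auto; fold (z - Ci * a)%C; lra.
Qed.

Lemma Tf1_eq c a z : good c a -> c < Re z -> Tf1 a z = (2 * z / (z ^ 2 + a ^ 2))%C.
Proof.
  intros Ha Hz.
  assert (A1 := good_re1 c a z Ha Hz). assert (A2 := good_re2 c a z Ha Hz).
  assert (N1 : (z - Ci * a)%C <> RtoC 0) by (apply Cneq0_re; lra).
  assert (N2 : (z + Ci * a)%C <> RtoC 0) by (apply Cneq0_re; lra).
  replace (z ^ 2 + a ^ 2)%C with (z * z + a * a)%C by (simpl; ring).
  rewrite factor_za. unfold Tf1. field. auto.
Qed.

(** At real points conjugation exchanges the factors [x - i a] and [x + i a]. *)
Lemma Tf_conj c a x : good c a -> c < x -> Tf c (Cconj a) (RtoC x) = Cconj (Tf c a (RtoC x)).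
Proof.
  intros Ha Hx. assert (Hc := good_pos c a Ha). assert (Ha0 := good_neq0 c a Ha).
  assert (HR : forall y, Cconj (RtoC y) = RtoC y) by (intros; apply C_eq; simpl; ring).
  assert (HI : Cconj Ci = (- Ci)%C) by (apply C_eq; simpl; ring).
  assert (E1 : forall y, (RtoC y - Ci * Cconj a)%C = Cconj (RtoC y + Ci * a)%C).
  { intros. rewrite Cplus_conj, Cmult_conj, HR, HI. ring. }
  assert (E2 : forall y, (RtoC y + Ci * Cconj a)%C = Cconj (RtoC y - Ci * a)%C).
  { intros. rewrite Cminus_conj, Cmult_conj, HR, HI. ring. }
  assert (E3 : (1 + RtoC (c + 1) * RtoC (c + 1) / (Cconj a * Cconj a))%C =
     Cconj (1 + RtoC (c + 1) * RtoC (c + 1) / (a * a))%C).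
  { rewrite Cplus_conj, Cdiv_conj, !Cmult_conj, !HR. reflexivity.
    intro E. apply Ha0. destruct (Ceq_dec a (RtoC 0)); auto. exfalso.
    apply (Cmult_neq_0 a a); auto. }
  assert (A1 := good_re1 c a (RtoC x) Ha Hx). assert (A2 := good_re2 c a (RtoC x) Ha Hx).
  assert (A3 := good_re1 c a (RtoC (c + 1)) Ha ltac:(reim; lra)).
  assert (A4 := good_re2 c a (RtoC (c + 1)) Ha ltac:(reim; lra)).
  rewrite Re_RtoC in *.
  assert (A5 := good_re_quot c a (c + 1) Ha).
  unfold Tf. rewrite !E1, !E2, E3, !Clog_conj by (try lra; reim; revert A5; reim; lra).
  rewrite !Cplus_conj, !Cminus_conj. ring.
Qed.

(** [kap d M * |a|] bounds [|z -/+ i a|] from below: by [|a| - |z|] if [|a| >= 2 M],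
    by the real part otherwise. *)
Definition kap (d M : R) : R := Rmin (1 / 2) (d / (2 * M)).

Lemma kap_pos d M : 0 < d -> 0 < M -> 0 < kap d M.
Proof. intros. apply Rmin_pos. lra. apply Rdiv_lt_0_compat; lra. Qed.

Lemma kap_bound c a z d M : good c a -> 0 < d -> c + d <= Re z -> Cmod z <= M ->
  kap d M * Cmod a <= Cmod (z - Ci * a)%C /\ kap d M * Cmod a <= Cmod (z + Ci * a)%C.
Proof.
  intros Ha Hd Hz HM.
  assert (A1 := good_re1 c a z Ha ltac:(lra)). assert (A2 := good_re2 c a z Ha ltac:(lra)).
  assert (Hm := good_mod c a Ha). assert (Hc := good_pos c a Ha).
  assert (HM0 : 0 < M) by (generalize (Re_le_Cmod z); lra).
  assert (Hia : Cmod (Ci * a)%C = Cmod a) by (rewrite Cmod_mult, Cmod_Ci; ring).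
  assert (B1 := Cmod_minus_ge (Ci * a)%C z). rewrite Cmod_minus_sym, Hia in B1.
  assert (B2 := Cmod_plus_ge (Ci * a)%C z). rewrite Cplus_comm, Hia in B2.
  assert (C1 := Re_le_Cmod (z - Ci * a)%C). assert (C2 := Re_le_Cmod (z + Ci * a)%C).
  assert (K1 : kap d M <= 1 / 2) by apply Rmin_l. assert (K2 : kap d M <= d / (2 * M)) by apply Rmin_r.
  assert (K0 := kap_pos d M Hd HM0).
  destruct (Rle_lt_dec (2 * M) (Cmod a)).
  - split; nra.
  - assert (kap d M * Cmod a <= d).
    { apply Rle_trans with (d / (2 * M) * (2 * M)).
      apply Rmult_le_compat; lra. right; field; lra. }
    split; lra.
Qed.

Lemma Tf1_bound c a z d M : good c a -> 0 < d -> c + d <= Re z -> Cmod z <= M ->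
  Cmod (Tf1 a z) <= 2 * M / (kap d M * kap d M) * / (Cmod a * Cmod a).
Proof.
  intros Ha Hd Hz HM.
  destruct (kap_bound c a z d M Ha Hd Hz HM) as [B1 B2].
  assert (Hm := good_mod c a Ha). assert (Hc := good_pos c a Ha).
  assert (HM0 : 0 < M) by (generalize (Re_le_Cmod z); lra).
  assert (K0 := kap_pos d M Hd HM0).
  rewrite (Tf1_eq c) by (auto; lra).
  replace (z ^ 2 + a ^ 2)%C with (z * z + a * a)%C by (simpl; ring). rewrite factor_za.
  rewrite Cmod_div', !Cmod_mult, Cmod_R_pos by lra.
  assert (K1 : 0 < kap d M * Cmod a) by (apply Rmult_lt_0_compat; lra).
  replace (2 * M / (kap d M * kap d M) * / (Cmod a * Cmod a)) with
    (2 * M * / ((kap d M * Cmod a) * (kap d M * Cmod a))) by (field; split; lra).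
  unfold Rdiv. apply Rmult_le_compat.
  - generalize (Cmod_ge_0 z); lra.
  - left. apply Rinv_0_lt_compat. apply Rmult_lt_0_compat; lra.
  - lra.
  - apply Rinv_le_contravar. nra. apply Rmult_le_compat; lra.
Qed.

Lemma Tf1_lip c a z w d M : good c a -> 0 < d -> c + d <= Re z -> Cmod z <= M ->
  c + d <= Re w -> Cmod w <= M ->
  Cmod (Tf1 a z - Tf1 a w)%C <= 2 / (kap d M * kap d M) * / (Cmod a * Cmod a) * Cmod (z - w)%C.
Proof.
  intros Ha Hd Hz HM Hw HMw.
  destruct (kap_bound c a z d M Ha Hd Hz HM) as [B1 B2].
  destruct (kap_bound c a w d M Ha Hd Hw HMw) as [B3 B4].
  assert (Hm := good_mod c a Ha). assert (Hc := good_pos c a Ha).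
  assert (HM0 : 0 < M) by (generalize (Re_le_Cmod z); lra).
  assert (K0 := kap_pos d M Hd HM0).
  set (m := kap d M * Cmod a) in *. assert (Hm0 : 0 < m) by (apply Rmult_lt_0_compat; lra).
  assert (HH : forall u v : C, m <= Cmod u -> m <= Cmod v -> Cmod (/ u - / v)%C <= / (m * m) * Cmod (u - v)%C).
  { intros u v Hu Hv.
    assert (u <> RtoC 0) by (apply Cmod_gt_0; lra). assert (v <> RtoC 0) by (apply Cmod_gt_0; lra).
    replace (/ u - / v)%C with (- (u - v) / (u * v))%C by (field; auto).
    rewrite Cmod_div', Cmod_opp, Cmod_mult. unfold Rdiv. rewrite Rmult_comm.
    apply Rmult_le_compat_r. apply Cmod_ge_0. apply Rinv_le_contravar. nra. apply Rmult_le_compat; lra. }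
  unfold Tf1.
  replace (/ (z - Ci * a) + / (z + Ci * a) - (/ (w - Ci * a) + / (w + Ci * a)))%C with
    ((/ (z - Ci * a) - / (w - Ci * a)) + (/ (z + Ci * a) - / (w + Ci * a)))%C by ring.
  eapply Rle_trans. apply Cmod_triangle.
  assert (G1 := HH _ _ B1 B3). assert (G2 := HH _ _ B2 B4).
  replace (z - Ci * a - (w - Ci * a))%C with (z - w)%C in G1 by ring.
  replace (z + Ci * a - (w + Ci * a))%C with (z - w)%C in G2 by ring.
  replace (2 / (kap d M * kap d M) * / (Cmod a * Cmod a)) with (2 * / (m * m)).
  lra. unfold m. field. lra.
Qed.

(** At the base point [c + 1] the branch is principal and the quotient has non-negative real part,
    so [Clog_1_plus] applies for every [a]. From there the bound on [Tf1] is integrated along the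
    segment to [z]. The factor [Cmod a ^ (-2)] makes the sum over the zeros converge. *)
Lemma Tf_bound c a z d M : good c a -> 0 < d <= 1 -> c + d <= Re z -> Cmod z <= M -> c + 1 <= M ->
  Cmod (Tf c a z) <= ((c + 1) * (c + 1) + 2 * M / (kap d M * kap d M) * (2 * M)) * / (Cmod a * Cmod a).
Proof.
  intros Ha Hd Hz HM HcM.
  assert (Hc := good_pos c a Ha). assert (Hm := good_mod c a Ha).
  assert (HM0 : 0 < M) by lra. assert (K0 := kap_pos d M (proj1 Hd) HM0).
  replace (Tf c a z) with (Tf c a (RtoC (c + 1)) + (Tf c a z - Tf c a (RtoC (c + 1))))%C by ring.
  eapply Rle_trans. apply Cmod_triangle. rewrite Rmult_plus_distr_r. apply Rplus_le_compat.
  - replace (Tf c a (RtoC (c + 1))) with (Clog (1 + RtoC (c + 1) * RtoC (c + 1) / (a * a))) by (unfold Tf; ring).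
    eapply Rle_trans. apply Clog_1_plus. apply (good_re_quot c); auto.
    rewrite Cmod_div', !Cmod_mult, !Cmod_R_pos by lra. unfold Rdiv. lra.
  - set (Q := 2 * M / (kap d M * kap d M) * / (Cmod a * Cmod a)).
    assert (HQ : 0 <= Q).
    { unfold Q. apply Rmult_le_pos. apply Rdiv_le_0_compat. lra. nra. left; apply Rinv_0_lt_compat; nra. }
    replace (2 * M / (kap d M * kap d M) * (2 * M) * / (Cmod a * Cmod a)) with (Q * (2 * M)).
    2: { unfold Q. field. split; lra. }
    assert (Hseg : forall t, 0 <= t <= 1 -> c + d <= Re (RtoC (c + 1) + RtoC t * (z - RtoC (c + 1)))%C /\
       Cmod (RtoC (c + 1) + RtoC t * (z - RtoC (c + 1)))%C <= M).
    { intros t Ht. split.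
      - reim. assert (0 <= t * (Re z - (c + d))) by (apply Rmult_le_pos; lra).
        assert (0 <= (1 - t) * (1 - d)) by (apply Rmult_le_pos; lra). nra.
      - replace (RtoC (c + 1) + RtoC t * (z - RtoC (c + 1)))%C with (RtoC (1 - t) * RtoC (c + 1) + RtoC t * z)%C
          by (rewrite RtoC_minus; ring).
        eapply Rle_trans. apply Cmod_triangle. rewrite !Cmod_mult, !Cmod_R_pos by lra. nra. }
    eapply Rle_trans. apply (Cmvt (Tf c a) (Tf1 a) _ _ Q).
    + intros t Ht. apply Cder_Tf; auto. destruct (Hseg t Ht). lra.
    + intros t Ht. destruct (Hseg t Ht). apply (Tf1_bound c); auto. lra.
    + apply Rmult_le_compat_l; auto. eapply Rle_trans. apply Cmod_minus_le. rewrite Cmod_R_pos by lra. lra.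
Qed.

Definition Pf (c : R) (alpha : nat -> C) (z : C) : C :=
  Clim_seq (fun n => Csum (fun k => Tf c (alpha k) z) (S n)).

Definition good_seq (c : R) (alpha : nat -> C) : Prop :=
  (forall n, good c (alpha n)) /\ ex_series (fun n => / (Cmod (alpha n) * Cmod (alpha n))).

Lemma ex_series_scal_R (c : R) (u : nat -> R) : ex_series u -> ex_series (fun n => c * u n).
Proof. apply (ex_series_scal (V := R_NormedModule)). Qed.

Lemma ex_series_S (u : nat -> R) : ex_series u -> ex_series (fun n => u (S n)).
Proof. apply (ex_series_incr_1 (V := R_NormedModule) u). Qed.

Lemma Pf_lim c alpha z : good_seq c alpha -> c < Re z ->
  Clim (fun n => Csum (fun k => Tf c (alpha k) z) (S n)) (Pf c alpha z).
Proof.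
  intros [Hg Hs] Hz.
  set (d := Rmin 1 (Re z - c)). set (M := Rmax (Cmod z) (c + 1)).
  assert (Hd : 0 < d <= 1) by (split; [apply Rmin_pos; lra|apply Rmin_l]).
  assert (Hd2 : d <= Re z - c) by apply Rmin_r.
  destruct (Cseries_cv (fun n => Csum (fun k => Tf c (alpha k) z) (S n))
    (fun n => ((c + 1) * (c + 1) + 2 * M / (kap d M * kap d M) * (2 * M)) * / (Cmod (alpha (S n)) * Cmod (alpha (S n))))) as [l Hl].
  - apply ex_series_scal_R. apply (ex_series_S _ Hs).
  - intros n. change (Csum (fun k => Tf c (alpha k) z) (S (S n))) with
     (Csum (fun k => Tf c (alpha k) z) (S n) + Tf c (alpha (S n)) z)%C.
    match goal with |- Cmod ?e <= _ => replace e with (Tf c (alpha (S n)) z) by ring end.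
    apply Tf_bound; auto. lra. apply Rmax_l. apply Rmax_r.
  - unfold Pf. rewrite (Clim_Clim_seq _ _ Hl). exact Hl.
Qed.

Lemma Pf_der c alpha z : good_seq c alpha -> c < Re z ->
  Cder (Pf c alpha) z (CSeries (zeta_sum_term alpha z)).
Proof.
  intros [Hg Hs] Hz.
  set (d := (Re z - c) / 2). set (M := Cmod z + d).
  assert (Hc := good_pos _ _ (Hg O)).
  assert (Hd : 0 < d) by (unfold d; lra).
  assert (HM : 0 < M) by (unfold M; generalize (Cmod_ge_0 z); lra).
  assert (K0 := kap_pos d M Hd HM).
  assert (Hball : forall w, Cmod (w - z)%C < d -> c + d <= Re w /\ Cmod w <= M).
  { intros w Hw. split.
    - generalize (re_le_Cmod (w - z)%C). reim. unfold Rabs, d in *. destruct (Rcase_abs (Re w - Re z)); lra.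
    - unfold M. generalize (Cmod_triangle (w - z)%C z). replace (w - z + z)%C with w by ring. lra. }
  assert (Hz0 : Cmod (z - z)%C < d) by (replace (z - z)%C with (RtoC 0) by ring; rewrite Cmod_0; auto).
  destruct (Hball z Hz0) as [Z1 Z2].
  destruct (Cseries_cv (fun n => Csum (fun k => Tf1 (alpha k) z) (S n))
    (fun n => (2 * M / (kap d M * kap d M)) * / (Cmod (alpha (S n)) * Cmod (alpha (S n))))) as [G HG].
  - apply ex_series_scal_R. apply (ex_series_S _ Hs).
  - intros n. change (Csum (fun k => Tf1 (alpha k) z) (S (S n))) with
     (Csum (fun k => Tf1 (alpha k) z) (S n) + Tf1 (alpha (S n)) z)%C.
    match goal with |- Cmod ?e <= _ => replace e with (Tf1 (alpha (S n)) z) by ring end.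
    apply (Tf1_bound c); auto.
  - replace (CSeries (zeta_sum_term alpha z)) with G.
    2: { unfold CSeries. symmetry. apply Clim_Clim_seq.
         eapply Clim_ext; [|exact HG]. intros n. cbv beta. rewrite sum_n_Csum.
         apply Csum_ext. intros k _. apply (Tf1_eq c); auto. }
    apply Cder_lim with (F := fun n z => Csum (fun k => Tf c (alpha k) z) (S n))
      (g := fun n z => Csum (fun k => Tf1 (alpha k) z) (S n))
      (M := Series (fun n => 2 / (kap d M * kap d M) * / (Cmod (alpha n) * Cmod (alpha n)))) (d := d); auto.
    + intros n w Hw. destruct (Hball w Hw).
      apply (Cder_Csum (fun k => Tf c (alpha k)) (fun k => Tf1 (alpha k))).
      intros k _. apply Cder_Tf; auto. lra.
    + intros n w Hw. destruct (Hball w Hw) as [W1 W2].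
      rewrite <- Csum_minus.
      rewrite Rmult_comm, <- Series_scal_l. apply Csum_bound.
      * apply ex_series_scal_R. apply ex_series_scal_R. exact Hs.
      * intros k. rewrite Rmult_comm. apply (Tf1_lip c); auto.
    + intros w Hw. destruct (Hball w Hw) as [W1 W2].
      apply Pf_lim. split; auto. lra.
Qed.

Lemma Cexp_Pf c alpha z : good_seq c alpha -> c < Re z ->
  Cexp (Pf c alpha z) = CProd (fun n => 1 + z ^ 2 / alpha n ^ 2)%C.
Proof.
  intros Hg Hz. unfold CProd. symmetry. apply Clim_Clim_seq.
  eapply Clim_ext; [|exact (Clim_Cexp _ _ (Pf_lim c alpha z Hg Hz))].
  assert (E : forall n, Cexp (Tf c (alpha n) z) = (1 + z ^ 2 / alpha n ^ 2)%C).
  { intros n. rewrite Cexp_Tf by (auto; apply Hg). simpl. rewrite !Cmult_1_r. reflexivity. }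
  intros n. cbv beta. induction n.
  - cbn [Csum Cprod_n]. rewrite Cplus_0_l. apply E.
  - change (Csum (fun k => Tf c (alpha k) z) (S (S n))) with
     (Csum (fun k => Tf c (alpha k) z) (S n) + Tf c (alpha (S n)) z)%C.
    rewrite Cexp_plus, IHn, E. reflexivity.
Qed.

Lemma Re_sum_n (u : nat -> C) n : Re (sum_n u n) = sum_n (fun k => Re (u k)) n.
Proof. induction n. rewrite !sum_O. auto. rewrite !sum_Sn, <- IHn. reflexivity. Qed.

(** [B_const] is defined with principal logarithms and [Pf] with the branch [Tf]; the real parts
    agree because both are the logarithm of the modulus of the factor. *)
Lemma Pf_re c alpha x : good_seq c alpha -> c < x ->
  Re (Pf c alpha (RtoC x)) = Re (CSeries (fun n => Clog (1 + RtoC (x ^ 2) / alpha n ^ 2)%C)).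
Proof.
  intros Hg Hx.
  change (Re (CSeries (fun n => Clog (1 + RtoC (x ^ 2) / alpha n ^ 2)%C))) with
    (real (Lim_seq (fun n => Re (sum_n (fun n => Clog (1 + RtoC (x ^ 2) / alpha n ^ 2)%C) n)))).
  rewrite (Lim_seq_ext _ (fun n => Re (Csum (fun k => Tf c (alpha k) (RtoC x)) (S n)))).
  - rewrite (is_lim_seq_unique _ _ (Clim_re _ _ (Pf_lim c alpha (RtoC x) Hg Hx))). reflexivity.
  - intros n. rewrite <- sum_n_Csum, !Re_sum_n. apply sum_n_ext. intros k.
    assert (E := f_equal Cmod (Cexp_Tf c (alpha k) (RtoC x) (proj1 Hg k) Hx)).
    rewrite Cmod_Cexp in E. change (ln (Cmod (1 + RtoC (x ^ 2) / alpha k ^ 2)%C) = Re (Tf c (alpha k) (RtoC x))). simpl.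
    replace (RtoC (x * (x * 1)) / (alpha k * (alpha k * 1)))%C with (RtoC x * RtoC x / (alpha k * alpha k))%C.
    rewrite <- E. apply ln_exp.
    rewrite !Cmult_1_r, Rmult_1_r, RtoC_mult. reflexivity.
Qed.

(** * Conjugate symmetry of the zeros *)

Definition conj_mult (alpha : nat -> C) : Prop := forall a : C, exists k : nat,
    has_multiplicity alpha a k /\
    (Im a <> 0 -> has_multiplicity alpha (Cconj a) k).

(** Each index is matched with one of the conjugate zero, at the same position
    in the list of indices of the latter. *)
Lemma conj_injection alpha : conj_mult alpha ->
  exists sigma : nat -> nat, (forall i j, sigma i = sigma j -> i = j) /\
    forall n, alpha (sigma n) = Cconj (alpha n).
Proof.
  intros H.
  assert (H1 : forall a : C, exists p : list nat * list nat,
    NoDup (fst p) /\ (forall n, In n (fst p) <-> alpha n = a) /\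
    NoDup (snd p) /\ (forall n, In n (snd p) <-> alpha n = Cconj a) /\
    length (fst p) = length (snd p)).
  { intros a. destruct (H a) as [k [[l [A1 [A2 A3]]] HC]].
    destruct (Req_dec (Im a) 0) as [E|E].
    - exists (l, l). simpl. assert (Cconj a = a).
      { apply C_eq. apply re_conj. rewrite im_conj. lra. }
      rewrite H0. auto 10.
    - destruct (HC E) as [l' [B1 [B2 B3]]]. exists (l, l'). simpl. split; auto. split; auto. split; auto. split; auto. lia. }
  destruct (functional_choice _ H1) as [f Hf].
  assert (H2 : forall n : nat, exists j : nat, exists i : nat,
     (i < length (fst (f (alpha n))))%nat /\ nth i (fst (f (alpha n))) O = n /\ nth i (snd (f (alpha n))) O = j).
  { intros n. destruct (Hf (alpha n)) as [_ [A2 _]].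
    destruct (In_nth (fst (f (alpha n))) n O) as [i [I1 I2]]. apply A2; auto.
    exists (nth i (snd (f (alpha n))) O), i. auto. }
  destruct (functional_choice _ H2) as [sigma Hs].
  assert (Hc : forall n, alpha (sigma n) = Cconj (alpha n)).
  { intros n. destruct (Hs n) as [i [I1 [I2 I3]]].
    destruct (Hf (alpha n)) as [_ [_ [_ [A4 A5]]]]. apply A4. rewrite <- I3. apply nth_In. lia. }
  exists sigma. split; auto.
  intros n m E.
  assert (Ea : alpha n = alpha m).
  { rewrite <- (Cconj_conj (alpha n)), <- (Cconj_conj (alpha m)), <- !Hc, E. reflexivity. }
  destruct (Hs n) as [i [I1 [I2 I3]]]. destruct (Hs m) as [j [J1 [J2 J3]]].
  rewrite Ea in I1, I2, I3.
  destruct (Hf (alpha m)) as [_ [_ [A3 [_ A5]]]].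
  assert (i = j).
  { apply (proj1 (NoDup_nth _ O) A3); lia. }
  subst j. congruence.
Qed.

Definition lsum (u : nat -> R) (l : list nat) : R := fold_right (fun n s => u n + s) 0 l.

Lemma lsum_app u l1 l2 : lsum u (l1 ++ l2) = lsum u l1 + lsum u l2.
Proof. induction l1; simpl. ring. rewrite IHl1. ring. Qed.

Lemma lsum_incl u l1 l2 : (forall n, 0 <= u n) -> NoDup l1 -> incl l1 l2 -> lsum u l1 <= lsum u l2.
Proof.
  intros Hu. revert l2. induction l1 as [|x l1 IH]; intros l2 Hn Hi; simpl.
  - induction l2; simpl. lra. assert (incl nil l2) by (intros y []). generalize (Hu a) (IHl2 H). lra.
  - inversion Hn; subst.
    destruct (in_split x l2) as [m1 [m2 E]]. apply Hi; left; auto. subst l2.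
    rewrite lsum_app. simpl.
    assert (lsum u l1 <= lsum u (m1 ++ m2)).
    { apply IH; auto. intros y Hy. 
      assert (Hy' := Hi y (or_intror Hy)). apply in_app_or in Hy'. apply in_or_app.
      destruct Hy' as [|[|]]; auto. subst. contradiction. }
    rewrite lsum_app in H. lra.
Qed.

Lemma lsum_seq u n : lsum u (seq 0 (S n)) = sum_n u n.
Proof.
  induction n. rewrite sum_O. simpl. ring.
  rewrite seq_S, lsum_app, IHn, sum_Sn. simpl. unfold plus; simpl. ring.
Qed.

Lemma sum_n_le_Series (u : nat -> R) n : (forall n, 0 <= u n) -> ex_series u -> sum_n u n <= Series u.
Proof.
  intros Hu Hs. assert (H := Series_correct _ Hs). change (is_lim_seq (sum_n u) (Series u)) in H.
  apply is_lim_seq_incr_compare with (u := sum_n u); auto.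
  intros m. rewrite sum_Sn. unfold plus; simpl. generalize (Hu (S m)). lra.
Qed.

(** A partial sum along [sigma] runs over distinct indices, hence is at most the partial sum of [u]
    up to the largest of them. This inequality takes the place of a rearrangement theorem. *)
Lemma Series_inj_le (u : nat -> R) (sigma : nat -> nat) : (forall n, 0 <= u n) -> ex_series u ->
  ex_series (fun n => u (sigma n)) ->
  (forall i j, sigma i = sigma j -> i = j) -> Series (fun n => u (sigma n)) <= Series u.
Proof.
  intros Hu Hs Hs' Hi.
  assert (H := Series_correct _ Hs'). change (is_lim_seq (sum_n (fun n => u (sigma n))) (Series (fun n => u (sigma n)))) in H.
  assert (HR : Rbar_le (Series (fun n => u (sigma n))) (Series u)); [|exact HR].
  apply (is_lim_seq_le (sum_n (fun n => u (sigma n))) (fun _ => Series u)); auto. 2: apply is_lim_seq_const.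
  intros n. rewrite <- lsum_seq.
  replace (lsum (fun n => u (sigma n)) (seq 0 (S n))) with (lsum u (map sigma (seq 0 (S n)))).
  2: { generalize (seq 0 (S n)). induction l; simpl; auto. rewrite IHl; auto. }
  eapply Rle_trans; [|apply (sum_n_le_Series u (list_max (map sigma (seq 0 (S n))))); auto].
  rewrite <- lsum_seq. apply lsum_incl; auto.
  - apply FinFun.Injective_map_NoDup. exact Hi. apply seq_NoDup.
  - intros y Hy. apply in_seq. split. lia.
    assert (A := proj1 (list_max_le (map sigma (seq 0 (S n))) _) (le_n _)).
    rewrite Forall_forall in A. specialize (A y Hy). lia.
Qed.

(** The injection [sigma] exchanges the positive part [p] and the negative part [q] of the terms.
    Applying [Series_inj_le] to each of them gives inequalities both ways, so the two sums agree and
    their difference vanishes. *)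
Lemma conj_sum_zero (alpha : nat -> C) (h : C -> R) (m : nat -> R) (l : R) :
  conj_mult alpha -> (forall n, h (Cconj (alpha n)) = - h (alpha n)) ->
  ex_series m -> (forall n, Rabs (h (alpha n)) <= m n) ->
  is_lim_seq (sum_n (fun n => h (alpha n))) l -> l = 0.
Proof.
  intros HC Hh Hm Hb Hl.
  destruct (conj_injection alpha HC) as [sigma [Hi Hs]].
  set (p := fun n => Rmax (h (alpha n)) 0). set (q := fun n => Rmax (- h (alpha n)) 0).
  assert (Ep : forall n, p (sigma n) = q n) by (intros n; unfold p, q; rewrite Hs, Hh; auto).
  assert (Eq : forall n, q (sigma n) = p n) by (intros n; unfold p, q; rewrite Hs, Hh, Ropp_involutive; auto).
  assert (Hp0 : forall n, 0 <= p n) by (intros; apply Rmax_r).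
  assert (Hq0 : forall n, 0 <= q n) by (intros; apply Rmax_r).
  assert (Hle : forall u, (forall n, 0 <= u n <= Rabs (h (alpha n))) -> ex_series u).
  { intros u Hu. apply (ex_series_le (K := R_AbsRing) (V := R_CompleteNormedModule) _ m); auto.
    intros n. change (Rabs (u n) <= m n). destruct (Hu n). rewrite Rabs_pos_eq by auto.
    eapply Rle_trans; [exact H0|apply Hb]. }
  assert (Hp : ex_series p).
  { apply Hle. intros n. split; auto. unfold p. apply Rmax_lub. apply Rle_abs. apply Rabs_pos. }
  assert (Hq : ex_series q).
  { apply Hle. intros n. split; auto. unfold q. apply Rmax_lub. rewrite <- Rabs_Ropp. apply Rle_abs. apply Rabs_pos. }
  assert (L1 : Series q <= Series p).
  { rewrite <- (Series_ext _ _ Ep). apply Series_inj_le; auto. apply (ex_series_ext q); auto. }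
  assert (L2 : Series p <= Series q).
  { rewrite <- (Series_ext _ _ Eq). apply Series_inj_le; auto. apply (ex_series_ext p); auto. }
  assert (HL : is_lim_seq (sum_n (fun n => h (alpha n))) (Series p - Series q)).
  { apply is_lim_seq_ext with (fun n => sum_n p n - sum_n q n).
    - intros n. induction n.
      + rewrite !sum_O. unfold p, q, Rmax. destruct (Rle_dec _ _), (Rle_dec _ _); lra.
      + rewrite !sum_Sn, <- IHn. unfold plus; simpl.
        unfold p at 2, q at 2, Rmax. destruct (Rle_dec _ _), (Rle_dec _ _); lra.
    - apply is_lim_seq_minus'; apply Series_correct; auto. }
  apply is_lim_seq_unique in Hl. apply is_lim_seq_unique in HL. rewrite HL in Hl. injection Hl. lra.
Qed.

Lemma Pf_real c alpha x : good_seq c alpha -> conj_mult alpha -> c < x -> Im (Pf c alpha (RtoC x)) = 0.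
Proof.
  intros Hg HC Hx. assert (Hc := good_pos _ _ (proj1 Hg O)).
  set (d := Rmin 1 (x - c)). set (M := Rmax x (c + 1)).
  assert (Hd : 0 < d <= 1) by (split; [apply Rmin_pos; lra|apply Rmin_l]).
  assert (Hd2 : d <= x - c) by apply Rmin_r.
  apply (conj_sum_zero alpha (fun a => Im (Tf c a (RtoC x)))
    (fun n => ((c + 1) * (c + 1) + 2 * M / (kap d M * kap d M) * (2 * M)) * / (Cmod (alpha n) * Cmod (alpha n)))); auto.
  - intros n. rewrite Tf_conj by (auto; apply Hg). rewrite im_conj. reflexivity.
  - apply ex_series_scal_R. apply Hg.
  - intros n. eapply Rle_trans. apply im_le_Cmod. apply Tf_bound; auto. apply Hg. reim; lra.
    rewrite Cmod_R_pos by lra. apply Rmax_l. apply Rmax_r.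
  - eapply is_lim_seq_ext; [|exact (Clim_im _ _ (Pf_lim c alpha (RtoC x) Hg Hx))].
    intros n. cbv beta. rewrite <- sum_n_Csum.
    induction n. rewrite !sum_O. auto. rewrite !sum_Sn, <- IHn. reflexivity.
Qed.

(** * Summability of the inverse squares of the zeros *)

Lemma ex_series_Re (u : nat -> C) : ex_series (K := C_AbsRing) (V := C_NormedModule) u ->
  ex_series (fun n => Re (u n)).
Proof.
  intros [l Hl]. exists (Re l).
  intros P [eps HP]. 
  assert (HQ : locally (T := C_UniformSpace) l (fun y => P (Re y))).
  { exists eps. intros y [H1 _]. apply HP. exact H1. }
  specialize (Hl _ HQ). unfold filtermap in *.
  destruct Hl as [N HN]. exists N. intros n Hn. rewrite <- Re_sum_n. apply HN. auto.
Qed.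

Lemma Re_inv z : Re (/ z)%C = Re z / (Cmod z * Cmod z).
Proof. rewrite Cmod_sqr. unfold Cinv, Re, Im. simpl. f_equal. ring. Qed.

(** Mere convergence of the sum in (e) at one large real [x] suffices. With [W = x^2 + a^2], the
    real part of the term is [2 x Re W / |W|^2], where [Re W >= |a|^2] because [x > 2 c], and
    [|W| <= (x^2 + 1) |a|^2] because [|a| > 1]. It is thus bounded below by a multiple of
    [|a|^(-2)]. *)
Lemma ex_series_inv_mod2 c alpha : (forall n, good c (alpha n)) ->
  (exists a : R, forall z : C, a < Re z ->
    ex_series (K := C_AbsRing) (V := C_NormedModule) (zeta_sum_term alpha z)) ->
  ex_series (fun n => / (Cmod (alpha n) * Cmod (alpha n))).
Proof.
  intros Hg [a0 Ha]. assert (Hc := good_pos _ _ (Hg O)).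
  set (x := Rabs a0 + 2 * c + 1).
  assert (Hx : a0 < x /\ 2 * c + 1 <= x).
  { unfold x. generalize (Rle_abs a0) (Rabs_pos a0). lra. }
  assert (H := ex_series_Re _ (Ha (RtoC x) (proj1 Hx))).
  apply (ex_series_le (K := R_AbsRing) (V := R_CompleteNormedModule) _
    (fun n => ((x * x + 1) * (x * x + 1) / (2 * x)) * Re (zeta_sum_term alpha (RtoC x) n))).
  2: { apply ex_series_scal_R. exact H. }
  intros n. set (A := alpha n). destruct (Hg n) as [G1 [G2 G3]]. fold A in G1, G2, G3.
  assert (Hm := good_mod c A (Hg n)).
  set (t := Cmod A * Cmod A). assert (Ht : 1 <= t) by (unfold t; nra).
  change (Rabs (/ t) <= (x * x + 1) * (x * x + 1) / (2 * x) * Re (zeta_sum_term alpha (RtoC x) n)).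
  rewrite Rabs_pos_eq by (left; apply Rinv_0_lt_compat; lra).
  unfold zeta_sum_term. fold A.
  set (W := (RtoC x ^ 2 + A ^ 2)%C).
  assert (EW : W = (RtoC x * RtoC x + A * A)%C) by (unfold W; simpl; ring).
  assert (HI : Im A * Im A <= c * c).
  { revert G1. unfold Rabs. destruct (Rcase_abs (Im A)); intros; nra. }
  assert (HRe : t <= Re W).
  { rewrite EW. unfold t. rewrite Cmod_sqr. reim. nra. }
  assert (HW : Cmod W <= (x * x + 1) * t).
  { rewrite EW. eapply Rle_trans. apply Cmod_triangle. rewrite !Cmod_mult, Cmod_R_pos by lra. fold t. nra. }
  assert (HW0 : 0 < Cmod W) by (apply Cmod_gt_0_re; lra).
  replace (2 * RtoC x / W)%C with (RtoC (2 * x) * / W)%C by (rewrite RtoC_mult; unfold Cdiv; ring).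
  rewrite Re_mult, Re_RtoC, Im_RtoC, Re_inv.
  replace ((x * x + 1) * (x * x + 1) / (2 * x) * (2 * x * (Re W / (Cmod W * Cmod W)) - 0 * Im (/ W)%C))
    with ((x * x + 1) * (x * x + 1) * (Re W / (Cmod W * Cmod W))) by (field; split; lra).
  assert (HX : 0 < (x * x + 1) * (x * x + 1)) by nra.
  apply Rle_trans with ((x * x + 1) * (x * x + 1) * (t / (((x * x + 1) * t) * ((x * x + 1) * t)))).
  - right. field. split; nra.
  - apply Rmult_le_compat_l. lra. apply Rmult_le_compat; auto. lra.
    left; apply Rinv_0_lt_compat. apply Rmult_lt_0_compat; nra.
    apply Rinv_le_contravar. nra. apply Rmult_le_compat; lra.
Qed.

Lemma Carg_Re_sqr a : 0 < Re a -> Rabs (Carg a) < PI / 4 -> 0 < Re (a * a)%C.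
Proof.
  intros Ha H. rewrite Carg_atan in H by auto.
  apply Rabs_def2 in H. destruct H as [H1 H2].
  assert (T1 : Im a / Re a < 1).
  { apply Rnot_le_lt. intros Hle. destruct Hle as [Hlt|Heq].
    - apply atan_increasing in Hlt. rewrite atan_1 in Hlt. lra.
    - rewrite <- Heq, atan_1 in H1. lra. }
  assert (T2 : -1 < Im a / Re a).
  { apply Rnot_le_lt. intros Hle. 
    assert (E : atan (-1) = - (PI / 4)) by (replace (-1) with (-(1)) by ring; rewrite atan_opp, atan_1; auto).
    destruct Hle as [Hlt|Heq].
    - apply atan_increasing in Hlt. lra.
    - rewrite Heq in H2. lra. }
  assert (E : Im a = Im a / Re a * Re a) by (field; lra).
  set (q := Im a / Re a) in *. reim. rewrite E. 
  assert (0 < 1 - q * q) by nra. assert (0 < Re a * Re a) by nra. nra.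
Qed.

Lemma good_Riemann E B alpha c : Riemann_sequence E B alpha ->
  (forall n, Rabs (Im (alpha n)) < c) -> good_seq c alpha.
Proof.
  intros H Hc.
  assert (HR : forall n, 1 < Re (alpha n)).
  { induction n. apply (rs_gt1 _ _ _ H). generalize (rs_incr _ _ _ H n). lra. }
  assert (Hg : forall n, good c (alpha n)).
  { intros n. split; auto. split; auto. apply Carg_Re_sqr. specialize (HR n); lra. apply (rs_arg _ _ _ H). }
  split; auto. apply (ex_series_inv_mod2 c); auto. apply (rs_cv _ _ _ H).
Qed.

(** * Sectors, cones and asymptotic expansions *)

Lemma quot_bounds z : 0 < Cmod z -> -1 <= Re z / Cmod z <= 1.
Proof.
  intros H. generalize (re_le_Cmod z). intros A. apply Rabs_le_between in A.
  split; [apply le_div_r|apply le_div_l]; lra.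
Qed.

Lemma Rabs_Carg z : Rabs (Carg z) = acos (Re z / Cmod z).
Proof.
  unfold Carg. destruct (acos_bound (Re z / Cmod z)).
  destruct (Rle_dec 0 (Im z)); [|rewrite Rabs_Ropp]; apply Rabs_pos_eq; auto.
Qed.

Lemma sector_cone eps z : 0 < eps < PI / 2 -> 0 < Cmod z -> sector eps z -> sin eps * Cmod z <= Re z.
Proof.
  intros He Hz H. unfold sector in H. rewrite Rabs_Carg in H.
  assert (HPI := PI_RGT_0).
  assert (Hq := quot_bounds z Hz). destruct (acos_bound (Re z / Cmod z)) as [B1 B2].
  assert (A : cos (PI / 2 - eps) <= cos (acos (Re z / Cmod z))) by (apply cos_decr_1; lra).
  rewrite cos_shift, cos_acos in A by auto.
  apply Rmult_le_compat_r with (r := Cmod z) in A; [|lra].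
  replace (Re z / Cmod z * Cmod z) with (Re z) in A by (field; lra). auto.
Qed.

Lemma cone_sector k z : 0 < k < 1 -> 0 < Cmod z -> k * Cmod z <= Re z -> sector (asin k) z.
Proof.
  intros Hk Hz H. unfold sector. rewrite Rabs_Carg.
  assert (Hq := quot_bounds z Hz).
  destruct (acos_bound (Re z / Cmod z)) as [B1 B2].
  rewrite (acos_asin (Re z / Cmod z)) in * by auto.
  assert (HPI := PI_RGT_0).
  destruct (asin_bound k) as [C1 C2]. destruct (asin_bound (Re z / Cmod z)) as [D1 D2].
  apply Rplus_le_compat_l, Ropp_le_contravar.
  apply Rnot_lt_le. intros Hlt.
  apply (sin_increasing_1) in Hlt; try lra.
  rewrite !sin_asin in Hlt by lra.
  apply Rmult_lt_compat_r with (r := Cmod z) in Hlt; auto.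
  replace (Re z / Cmod z * Cmod z) with (Re z) in Hlt by (field; lra). lra.
Qed.

Lemma asin_range k : 0 < k < 1 -> 0 < asin k < PI / 2.
Proof.
  intros Hk. assert (HPI := PI_RGT_0). destruct (asin_bound k) as [C1 C2].
  assert (E := sin_asin k ltac:(lra)). split.
  - apply Rnot_le_lt. intros Hle.
    assert (sin (asin k) <= sin 0) by (apply sin_incr_1; lra). rewrite sin_0 in H. lra.
  - destruct C2 as [|C2]; auto. rewrite C2, sin_PI2 in E. lra.
Qed.

Lemma locally_C_ball (l : C) (P : C -> Prop) : locally l P ->
  exists d, 0 < d /\ forall w : C, Cmod (w - l)%C < d -> P w.
Proof.
  intros [d Hd]. exists d. split. apply cond_pos.
  intros w Hw. apply Hd. split; [|]; simpl.
  - change (Rabs (Re w - Re l) < d). rewrite <- Re_minus. eapply Rle_lt_trans. apply re_le_Cmod. auto.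
  - change (Rabs (Im w - Im l) < d). rewrite <- Im_minus. eapply Rle_lt_trans. apply im_le_Cmod. auto.
Qed.

Lemma locally_C_intro (l : C) (P : C -> Prop) d : 0 < d -> (forall w : C, Cmod (w - l)%C < d -> P w) ->
  locally l P.
Proof.
  intros Hd H. assert (Hd2 : 0 < d / 2) by lra. exists (mkposreal _ Hd2).
  intros w [H1 H2]. apply H. 
  change (Rabs (Re w - Re l) < d / 2) in H1. change (Rabs (Im w - Im l) < d / 2) in H2.
  eapply Rle_lt_trans. apply Cmod_le_abs. reim. lra.
Qed.

Lemma Csub_0_r (z : C) : (z - 0)%C = z.
Proof. ring. Qed.

(** Of the limit 0 only the bound 1 is kept; since [N] is arbitrary, the order lost can be recovered
    by a longer truncation. *)
Lemma asymp_bound f b N k : asymp f b -> 0 < k < 1 ->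
  exists r, 1 <= r /\ forall z, Dom k r z -> Cmod (f z - sum_n (fun n => b n / z ^ n) N)%C <= 1 / Cmod z ^ N.
Proof.
  intros H Hk. specialize (H N (asin k) (asin_range k Hk)).
  specialize (H (fun w => Cmod (w - 0)%C < 1) (locally_C_intro 0 _ 1 ltac:(lra) (fun w Hw => Hw))).
  destruct H as [M HM]. exists (Rmax 1 (M + 1)). split. apply Rmax_l.
  intros z [Hz1 Hz2].
  assert (Hz3 : 1 <= Cmod z) by (eapply Rle_trans; [apply Rmax_l|exact Hz2]).
  assert (Hz4 : M + 1 <= Cmod z) by (eapply Rle_trans; [apply Rmax_r|exact Hz2]).
  specialize (HM z ltac:(lra)). cbv beta in HM.
  assert (HS := HM (cone_sector k z Hk ltac:(lra) Hz1)).
  rewrite Csub_0_r in HS.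
  rewrite Cmod_mult, Cmod_pow in HS. 
  apply le_div_r. apply pow_lt; lra. left. exact HS.
Qed.

(** The exponent [S N] yields the vanishing limit in [asymp] at order [N] directly; [r] and [K] may
    depend on the order and on the cone. *)
Definition negligible (f : C -> C) : Prop := forall N k, 0 < k < 1 ->
  exists r K, 1 <= r /\ 0 <= K /\ forall z, Dom k r z -> Cmod (f z) <= K / Cmod z ^ S N.

Lemma negligible_asymp f : negligible f -> asymp f (fun _ => RtoC 0).
Proof.
  intros H N eps He P HP.
  destruct (locally_C_ball _ _ HP) as [d [Hd HPd]].
  assert (Hk : 0 < sin eps < 1).
  { assert (HPI := PI_RGT_0). split. apply sin_gt_0; lra.
    rewrite <- sin_PI2. apply sin_increasing_1; lra. }
  destruct (H N (sin eps) Hk) as [r [K [Hr [HK Hb]]]].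
  exists (Rmax r (K / d + 1)). intros z Hz HS.
  assert (Hz1 : r < Cmod z) by (eapply Rle_lt_trans; [apply Rmax_l|exact Hz]).
  assert (Hz2 : K / d + 1 < Cmod z) by (eapply Rle_lt_trans; [apply Rmax_r|exact Hz]).
  apply HPd.
  assert (E : sum_n (fun n => (RtoC 0 / z ^ n)%C) N = RtoC 0).
  { rewrite sum_n_Csum. generalize (S N). induction n; simpl; auto. rewrite IHn. unfold Cdiv. ring. }
  rewrite E.
  replace ((f z - 0) * z ^ N - 0)%C with (f z * z ^ N)%C by ring.
  rewrite Cmod_mult, Cmod_pow.
  assert (HD : Dom (sin eps) r z) by (split; [apply sector_cone; auto; lra|lra]).
  specialize (Hb z HD).
  assert (Hp : 0 < Cmod z ^ N) by (apply pow_lt; lra).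
  apply Rle_lt_trans with (K / Cmod z ^ S N * Cmod z ^ N). apply Rmult_le_compat_r; lra.
  replace (K / Cmod z ^ S N * Cmod z ^ N) with (K / Cmod z) by (simpl; field; lra).
  apply Rmult_lt_reg_r with (Cmod z). lra. replace (K / Cmod z * Cmod z) with K by (field; lra).
  apply Rlt_le_trans with (d * (K / d + 1)).
  replace (d * (K / d + 1)) with (K + d) by (field; lra). lra.
  apply Rmult_le_compat_l; lra.
Qed.

(** Passes from [z] to [s = z + 1/2]. Halving [k] absorbs the translation as soon as
    [k * Cmod s >= 2], and doubling [r] absorbs its effect on the modulus. *)
Lemma negligible_shift f : negligible f -> negligible (fun s => f (s - RtoC (1 / 2))%C).
Proof.
  intros H N k Hk. destruct (H N (k / 2) ltac:(lra)) as [r [K [Hr [HK Hb]]]].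
  exists (Rmax (2 * r) (2 / k)), (K * 2 ^ S N).
  assert (HM1 := Rmax_l (2 * r) (2 / k)). assert (HM2 := Rmax_r (2 * r) (2 / k)).
  split. lra. split. apply Rmult_le_pos; [lra|apply pow_le; lra].
  intros s [Hs1 Hs2].
  assert (A1 : 2 <= k * Cmod s).
  { apply Rle_trans with (k * (2 / k)). right; field; lra. apply Rmult_le_compat_l; lra. }
  assert (A2 := Cmod_minus_ge s (RtoC (1 / 2))). assert (A3 := Cmod_minus_le s (RtoC (1 / 2))).
  rewrite Cmod_R_pos in A2, A3 by lra.
  assert (HD : Dom (k / 2) r (s - RtoC (1 / 2))%C).
  { split. reim. nra. lra. }
  eapply Rle_trans. apply Hb; auto. unfold Rdiv. rewrite Rmult_assoc. apply Rmult_le_compat_l; auto.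
  replace (2 ^ S N * / Cmod s ^ S N) with (/ ((Cmod s / 2) ^ S N)).
  2: { unfold Rdiv. rewrite Rpow_mult_distr, pow_inv. field. split; apply pow_nonzero; lra. }
  apply Rinv_le_contravar. apply pow_lt; lra. apply pow_incr; lra.
Qed.

Lemma negligible_ext f g : (exists M, forall k z, 0 < k < 1 -> M < k * Cmod z -> k * Cmod z <= Re z -> f z = g z) ->
  negligible f -> negligible g.
Proof.
  intros [M HM] H N k Hk. destruct (H N k Hk) as [r [K [Hr [HK Hb]]]].
  exists (Rmax r ((Rabs M + 1) / k)), K. split. eapply Rle_trans. exact Hr. apply Rmax_l. split; auto.
  intros z [Hz1 Hz2].
  assert (A1 : r <= Cmod z) by (eapply Rle_trans; [apply Rmax_l|exact Hz2]).
  assert (A2 : (Rabs M + 1) / k <= Cmod z) by (eapply Rle_trans; [apply Rmax_r|exact Hz2]).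
  rewrite <- (HM k); auto. apply Hb. split; auto.
  apply Rmult_le_compat_l with (r := k) in A2; [|lra].
  replace (k * ((Rabs M + 1) / k)) with (Rabs M + 1) in A2 by (field; lra).
  generalize (Rle_abs M). lra.
Qed.

Lemma Cexp_minus_1 w : Cmod w <= 1 -> Cmod (Cexp w - 1)%C <= 3 * Cmod w.
Proof.
  intros H.
  generalize (path_mvt (fun t => Cexp (RtoC t * w)) (fun t => w * Cexp (RtoC t * w))%C (3 * Cmod w)).
  replace (RtoC 1 * w)%C with w by ring. replace (RtoC 0 * w)%C with (RtoC 0) by ring. rewrite Cexp_0.
  intros HP; apply HP.
  - intros t _. split; apply is_derive_Reals.
    + apply (is_derive_ext (fun t => exp (t * Re w) * cos (t * Im w))).
      { intros s. unfold Cexp. simpl. unfold Re, Im. f_equal; f_equal; ring. }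
      reim. unfold Cexp. auto_derive; auto. reim. simpl.
      replace (t * Re w - 0 * Im w) with (t * Re w) by ring. replace (t * Im w + 0 * Re w) with (t * Im w) by ring. ring.
    + apply (is_derive_ext (fun t => exp (t * Re w) * sin (t * Im w))).
      { intros s. unfold Cexp. simpl. unfold Re, Im. f_equal; f_equal; ring. }
      reim. unfold Cexp. auto_derive; auto. reim. simpl.
      replace (t * Re w - 0 * Im w) with (t * Re w) by ring. replace (t * Im w + 0 * Re w) with (t * Im w) by ring. ring.
  - intros t Ht. rewrite Cmod_mult, Cmod_Cexp, Rmult_comm. apply Rmult_le_compat_r. apply Cmod_ge_0.
    apply Rle_trans with (exp 1); [|apply exp_le_3].
    assert (Re (RtoC t * w)%C <= 1).
    { eapply Rle_trans. apply Re_le_Cmod. rewrite Cmod_mult, Cmod_R_pos by lra.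
      generalize (Cmod_ge_0 w). nra. }
    destruct H0 as [H0|H0]. left; apply exp_increasing; auto. rewrite H0; lra.
Qed.

Lemma negligible_Cexp f : negligible f -> negligible (fun s => Cexp (f s) - 1)%C.
Proof.
  intros H N k Hk. destruct (H N k Hk) as [r [K [Hr [HK Hb]]]].
  exists (Rmax r K), (3 * K). assert (HM1 := Rmax_l r K). assert (HM2 := Rmax_r r K).
  split. lra. split. lra. intros z [Hz1 Hz2].
  assert (A : Cmod (f z) <= K / Cmod z ^ S N) by (apply Hb; split; lra).
  assert (Hp : Cmod z <= Cmod z ^ S N).
  { rewrite <- (pow_1 (Cmod z)) at 1. apply Rle_pow. lra. lia. }
  eapply Rle_trans. apply Cexp_minus_1.
  - eapply Rle_trans. exact A. apply le_div_l; lra.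
  - replace (3 * K / Cmod z ^ S N) with (3 * (K / Cmod z ^ S N)) by (unfold Rdiv; ring). lra.
Qed.

(** * Branches of the logarithm *)

Lemma Cder_ex_derive f z l : Cder f z l -> ex_derive (K := C_AbsRing) (V := C_NormedModule) f z.
Proof.
  intros H. exists l. split. apply is_linear_scal_l.
  intros x Hx. apply (is_filter_lim_locally_unique (V := AbsRing_NormedModule C_AbsRing)) in Hx. subst x.
  intros eps. destruct (H eps (cond_pos eps)) as [d [Hd H']].
  exists (mkposreal d Hd). intros y Hy. 
  change (Cmod (y - z)%C < d) in Hy.
  change (Cmod (f y - f z - (y - z) * l)%C <= eps * Cmod (y - z)%C).
  specialize (H' (y - z)%C Hy).
  assert (E1 : forall w : C, (z + (w - z))%C = w) by (intros; ring).
  assert (E2 : forall w : C, (w * l)%C = (l * w)%C) by (intros; ring).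
  rewrite E1 in H'. rewrite E2. exact H'.
Qed.

Lemma ex_derive_Cder f z : ex_derive (K := C_AbsRing) (V := C_NormedModule) f z -> exists l, Cder f z l.
Proof.
  intros [l [_ H]]. exists l. intros e He.
  destruct (H z (fun P HP => HP) (mkposreal e He)) as [d Hd].
  exists d. split. apply cond_pos. intros h Hh.
  assert (Hb : ball (M := AbsRing_UniformSpace C_AbsRing) z d (z + h)%C).
  { change (Cmod (z + h - z)%C < d). replace (z + h - z)%C with h by ring. auto. }
  specialize (Hd _ Hb).
  change (Cmod (f (z + h) - f z - (z + h - z) * l)%C <= e * Cmod (z + h - z)%C) in Hd.
  replace (z + h - z)%C with h in Hd by ring.
  replace (f (z + h) - f z - l * h)%C with (f (z + h) - f z - h * l)%C by ring. exact Hd.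
Qed.

Lemma cos_eq_1_large v : cos v = 1 -> v <> 0 -> PI < Rabs v.
Proof.
  intros Hc Hv. apply Rnot_le_lt. intros Hle.
  assert (HPI := PI_RGT_0).
  assert (E : cos (Rabs v) = 1) by (unfold Rabs; destruct (Rcase_abs v); [rewrite cos_neg|]; auto).
  assert (A := Rabs_pos_lt _ Hv).
  assert (cos (Rabs v) < cos 0) by (apply cos_decreasing_1; lra).
  rewrite cos_0 in H. lra.
Qed.

(** The difference [D] of two branches has [Re D = 0] and [cos (Im D) = 1], and vanishes on the real
    axis. Were it non-zero at [s], then [Im D] would exceed [PI] in absolute value there. On the
    vertical segment from [Re s] it would then pass through [PI] or [- PI], where the cosine is
    [-1]. *)
Lemma is_log_branch_unique a f L1 L2 : is_log_branch a f L1 -> is_log_branch a f L2 ->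
  forall s : C, a < Re s -> L1 s = L2 s.
Proof.
  intros [D1 [E1 I1]] [D2 [E2 I2]].
  set (D := fun s => (L1 s - L2 s)%C).
  assert (HE : forall s : C, a < Re s -> Cexp (D s) = 1%C).
  { intros s Hs. unfold D. rewrite Cexp_minus, E1, E2 by auto. rewrite <- (E1 s Hs).
    generalize (Cexp_neq0 (L1 s)). intros. field. auto. }
  assert (HR : forall s : C, a < Re s -> Re (D s) = 0 /\ cos (Im (D s)) = 1).
  { intros s Hs. specialize (HE s Hs).
    assert (M := f_equal Cmod HE). rewrite Cmod_Cexp, Cmod_1 in M.
    assert (R0 : Re (D s) = 0) by (rewrite <- (ln_exp (Re (D s))), M; apply ln_1).
    split; auto. apply (f_equal Re) in HE.
    change (exp (Re (D s)) * cos (Im (D s)) = 1) in HE. rewrite R0, exp_0 in HE. lra. }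
  assert (HC : forall s : C, a < Re s -> exists l, Cder D s l).
  { intros s Hs. destruct (ex_derive_Cder _ _ (D1 s Hs)) as [l1 H1]. destruct (ex_derive_Cder _ _ (D2 s Hs)) as [l2 H2].
    exists (l1 - l2)%C. apply Cder_minus; auto. }
  intros s Hs. 
  assert (HD : D s = 0%C).
  2: { unfold D in HD. replace (L1 s) with (L1 s - L2 s + L2 s)%C by ring. rewrite HD. ring. }
  apply C_eq; [apply HR; auto|]. simpl.
  destruct (Req_dec (Im (D s)) 0) as [|Hn]; auto. exfalso.
  assert (HPI := PI_RGT_0).
  set (p := fun t => (RtoC (Re s) + RtoC t * (Ci * RtoC (Im s)))%C).
  assert (Hp : forall t, a < Re (p t)) by (intros; unfold p; reim; lra).
  assert (Hp0 : p 0 = RtoC (Re s)) by (unfold p; ring).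
  assert (Hp1 : p 1 = s) by (unfold p; apply C_eq; reim; ring).
  (* The square lets one application of the intermediate value theorem serve both signs of
     [Im D]. *)
  set (psi := fun t => Im (D (p t)) * Im (D (p t)) - PI * PI).
  assert (Hcont : continuity psi).
  { intros t. destruct (HC _ (Hp t)) as [l Hl].
    apply derivable_continuous_pt.
    destruct (Cder_path D (RtoC (Re s)) (Ci * RtoC (Im s))%C l t Hl) as [_ HI].
    apply derivable_pt_minus; [|apply derivable_pt_const].
    apply derivable_pt_mult; eexists; exact HI. }
  destruct (IVT psi 0 1 Hcont) as [t [Ht1 Ht2]]; [lra| | |].
  - unfold psi. rewrite Hp0. unfold D. reim. rewrite I1, I2 by auto. nra.
  - unfold psi. rewrite Hp1. 
    assert (A := cos_eq_1_large _ (proj2 (HR s Hs)) Hn).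
    revert A. unfold Rabs. destruct (Rcase_abs (Im (D s))); intros; nra.
  - assert (A := proj2 (HR _ (Hp t))). unfold psi in Ht2.
    set (v := Im (D (p t))) in *.
    assert (B : (v - PI) * (v + PI) = 0) by lra.
    apply Rmult_integral in B. destruct B as [B|B].
    + replace v with PI in A by lra. rewrite cos_PI in A. lra.
    + replace v with (- PI) in A by lra. rewrite cos_neg, cos_PI in A. lra.
Qed.

(** * The logarithm of the zeta function of a Riemann sequence *)

Definition logZ (c : R) (alpha : nat -> C) (z : C) : C :=
  (Pf c alpha z - Qf (B_const alpha) z)%C.

Lemma Pf_expansion E B alpha c n k : Riemann_sequence E B alpha ->
  (forall n, Rabs (Im (alpha n)) < c) -> 0 < k < 1 ->
  exists l r K, 1 <= r /\ 0 <= K /\ c + 1 <= k * r /\ forall z, Dom k r z ->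
    Cmod (Pf c alpha z - EN (coef_a E B) 0 (S n) z - l)%C <= K / Cmod z ^ S n.
Proof.
  intros H Hc Hk. assert (Hg := good_Riemann E B alpha c H Hc).
  assert (Hc0 := good_pos _ _ (proj1 Hg O)).
  (* Order [n + 2] for the derivative, since integration loses one power; it matches the [n + 2]
     coefficients in [EN1 a (S n)]. *)
  destruct (asymp_bound _ _ (S (S n)) k (rs_asymp _ _ _ H) Hk) as [r1 [Hr1 H1]].
  set (r := Rmax r1 ((c + 1) / k)).
  assert (Hra : r1 <= r) by apply Rmax_l. assert (Hrb : (c + 1) / k <= r) by apply Rmax_r.
  assert (Hrk : c + 1 <= k * r).
  { apply Rmult_le_compat_l with (r := k) in Hrb; [|lra].
    replace (k * ((c + 1) / k)) with (c + 1) in Hrb by (field; lra). auto. }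
  assert (Hre : forall z, Dom k r z -> c + 1 <= Re z).
  { intros z [A1 A2]. assert (k * r <= k * Cmod z) by (apply Rmult_le_compat_l; lra). lra. }
  set (a := coef_a E B) in *.
  destruct (Dom_int k r 1 n (fun z => Pf c alpha z - EN a 0 (S n) z)%C
    (fun z => CSeries (zeta_sum_term alpha z) - EN1 a (S n) z)%C) as [l [K [HK HB]]]; try lra.
  - intros z Hz. apply Cder_minus. apply Pf_der; auto. specialize (Hre z Hz). lra.
    apply Cder_EN. specialize (Hre z Hz). lra.
  - intros z Hz. assert (Hz' := Hre z Hz).
    assert (Hz0 : z <> RtoC 0) by (apply Cneq0_re; lra).
    assert (A := H1 z (conj (proj1 Hz) (Rle_trans _ _ _ Hra (proj2 Hz)))). cbv beta in A.
    replace (CSeries (zeta_sum_term alpha z) - EN1 a (S n) z)%C with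
     (CSeries (zeta_sum_term alpha z) - RtoC (1 / 2) * Clog (z / RtoC (2 * PI)) - sum_n (fun n => RtoC (a n) / z ^ n) (S (S n)))%C; auto.
    rewrite sum_n_Csum. unfold EN1.
    assert (HPI := PI_RGT_0).
    rewrite Clog_div_R by lra.
    rewrite (Csum_ext (fun k => RtoC (a (S k)) * (/ z) ^ S k)%C (fun k => (fun k => RtoC (a k) / z ^ k) (S k))%C).
    + rewrite (Csum_shift (fun k => RtoC (a k) / z ^ k)%C). cbn [Cpow].
      (* [coef_a] is 0 at index 0, so the expansion in (e) may start at 1. *)
      replace (RtoC (a O)) with (RtoC 0) by reflexivity. field. auto.
    + intros j _. rewrite Cpow_inv by auto. reflexivity.
  - exists l, r, K. split; [lra|]. auto.
Qed.

Lemma EN_const a b n z : EN a b n z = (EN a 0 n z + RtoC b)%C.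
Proof. unfold EN. ring. Qed.

Lemma EN_real a n x : 0 < x -> EN a 0 n (RtoC x) =
  RtoC (x / 2 * ln (x / (2 * PI)) - x / 2 + a 1%nat * ln x - Rsum (fun k => a (S (S k)) / INR (S k) * (/ x) ^ S k) n).
Proof.
  intros Hx. assert (HPI := PI_RGT_0). unfold EN. rewrite Clog_R by auto. rewrite ln_div by lra.
  assert (E : Csum (fun k => RtoC (a (S (S k)) / INR (S k)) * (/ RtoC x) ^ S k)%C n =
    RtoC (Rsum (fun k => a (S (S k)) / INR (S k) * (/ x) ^ S k) n)).
  { induction n. reflexivity. cbn [Csum Rsum]. rewrite IHn.
    rewrite <- RtoC_inv by lra. rewrite <- RtoC_pow, <- RtoC_mult, <- RtoC_plus. reflexivity. }
  rewrite E. apply C_eq; reim; field.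
Qed.

Lemma Rsum_inv_lim (b : nat -> R) n : exists K, 0 <= K /\ forall x, 1 <= x ->
  Rabs (Rsum (fun k => b k * (/ x) ^ S k) n) <= K / x.
Proof.
  induction n.
  - exists 0. split. lra. intros. simpl. rewrite Rabs_R0. lra.
  - destruct IHn as [K [HK H]]. exists (K + Rabs (b n)). split. generalize (Rabs_pos (b n)); lra.
    intros x Hx. cbn [Rsum]. eapply Rle_trans. apply Rabs_triang.
    unfold Rdiv. rewrite Rmult_plus_distr_r. apply Rplus_le_compat. apply H; auto.
    rewrite Rabs_mult. apply Rmult_le_compat_l. apply Rabs_pos.
    assert (0 < / x) by (apply Rinv_0_lt_compat; lra).
    rewrite Rabs_pos_eq by (apply pow_le; lra). rewrite pow_inv. apply Rinv_le_contravar. lra.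
    rewrite <- (pow_1 x) at 1. apply Rle_pow. lra. lia.
Qed.

(** The bound is read on the real axis. The imaginary part of [l] vanishes because [Pf] and [EN] are
    real there. The real part is the limit defining [B_const]; the same estimate shows that this
    limit exists, so that the total operator [Lim] returns it. *)
Lemma Pf_const E B alpha c n k l r K : Euler_numbers E -> Riemann_sequence E B alpha ->
  (forall n, Rabs (Im (alpha n)) < c) -> 0 < k < 1 -> 1 <= r -> 0 <= K -> c + 1 <= k * r ->
  (forall z, Dom k r z ->
    Cmod (Pf c alpha z - EN (coef_a E B) 0 (S n) z - l)%C <= K / Cmod z ^ S n) ->
  l = RtoC (B_const alpha).
Proof.
  intros HE H Hc Hk Hr HK Hkr HB. assert (Hg := good_Riemann E B alpha c H Hc).
  assert (Hc0 := good_pos _ _ (proj1 Hg O)).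
  set (a := coef_a E B) in *.
  assert (Ha1 : a 1%nat = 7 / 4) by (apply coef_a_1; auto).
  destruct (Rsum_inv_lim (fun k => a (S (S k)) / INR (S k)) (S n)) as [K2 [HK2 H2]].
  assert (Hx : forall x, r <= x -> c + 1 <= x /\ Cmod (Pf c alpha (RtoC x) - EN a 0 (S n) (RtoC x) - l)%C <= K / x).
  { intros x Hx. split. nra.
    eapply Rle_trans. apply HB. split; rewrite Cmod_R_pos by lra; [rewrite Re_RtoC; nra|lra].
    rewrite Cmod_R_pos by lra. apply Rmult_le_compat_l; auto. apply Rinv_le_contravar. lra.
    rewrite <- (pow_1 x) at 1. apply Rle_pow. lra. lia. }
  assert (Him : Im l = 0).
  { apply Rabs_eq_0. apply Rle_antisym; [|apply Rabs_pos]. apply le_epsilon. intros e He.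
    set (x := Rmax r (K / e)). assert (X1 : r <= x) by apply Rmax_l. assert (X2 : K / e <= x) by apply Rmax_r.
    destruct (Hx x X1) as [A1 A2]. assert (A3 := Rle_trans _ _ _ (im_le_Cmod _) A2).
    rewrite EN_real in A3 by lra. revert A3. reim. rewrite (Pf_real c alpha x Hg (rs_mult _ _ _ H)) by lra.
    intros A3.
    replace (0 - 0 - Im l) with (- Im l) in A3 by ring. rewrite Rabs_Ropp in A3.
    assert (K / x <= e).
    { apply le_div_l. lra. apply Rmult_le_compat_r with (r := e) in X2; [|lra].
      replace (K / e * e) with K in X2 by (field; lra). lra. }
    lra. }
  apply C_eq; [|rewrite Him; reflexivity]. rewrite Re_RtoC.
  unfold B_const. rewrite (is_lim_unique _ p_infty (Re l)). reflexivity.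
  apply is_lim_spec. intros eps. 
  exists (Rmax r ((K + K2) / eps + 1)). intros x X.
  assert (X1 : r < x) by (eapply Rle_lt_trans; [apply Rmax_l|exact X]).
  assert (X2 : (K + K2) / eps + 1 < x) by (eapply Rle_lt_trans; [apply Rmax_r|exact X]).
  destruct (Hx x ltac:(lra)) as [A1 A2]. assert (A3 := Rle_trans _ _ _ (re_le_Cmod _) A2).
  rewrite EN_real in A3 by lra. rewrite !Re_minus, Re_RtoC in A3.
  rewrite <- (Pf_re c) by (auto; lra). rewrite Ha1 in A3.
  specialize (H2 x ltac:(lra)). cbv beta in H2.
  set (S0 := Rsum _ _) in *.
  match goal with |- Rabs ?e < _ => replace e with
    ((Re (Pf c alpha (RtoC x)) - (x / 2 * ln (x / (2 * PI)) - x / 2 + 7 / 4 * ln x - S0) - Re l) - S0) by ring end.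
  assert (He := cond_pos eps).
  apply Rle_lt_trans with (K / x + K2 / x).
  { eapply Rle_trans. apply Rabs_triang. rewrite Rabs_Ropp. lra. }
  replace (K / x + K2 / x) with ((K + K2) / x) by (field; lra).
  apply Rmult_lt_reg_r with x. lra. replace ((K + K2) / x * x) with (K + K2) by (field; lra).
  apply Rlt_le_trans with (eps * ((K + K2) / eps + 1)).
  replace (eps * ((K + K2) / eps + 1)) with (K + K2 + eps) by (field; lra). lra.
  apply Rmult_le_compat_l; lra.
Qed.

Lemma logZ_negligible E B alpha c : Euler_numbers E -> Bernoulli_numbers B -> Riemann_sequence E B alpha ->
  (forall n, Rabs (Im (alpha n)) < c) -> negligible (logZ c alpha).
Proof.
  intros HE HB H Hc n k Hk.
  destruct (Pf_expansion E B alpha c n k H Hc Hk) as [l [r1 [K1 [Hr1 [HK1 [Hk1 H1]]]]]].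
  assert (El := Pf_const E B alpha c n k l r1 K1 HE H Hc Hk Hr1 HK1 Hk1 H1). subst l.
  (* Index [S n], so that both truncations are the same [EN]; the surplus power in the bound for
     [Qf] is dropped at the end. Taking [Bc = B_const alpha], as in the definition of [Xi0], makes
     the constants agree. *)
  destruct (Qf_bound E B (B_const alpha) (S n) k HE HB ltac:(lra)) as [r2 [K2 [Hr2 [HK2 H2]]]].
  exists (Rmax r1 r2), (K1 + K2). assert (M1 := Rmax_l r1 r2). assert (M2 := Rmax_r r1 r2).
  split. lra. split. lra. intros z [Hz1 Hz2].
  assert (A1 := H1 z (conj Hz1 (Rle_trans _ _ _ M1 Hz2))).
  assert (A2 := H2 z (conj Hz1 (Rle_trans _ _ _ M2 Hz2))).
  rewrite EN_const in A2.
  unfold logZ. set (b := RtoC (B_const alpha)) in *.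
  replace (Pf c alpha z - Qf (B_const alpha) z)%C with
    ((Pf c alpha z - EN (coef_a E B) 0 (S n) z - b) - (Qf (B_const alpha) z - (EN (coef_a E B) 0 (S n) z + b)))%C by ring.
  eapply Rle_trans. apply Cmod_minus_le. unfold Rdiv. rewrite Rmult_plus_distr_r. apply Rplus_le_compat; auto.
  eapply Rle_trans. exact A2. apply Rmult_le_compat_l; auto. apply Rinv_le_contravar.
  apply pow_lt; lra. apply Rle_pow. lra. lia.
Qed.

Lemma Cexp_logZ alpha c s : good_seq c alpha -> 1 / 2 + Rmax c (1 / 2) < Re s ->
  Cexp (logZ c alpha (s - RtoC (1 / 2))%C) = zeta alpha s.
Proof.
  intros Hg Hs. assert (M1 := Rmax_l c (1 / 2)). assert (M2 := Rmax_r c (1 / 2)).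
  unfold logZ. unfold Cminus at 1. rewrite Cexp_plus, Cexp_Pf, Cexp_Qf by (auto; reim; lra).
  replace (s - RtoC (1 / 2) + RtoC (1 / 2))%C with s by ring.
  unfold zeta, Xi0. ring.
Qed.

Lemma logZ_branch E B alpha c : Riemann_sequence E B alpha -> (forall n, Rabs (Im (alpha n)) < c) ->
  is_log_branch (1 / 2 + Rmax c (1 / 2)) (zeta alpha) (fun s => logZ c alpha (s - RtoC (1 / 2))%C).
Proof.
  intros H Hc. assert (Hg := good_Riemann E B alpha c H Hc).
  assert (M1 := Rmax_l c (1 / 2)). assert (M2 := Rmax_r c (1 / 2)).
  split; [|split].
  - intros s Hs. destruct (Qf_der (B_const alpha) (s - RtoC (1 / 2))%C) as [l Hl]. reim; lra.
    eapply Cder_ex_derive. unfold logZ.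
    apply (Cder_shift (fun z => Pf c alpha z - Qf (B_const alpha) z)%C). apply Cder_minus.
    apply Pf_der; auto. fold (s - RtoC (1 / 2))%C. reim; lra. exact Hl.
  - intros s Hs. apply Cexp_logZ; auto.
  - intros x Hx. rewrite <- RtoC_minus. unfold logZ. rewrite Im_minus, (Pf_real c alpha _ Hg (rs_mult _ _ _ H)), Qf_real by lra. ring.
Qed.

Theorem theorem22 :
  forall (E B : nat -> R),
  Euler_numbers E -> Bernoulli_numbers B ->
  forall (alpha : nat -> C),
  Riemann_sequence E B alpha ->
  (forall c : R, (forall n : nat, Rabs (Im (alpha n)) < c) ->
     let a := 1 / 2 + Rmax c (1 / 2) in
     (exists logzeta : C -> C, is_log_branch a (zeta alpha) logzeta) /\
     (forall logzeta : C -> C, is_log_branch a (zeta alpha) logzeta ->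
        asymp logzeta (fun _ => RtoC 0))) /\
  asymp (fun s => (zeta alpha s - 1)%C) (fun _ => RtoC 0).
Proof.
  intros E B HE HB alpha H. split.
  - intros c Hc a. assert (HL := logZ_branch E B alpha c H Hc). split. eexists; exact HL.
    intros L HL'. apply negligible_asymp.
    apply negligible_ext with (fun s => logZ c alpha (s - RtoC (1 / 2))%C).
    (* An arbitrary branch coincides with the constructed one on the half-plane, which contains the
       far part of every cone. *)
    + exists a. intros k z _ H1 H2. apply (is_log_branch_unique a (zeta alpha) (fun s => logZ c alpha (s - RtoC (1 / 2))%C) L); auto. lra.
    + apply (negligible_shift (logZ c alpha)). apply (logZ_negligible E B); auto.
  - destruct (rs_strip _ _ _ H) as [c Hc]. apply negligible_asymp.
    apply negligible_ext with (fun s => Cexp (logZ c alpha (s - RtoC (1 / 2))) - 1)%C.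
    + exists (1 / 2 + Rmax c (1 / 2)). intros k z _ H1 H2. rewrite Cexp_logZ; auto.
      apply (good_Riemann E B); auto. lra.
    + apply (negligible_Cexp (fun s => logZ c alpha (s - RtoC (1 / 2))%C)). apply (negligible_shift (logZ c alpha)). apply (logZ_negligible E B); auto.
Qed.
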